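(* Let $\Omega\subset\mathbb{R}^n$ be a bounded domain with boundary conditions such that $-\Delta$ has strictly positive eigenvalues, let $\alpha\in(0,1)\cup(1,2)$, and let $u_\gamma(x,t)$ denote the solution of the time-fractional diffusion problem with index $\gamma$, order $\alpha$ and initial data $v_\gamma\in L_2(\Omega)$, as specified in the context. Then the following limits hold in $L_2(\Omega)$ as $t\to\infty$ (each for those $\alpha$ for which $u_\gamma$ is defined, i.e. $\alpha\in(0,1)\cup(1,2)$ for $\gamma=0$ and $\gamma=\alpha-1$, and $\alpha\in(1,2)$ for $\gamma=1$ and $\gamma=\alpha-2$): $$t^{\alpha}\,u_0(\cdot,t)\longrightarrow \frac{1}{\Gamma(1-\alpha)}(-\Delta)^{-1}v_0,$$ $$t^{\alpha-1}\,u_1(\cdot,t)\longrightarrow \frac{1}{\Gamma(2-\alpha)}(-\Delta)^{-1}v_1,$$ $$t^{\alpha+1}\,u_{\alpha-1}(\cdot,t)\longrightarrow -\frac{1}{\Gamma(-\alpha)}(-\Delta)^{-2}v_{\alpha-1},$$ $$t^{\alpha+2}\,u_{\alpha-2}(\cdot,t)\longrightarrow -\frac{1}{\Gamma(-1-\alpha)}(-\Delta)^{-2}v_{\alpha-2}.$$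
   Context: Fractional operators in $t$. For $\nu>0$, the Riemann-Liouville integral is $J^\nu[f](t)=\frac1{\Gamma(\nu)}\int_0^t f(z)(t-z)^{\nu-1}\,dz$, and $J^0$ is the identity. For $\alpha>0$, the Riemann-Liouville derivative is ${}^{RL}D^\alpha[f]=\frac{d^{\lceil\alpha\rceil}}{dt^{\lceil\alpha\rceil}}J^{\lceil\alpha\rceil-\alpha}[f]$ and the Caputo derivative is ${}^{C}D^\alpha[f]=J^{\lceil\alpha\rceil-\alpha}\big[\frac{d^{\lceil\alpha\rceil}f}{dt^{\lceil\alpha\rceil}}\big]$. For $\alpha\le 0$ both are $J^{-\alpha}[f]$. The solutions $u_\gamma$. For $\alpha\in(0,1)\cup(1,2)$ and $\gamma\in\{0,1,\alpha-1,\alpha-2\}$, $u_\gamma(x,t)$ is the unique solution of $$D_t^\alpha u_\gamma-\Delta u_\gamma=0\ \text{ on }\Omega\times(0,\infty),\qquad D_t^\gamma u_\gamma|_{t=0^+}=v_\gamma,\qquad \mathcal{B}[u_\gamma]=0\ \text{ on }\partial\Omega\times(0,\infty),$$ where $v_\gamma\in L_2(\Omega)$, the initial condition $D_t^\gamma u_\gamma|_{t=0^+}=v_\gamma$ is satisfied in $L_2(\Omega)$ in the limit $t\to0^+$, and $\mathcal B$ denotes the homogeneous boundary conditions. The cases are: - $\gamma=0$ (Caputo derivative $D^\alpha_t$, $\alpha\in(0,1)\cup(1,2)$): $u_0(x,0)=v_0(x)$, and, if $\alpha>1$, $\partial_tu_0(x,0)=0$. - $\gamma=1$ (Caputo, $\alpha\in(1,2)$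 only): $\partial_tu_1(x,0)=v_1(x)$ and $u_1(x,0)=0$. - $\gamma=\alpha-1$ (Riemann-Liouville, $\alpha\in(0,1)\cup(1,2)$): ${}^{RL}D_t^{\alpha-1}[u_{\alpha-1}](x,0^+)=v_{\alpha-1}(x)$, and, if $\alpha>1$, ${}^{RL}D_t^{\alpha-2}[u_{\alpha-1}](x,0^+)=0$. - $\gamma=\alpha-2$ (Riemann-Liouville, $\alpha\in(1,2)$ only): ${}^{RL}D_t^{\alpha-2}[u_{\alpha-2}](x,0^+)=v_{\alpha-2}(x)$ and ${}^{RL}D_t^{\alpha-1}[u_{\alpha-2}](x,0^+)=0$. Spectral setting. The boundary conditions are such that $-\Delta$ on $\Omega$ has a discrete spectrum of positive eigenvalues $0<\lambda_0\le\lambda_1\le\cdots$ with an orthonormal basis of eigenfunctions $\{\phi_j\}$ of $L_2(\Omega)$. Write $\tilde f(j)=\langle f,\phi_j\rangle_{L_2(\Omega)}$. The problem is understood mode by mode: for each $j$, $\tilde u_\gamma(j,t)$ solves $D_t^\alpha\tilde u_\gamma(j,t)=-\lambda_j\tilde u_\gamma(j,t)$ with initial data $\tilde v_\gamma(j)$ (and zero for the other initial datum when $\alpha>1$). For $m=1,2$, $(-\Delta)^{-m}f=\sum_j\lambda_j^{-m}\tilde f(j)\phi_j$. *)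

(* Defs.v *)
From HB Require Import structures.
From mathcomp Require Import all_boot all_order all_algebra.
From mathcomp Require Import lra.
From mathcomp Require Import all_classical all_reals all_analysis.
From mathcomp Require Import measurable_realfun.
Set Implicit Arguments.
Unset Strict Implicit.
Unset Printing Implicit Defensive.
Import Order.TTheory GRing.Theory Num.Theory.
Import numFieldNormedType.Exports.
Local Open Scope classical_set_scope.
Local Open Scope ring_scope.

Definition rV_display : measure_display.
Proof. exact: default_measure_display. Qed.

(* 'rV[R]_n carries the Borel sigma-algebra of its (product) topology. *)
Section borel_rV.
Variables (R : realType) (n : nat).

Let borel : set (set 'rV[R]_n) := <<s open >>.

Let borel0 : borel set0.
Proof. exact: sigma_algebra0. Qed.

Let borelC A : borel A -> borel (~` A).
Proof. exact: sigma_algebraC. Qed.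

Let borel_bigcup (F : (set 'rV[R]_n)^nat) :
  (forall i, borel (F i)) -> borel (\bigcup_i F i).
Proof. exact: sigma_algebra_bigcup. Qed.

HB.instance Definition _ :=
  @isMeasurable.Build rV_display 'rV[R]_n borel borel0 borelC borel_bigcup.

End borel_rV.

Section lebesgue_tuple_succ.
Variables (R : realType) (n : nat).
Local Notation T := (measurableTypeR R).
Variable m : {sigma_finite_measure set (n.-tuple T) -> \bar R}.

Definition consT (p : T * n.-tuple T) : n.+1.-tuple T := [tuple of p.1 :: p.2].

Let mconsT : measurable_fun setT consT.
Proof. exact: measurable_cons. Qed.

Definition lebesgue_tuple_succ : set (n.+1.-tuple T) -> \bar R :=
  pushforward (lebesgue_measure \x m)%E consT.

Let leb0 : lebesgue_tuple_succ set0 = 0%E.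
Proof. exact: measure0. Qed.

Let leb_ge0 A : (0 <= lebesgue_tuple_succ A)%E.
Proof. exact: measure_ge0. Qed.

Let leb_sigma_additive : semi_sigma_additive lebesgue_tuple_succ.
Proof. exact: measure_semi_sigma_additive. Qed.

HB.instance Definition _ := isMeasure.Build _ _ _
  lebesgue_tuple_succ leb0 leb_ge0 leb_sigma_additive.

Let leb_sigma_finite : sigma_finite setT lebesgue_tuple_succ.
Proof.
have /sigma_finiteP[F [TF ndF Foo]] := sigma_finiteT (@lebesgue_measure R).
have /sigma_finiteP[G [TG ndG Goo]] := sigma_finiteT m.
pose g (t : n.+1.-tuple T) : T * n.-tuple T := (thead t, [tuple of behead t]).
have gK : cancel consT g.
  move=> [x t]; rewrite /g /consT /=.
  by congr (_, _); exact: val_inj.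
have mg : measurable_fun setT g.
  apply: measurable_fun_pair => /=.
    exact: measurable_tnth.
  exact: measurable_behead.
exists (fun k => g @^-1` (F k `*` G k)).
  rewrite -preimage_bigcup -[LHS](preimage_setT g); congr (_ @^-1` _).
  rewrite -setXTT TF TG predeqE => -[x y]; split.
    move=> [/= [i _ Fix] [k _ Gky]]; exists (maxn i k) => //; split.
    - by move: x Fix; exact/subsetPset/ndF/leq_maxl.
    - by move: y Gky; exact/subsetPset/ndG/leq_maxr.
  by move=> [k _ [/= Fkx Gky]]; split; exists k.
move=> k; have [mF Fk] := Foo k; have [mG Gk] := Goo k; split.
  by rewrite -[X in measurable X]setTI; apply: mg => //; exact: measurableX.
rewrite /lebesgue_tuple_succ /pushforward -comp_preimage.
rewrite (_ : g \o consT = id); last by apply/funext => x /=; exact: gK.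
by rewrite preimage_id product_measure1E// lte_mul_pinfty// ge0_fin_numE.
Qed.

HB.instance Definition _ := Measure_isSigmaFinite.Build _ _ _
  lebesgue_tuple_succ leb_sigma_finite.

End lebesgue_tuple_succ.

Fixpoint lebesgue_tuple (R : realType) (n : nat) :
    {sigma_finite_measure set (n.-tuple (measurableTypeR R)) -> \bar R} :=
  match n with
  | 0 => dirac [tuple]
  | k.+1 => lebesgue_tuple_succ (lebesgue_tuple R k)
  end.

Section lebesgue_rV.
Variables (R : realType) (n : nat).
Local Notation T := (measurableTypeR R).

Definition rV_of_tuple (t : n.-tuple T) : 'rV[R]_n := \row_i tnth t i.

Let rV_rat_ball (p : 'rV[rat]_n * rat) : set 'rV[R]_n :=
  ball (map_mx ratr p.1 : 'rV[R]_n) (ratr p.2 : R).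

Let open_rV_rat (U : set 'rV[R]_n) : open U ->
  U = \bigcup_(p in [set p | rV_rat_ball p `<=` U]) rV_rat_ball p.
Proof.
move=> oU; apply/seteqP; split; last by move=> x [p /= pU]; exact: pU.
move=> x Ux.
have [e /= e0 eU] : exists2 e : R, 0 < e & ball x e `<=` U.
  by move: (oU); rewrite openE => /(_ _ Ux) /nbhs_ballP [e e0 ?]; exists e.
have [r] := @rat_in_itvoo R 0 (e / 2) ltac:(lra).
rewrite in_itv/= => /andP[r0 re].
have /choice[q qP] : forall j, exists q : rat, ball (ratr q : R) (ratr r) (x ord0 j).
  move=> j.
  have [q] := @rat_in_itvoo R (x ord0 j - ratr r) (x ord0 j + ratr r)
    ltac:(by lra).
  rewrite in_itv/= => /andP[q1 q2]; exists q.
  by rewrite /ball/= ltr_norml; apply/andP; split; lra.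
exists (\row_j q j, r) => /=; last first.
  split => // i j; rewrite !mxE; rewrite (ord1 i); exact: qP.
move=> y [_ /= By]; apply: eU; split => // i j.
have := By i j; have := qP j; rewrite (ord1 i) !mxE /ball /= => h1 h2.
have -> : x ord0 j - y ord0 j =
  - (ratr (q j) - x ord0 j) + (ratr (q j) - y ord0 j) by lra.
by rewrite (le_lt_trans (ler_normD _ _))// normrN; lra.
Qed.

Let measurable_rV_of_tuple : measurable_fun setT rV_of_tuple.
Proof.
apply: (measurability (@open 'rV[R]_n)) => //.
move=> _ [U oU <-]; rewrite setTI (open_rV_rat oU) preimage_bigcup.
rewrite bigcup_mkcond; apply: countable_bigcupT_measurable => // p.
case: ifPn => // _.
have [r0|r0] := ltP 0 (ratr p.2 : R); last first.
  rewrite (_ : _ @^-1` _ = set0) //; apply/seteqP; split => // t [/= +].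
  by rewrite ltNge r0.
pose F (j : 'I_n) : set (n.-tuple T) :=
  (@tnth _ T ^~ j) @^-1` (ball (ratr (p.1 ord0 j) : R) (ratr p.2)).
rewrite (_ : _ @^-1` _ = \bigcap_(j in [set: 'I_n]) F j); last first.
  apply/seteqP; split => t /=.
    by move=> [_ tp] j _; have := tp ord0 j; rewrite !mxE.
  by move=> tp; split => // i j; rewrite (ord1 i) !mxE; exact: tp.
apply: fin_bigcap_measurable; [exact: finite_finset|move=> j _].
rewrite -[X in measurable X]setTI; apply: measurable_tnth => //.
exact: measurable_ball.
Qed.

(* n-dimensional Lebesgue measure, as the iterated product of the Lebesgue
   measure on R; see lebesgue_rV_box. *)
Definition lebesgue_rV : set 'rV[R]_n -> \bar R :=
  pushforward (lebesgue_tuple R n) rV_of_tuple.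

Let lebesgue_rV0 : lebesgue_rV set0 = 0%E.
Proof. exact: measure0. Qed.

Let lebesgue_rV_ge0 A : (0 <= lebesgue_rV A)%E.
Proof. exact: measure_ge0. Qed.

Let lebesgue_rV_sigma_additive : semi_sigma_additive lebesgue_rV.
Proof. exact: measure_semi_sigma_additive. Qed.

HB.instance Definition _ := isMeasure.Build _ _ _
  lebesgue_rV lebesgue_rV0 lebesgue_rV_ge0 lebesgue_rV_sigma_additive.

End lebesgue_rV.

Lemma lebesgue_rV_box (R : realType) n (A : 'I_n -> set R) :
  (forall i, measurable (A i)) ->
  lebesgue_rV [set x : 'rV[R]_n | forall i, A i (x ord0 i)] =
  (\prod_(i < n) lebesgue_measure (A i))%E.
Proof.
move=> mA.
have mbox m (B : 'I_m -> set R) : (forall i, measurable (B i)) ->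
    measurable [set t : m.-tuple (measurableTypeR R) | forall i, B i (tnth t i)].
  move=> mB; rewrite (_ : [set t | _] = \bigcap_(i in [set: 'I_m])
    ((@tnth _ (measurableTypeR R) ^~ i) @^-1` (B i))); last first.
    by apply/seteqP; split => t /= h; [move=> i _|move=> i]; exact: h.
  apply: fin_bigcap_measurable => [|i _]; first exact: finite_finset.
  by rewrite -[X in measurable X]setTI; apply: measurable_tnth => //; exact: mB.
rewrite /lebesgue_rV /pushforward.
transitivity (lebesgue_tuple R n [set t | forall i, A i (tnth t i)]).
  congr (lebesgue_tuple R n _); apply/seteqP; split => t /= h i.
    by have := h i; rewrite mxE.
  by rewrite mxE.
elim: n A mA => [|n ih] A mA.
  by rewrite big_ord0 /= diracE mem_set// => -[].
rewrite big_ord_recl -ih; last by move=> i; exact: mA.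
rewrite /= /lebesgue_tuple_succ /pushforward -product_measure1E//; last first.
- exact: (@mbox n (fun i => A (lift ord0 i)) (fun i => mA _)).
- exact: mA.
congr (product_measure1 _ _ _); apply/seteqP; split => -[x t] /=.
  move=> h; split; first exact: (h ord0).
  by move=> i; have := h (lift ord0 i); rewrite tnthS.
move=> [xA tA] i; case: (unliftP ord0 i) => [j ->|->] //=.
by rewrite tnthS; exact: tA.
Qed.

Section special_functions.
Variable R : realType.
Local Notation mu := (@lebesgue_measure R).

(* For x <= 0 the product below has floor(-x) + 1 factors, so that Euler's
   integral is evaluated in ]0, 1]. At the poles the product vanishes, hence
   (Gamma x)^-1 = 0 there. *)
Definition Gamma (x : R) : R :=
  let euler y := (\int[mu]_(t in `]0%R, +oo[) (t `^ (y - 1) * expR (- t)))%R in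
  if 0 < x then euler x
  else let k := `|Num.floor (- x)|.+1 in
       euler (x + k%:R) / \prod_(i < k) (x + i%:R).

Definition ceiln (a : R) : nat := `|Num.ceil a|%N.

Definition RL_integral (nu : R) (f : R -> R) (t : R) : R :=
  if nu == 0 then f t
  else (Gamma nu)^-1 *
       (\int[mu]_(z in `]0%R, t[) (f z * (t - z) `^ (nu - 1)))%R.

End special_functions.

Section fractional_derivatives.
Variable R : realType.
Local Notation mu := (@lebesgue_measure R).

Variant frac_kind := Caputo | RiemannLiouville.

Definition frac_deriv (K : frac_kind) (a : R) (f : R -> R) : R -> R :=
  if a <= 0 then RL_integral (- a) f
  else match K with
       | Caputo => RL_integral ((ceiln a)%:R - a) (derive1n (ceiln a) f)
       | RiemannLiouville => derive1n (ceiln a) (RL_integral ((ceiln a)%:R - a) f)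
       end.

Definition derivable_upto (m : nat) (f : R -> R) : Prop :=
  forall (k : nat) (t : R), (k < m)%N -> 0 < t -> derivable (derive1n k f) t 1.

Definition continuous_L1loc (f : R -> R) : Prop :=
  (forall t : R, 0 < t -> {for t, continuous f}) /\
  (forall T : R, 0 < T -> mu.-integrable `]0%R, T[ (EFin \o f)).

(* Conditions on ]0, +oo[ under which the integrals and the derivatives in
   frac_deriv K a f (for a > 0) are genuine; integrals and derivatives being
   total functions, they would otherwise take junk values. *)
Definition frac_derivable (K : frac_kind) (a : R) (f : R -> R) : Prop :=
  match K with
  | Caputo => derivable_upto (ceiln a) f /\ continuous_L1loc (derive1n (ceiln a) f)
  | RiemannLiouville =>
      continuous_L1loc f /\
      derivable_upto (ceiln a) (RL_integral ((ceiln a)%:R - a) f)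
  end.

End fractional_derivatives.

Section L2.
Variables (R : realType) (n : nat) (Omega : set 'rV[R]_n).
Local Notation mu := (@lebesgue_rV R n).
Implicit Types f g : 'rV[R]_n -> R.

(* Elements of L_2(Omega) are represented by functions on the whole space,
   only the values on Omega being relevant. *)
Definition L2 f : Prop := (f \_ Omega) \in Lfun mu 2%:E.

Definition L2norm f : \bar R := 'N[mu]_(2%:E)[EFin \o (f \_ Omega)].

Definition L2inner f g : R := (\int[mu]_(x in Omega) (f x * g x))%R.

Definition L2cvg {I : Type} (F : set_system I) (u : I -> 'rV[R]_n -> R) g : Prop :=
  (fun i => L2norm (fun x => u i x - g x)) @ F --> 0%E.

End L2.

Section domains_and_Laplacian.
Variables (R : realType) (n : nat).
Implicit Types (Omega : set 'rV[R]_n) (f : 'rV[R]_n -> R).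

Definition bounded_domain Omega : Prop :=
  [/\ open Omega, connected Omega, Omega !=set0 & bounded_set Omega].

Definition boundary Omega : set 'rV[R]_n := closure Omega `\` Omega°.

Definition partial (i : 'I_n) f : 'rV[R]_n -> R := 'D_(delta_mx ord0 i) f.

Definition laplacian f (x : 'rV[R]_n) : R := \sum_(i < n) partial i (partial i f) x.

Definition C1_on Omega f : Prop :=
  forall x, Omega x -> {for x, continuous f} /\
    forall i, derivable f x (delta_mx ord0 i) /\ {for x, continuous (partial i f)}.

Definition C2_on Omega f : Prop :=
  C1_on Omega f /\ forall i, C1_on Omega (partial i f).

End domains_and_Laplacian.

(* The homogeneous boundary conditions are given by a boundary operator B: f
   satisfies them when B f vanishes on the boundary of Omega. *)
Record laplace_eigenbasis (R : realType) (n : nat) (Omega : set 'rV[R]_n)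
    (B : ('rV[R]_n -> R) -> 'rV[R]_n -> R)
    (lam : nat -> R) (phi : nat -> 'rV[R]_n -> R) : Prop := {
  lam_gt0 : 0 < lam 0 ;
  lam_nondecreasing : nondecreasing_seq lam ;
  lam_discrete : lam @ \oo --> +oo ;
  phi_C2 : forall j, C2_on Omega (phi j) ;
  phi_eigen : forall j x, Omega x -> - laplacian (phi j) x = lam j * phi j x ;
  phi_boundary : forall j x, boundary Omega x -> B (phi j) x = 0 ;
  phi_L2 : forall j, L2 Omega (phi j) ;
  phi_orthonormal : forall i j, L2inner Omega (phi i) (phi j) = (i == j)%:R ;
  phi_complete : forall f, L2 Omega f ->
    L2cvg Omega \oo
      (fun N x => \sum_(j < N) L2inner Omega f (phi j) * phi j x) f
}.

Section spectral.
Variables (R : realType) (n : nat) (Omega : set 'rV[R]_n).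
Variables (lam : nat -> R) (phi : nat -> 'rV[R]_n -> R).

(* (-Delta)^(-m) f, as the sum of its eigenfunction expansion in L_2(Omega). *)
Definition neg_laplacian_inv (m : nat) (f : 'rV[R]_n -> R) : 'rV[R]_n -> R :=
  get [set g | L2 Omega g /\
    L2cvg Omega \oo
      (fun N x => \sum_(j < N) lam j ^- m * L2inner Omega f (phi j) * phi j x) g].

Definition mode (u : R -> 'rV[R]_n -> R) (j : nat) (t : R) : R :=
  L2inner Omega (u t) (phi j).

(* y solves D^alpha y = - l y on ]0, +oo[ with D^gamma y (0+) = c and, if
   alpha > 1, D^gamma' y (0+) = 0. *)
Definition mode_solution (K : frac_kind) (alpha gamma gamma' l c : R)
    (y : R -> R) : Prop :=
  [/\ frac_derivable K alpha y,
      forall t : R, 0 < t -> frac_deriv K alpha y t = - l * y t,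
      frac_deriv K gamma y t @[t --> 0^'+] --> c &
      1 < alpha -> frac_deriv K gamma' y t @[t --> 0^'+] --> 0].

(* u = u_gamma, with derivatives of kind K; gamma' is the index of the other
   initial datum, which is zero and only present if alpha > 1. The function w
   is D^gamma u, defined mode by mode. *)
Definition diffusion_solution (K : frac_kind) (alpha gamma gamma' : R)
    (v : 'rV[R]_n -> R) (u : R -> 'rV[R]_n -> R) : Prop :=
  [/\ forall t : R, 0 < t -> L2 Omega (u t),
      forall j, mode_solution K alpha gamma gamma' (lam j)
                  (L2inner Omega v (phi j)) (mode u j) &
      exists w : R -> 'rV[R]_n -> R,
        (forall t : R, 0 < t -> L2 Omega (w t) /\
           forall j, mode w j t = frac_deriv K gamma (mode u j) t) /\
        L2cvg Omega 0^'+ w v].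

End spectral.

(* Main.v *)
(* Each mode is determined by its Laplace transform. After one more integration
   the fractional equation of a mode y becomes J y + lam J^(al+1) y = c kap with
   a power kernel kap, so that the Laplace transform of J y is explicit, and, as
   that transform is injective on continuous functions, y = c S_lam, where S_lam
   is the inverse transform of s^a / (s^al + lam) with a = al - 1, al - 2, 0, 1
   in the four cases. Written as a Hankel integral over the rays of argument
   +- th with pi/2 < th < pi and al th < pi, S_lam satisfies
     S_lam(t) = t^(al-a-1) S_z(1),  z = lam t^al,   and   |S_z(1)| <= M / z,
   and 1/(z + w) = 1/z - w/(z (z + w)) under the integral gives
     z S^a_z(1) = 1 / Gamma(-a) - S^(a+al)_z(1).
   For a = 0, 1 the term 1 / Gamma(-a) vanishes and a second expansion yields the
   limit -1 / Gamma(-a-al) of z^2 S_z(1). All errors are of order t^(-al),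
   uniformly over the spectrum, so Parseval's identity sums them up. *)

Require Import Defs.
From HB Require Import structures.
From mathcomp Require Import all_boot all_order all_algebra.
From mathcomp Require Import complex.
From mathcomp Require Import ring lra.
From mathcomp Require Import all_classical all_reals all_analysis.
From mathcomp Require Import measurable_realfun.
Import Order.TTheory GRing.Theory Num.Theory.
Import numFieldNormedType.Exports.
Set Implicit Arguments.
Unset Strict Implicit.
Unset Printing Implicit Defensive.
Local Open Scope classical_set_scope.
Local Open Scope ring_scope.
Import Normc.
Local Notation Re := (@complex.Re _).
Local Notation Im := (@complex.Im _).

(** That a mode has a Laplace transform at all must be proved, since nothing is assumed about its
    growth: for s with lam s^(-al) <= 1/2 the convolution term of the integrated equation is
    absorbed, uniformly in the time of truncation. This is done for J y because y may be unbounded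
    at 0 in the Riemann-Liouville cases, while J y is locally bounded; likewise kernels of index at
    least 1 are locally bounded, so that Fubini gives identities at every t and not merely almost
    everywhere. Contours are treated in the coordinate w = log z: rays become horizontal lines,
    moving a ray is differentiation under the integral sign, and scaling z is translating w, which
    brings the pole z = s to z = 1. The angle th exceeds pi / 2 so that e^(t z) decays along the
    ray; al q < pi for some q > th keeps z^al + lam away from 0 in the whole sector, so that no
    residue arises. Such angles exist because al < 2. Hankel's formula for 1 / Gamma comes from the
    same computation with al = 0 and lam = 1, extended by integration by parts. *)

Local Notation L1 f := ((@lebesgue_measure _).-integrable setT (EFin \o f)).
Local Notation I f := (\int[lebesgue_measure]_x f x)%R.

(** * Integrals over the real line *)

Section lebesgue_change_of_variable.
Context {R : realType}.
Notation mu := (@lebesgue_measure R).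
Implicit Types f g : R -> R.

Section affine.
Variables (a b : R).
Hypothesis a_gt0 : 0 < a.

Definition affine (x : measurableTypeR R) : measurableTypeR R := a * x + b.

Lemma measurable_affine : measurable_fun setT affine.
Proof.
apply: (@measurable_funD _ _ R setT (fun x => a * x) (cst b)) => //.
exact: mulrl_measurable.
Qed.

HB.instance Definition _ := isMeasurableFun.Build _ _ _ _ affine measurable_affine.

Let affine_pushforward : {measure set (measurableTypeR R) -> \bar R} :=
  measure_function_pushforward__canonical__measure_function_Measure mu
    measurable_affine.

(** By uniqueness of Lebesgue measure it is enough to compare both sides on half-open intervals. *)
Lemma lebesgue_measure_affine A : measurable A ->
  mu A = (a%:E * pushforward mu affine A)%E.
Proof.
have a_nng : 0 <= a by exact: ltW.
pose m := mscale (NngNum a_nng) affine_pushforward.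
move=> mA; rewrite (@lebesgue_measure_unique R m)// => _ [[x y] _ <-] /=.
rewrite /m /mscale /= /pushforward.
have -> : affine @^-1` `]x, y] = `](x - b) / a, (y - b) / a]%classic.
  apply/seteqP; split => z /=; rewrite !in_itv/= /affine => /andP[h1 h2];
    apply/andP; split.
  - by rewrite ltr_pdivrMr// ltrBlDr mulrC.
  - by rewrite ler_pdivlMr// lerBrDr mulrC.
  - by move: h1; rewrite ltr_pdivrMr// ltrBlDr mulrC.
  - by move: h2; rewrite ler_pdivlMr// lerBrDr mulrC.
rewrite !lebesgue_measure_itv/= !lte_fin ltr_pM2r ?invr_gt0// ltrD2r.
case: ifPn => _; last by rewrite mule0.
rewrite -!EFinD -EFinM; congr EFin; field; exact: lt0r_neq0.
Qed.

Lemma ge0_integral_affine (f : R -> \bar R) : measurable_fun setT f ->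
  (forall x, 0 <= f x)%E ->
  (\int[mu]_x f x = a%:E * \int[mu]_x f (a * x + b)%R)%E.
Proof.
move=> mf f0.
have a_nng : 0 <= a by exact: ltW.
pose m := mscale (NngNum a_nng) affine_pushforward.
rewrite (eq_measure_integral m); last first.
  by move=> A mA _; exact: lebesgue_measure_affine.
rewrite ge0_integral_mscale//.
congr (_ * _)%E.
have := ge0_integral_pushforward measurable_affine mu measurableT mf.
by rewrite preimage_setT; apply => x _; exact: f0.
Qed.

Lemma integrable_affine f : L1 f -> L1 (fun x => f (a * x + b)).
Proof.
move=> /integrableP[mf fi]; apply/integrableP; split.
  apply/measurable_EFinP; apply: (measurableT_comp (f := f)).
    exact/measurable_EFinP.
  exact: measurable_affine.
move: fi; rewrite ge0_integral_affine//; last exact: measurableT_comp.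
move=> h; rewrite ltNge leye_eq; apply/negP => /eqP hy.
by move: h; rewrite hy gt0_muley ?lte_fin// ltxx.
Qed.

Lemma Rintegral_affine f : L1 f -> I f = a * I (fun x => f (a * x + b)).
Proof.
move=> fi; have /integrableP[mf _] := fi.
have fai := integrable_affine fi.
rewrite /Rintegral integralE [in RHS]integralE.
rewrite (ge0_integral_affine (f := ((EFin \o f)^\+)%E))//; last exact: measurable_funepos.
rewrite (ge0_integral_affine (f := ((EFin \o f)^\-)%E))//; last exact: measurable_funeneg.
have pf := integrable_pos_fin_num measurableT fai.
have nf := integrable_neg_fin_num measurableT fai.
have pE : (EFin \o (fun x => f (a * x + b)%R))^\+%E = (EFin \o f)^\+%E \o affine.
  by rewrite -funepos_comp.
have nE : (EFin \o (fun x => f (a * x + b)%R))^\-%E = (EFin \o f)^\-%E \o affine.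
  by rewrite -funeneg_comp.
rewrite -[X in _ = a * fine (integral _ _ X^\+%E - integral _ _ X^\-%E)]
  /(EFin \o (fun x => f (a * x + b))).
rewrite pE nE in pf nf *.
rewrite -muleBr ?fin_num_adde_defl ?fin_numN//.
by rewrite fineM// fin_numB pf.
Qed.

End affine.

Lemma Rintegral_translation f c : L1 f -> I (fun x => f (x + c)) = I f.
Proof.
move=> fi; rewrite [RHS](Rintegral_affine c ltr01)// mul1r.
by apply: eq_Rintegral => x _; rewrite mul1r.
Qed.

Lemma integrable_translation f c : L1 f -> L1 (fun x => f (x + c)).
Proof.
move=> /(integrable_affine c ltr01).
by under eq_fun do rewrite mul1r.
Qed.

Lemma ge0_integral_translation (f : R -> \bar R) c : measurable_fun setT f ->
  (forall x, 0 <= f x)%E -> (\int[mu]_x f (x + c)%R = \int[mu]_x f x)%E.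
Proof.
move=> mf f0; rewrite [RHS](ge0_integral_affine c ltr01)// mul1e.
by apply: eq_integral => x _; rewrite mul1r.
Qed.

End lebesgue_change_of_variable.

Section real_line_integrals.
Context {R : realType}.
Notation mu := (@lebesgue_measure R).
Implicit Types f g : R -> R.

Lemma eq_I f g : (forall x, f x = g x) -> I f = I g.
Proof. by move=> fg; apply: eq_Rintegral => x _; exact: fg. Qed.

Lemma L1_measurable f : L1 f -> measurable_fun setT f.
Proof. by move=> /integrableP[/measurable_EFinP]. Qed.

Lemma L1_dominated f g : measurable_fun setT f -> L1 g ->
  (forall x, `|f x| <= g x) -> L1 f.
Proof.
move=> mf gi fg; apply: (le_integrable measurableT _ _ gi).
  exact/measurable_EFinP.
by move=> x _ /=; rewrite lee_fin (le_trans (fg x))// ler_norm.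
Qed.

Lemma Rintegral_norm_le f g : measurable_fun setT f -> L1 g ->
  (forall x, `|f x| <= g x) -> `|I f| <= I g.
Proof.
move=> mf gi fg; have fi := L1_dominated mf gi fg.
apply: (le_trans (le_normr_Rintegral measurableT fi)).
by apply: le_Rintegral => //; exact: (integrable_norm fi).
Qed.

Lemma RintegralE f : L1 f -> (\int[mu]_x (f x)%:E = (I f)%:E)%E.
Proof. by move=> fi; rewrite /Rintegral fineK// integrable_fin_num. Qed.

Lemma ge0_L1P f : measurable_fun setT f -> (forall x, 0 <= f x) ->
  (\int[mu]_x (f x)%:E < +oo)%E -> L1 f.
Proof.
move=> mf f0 fi; apply/integrableP; split; first exact/measurable_EFinP.
by under eq_integral do rewrite /= ger0_norm//.
Qed.

(** The exceptional point c is a null set; it is needed at the pole of 1 / sinh and at the jump of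
    an indicator. *)
Lemma Rintegral_dominated_cvg (f_ : nat -> R -> R) f g c :
  (forall n, measurable_fun setT (f_ n)) -> measurable_fun setT f -> L1 g ->
  (forall n x, `|f_ n x| <= g x) ->
  (forall x, x != c -> f_ n x @[n --> \oo] --> f x) ->
  L1 f /\ I (f_ n) @[n --> \oo] --> I f.
Proof.
move=> mf_ mf gi fg fcvg.
have [|||||fi _ cv] := @dominated_convergence _ _ _ mu setT measurableT
    (fun n x => (f_ n x)%:E) (EFin \o f) (EFin \o g).
- by move=> n; apply/measurable_EFinP; exact: mf_.
- by apply/measurable_EFinP; exact: mf.
- exists [set c]; split => //; first exact: lebesgue_measure_set1.
  move=> x /= ncv; apply: contrapT => /eqP x0; apply: ncv => _.
  apply/fine_cvgP; split; first exact: nearW.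
  exact: fcvg.
- exact: gi.
- by apply: aeW => x n _; rewrite lee_fin.
split => //; rewrite /Rintegral; apply: fine_cvg.
by rewrite fineK ?integrable_fin_num.
Qed.

Section Fubini.
Variable f : R -> R -> R.
Hypothesis mf : measurable_fun setT (fun p : R * R => f p.1 p.2).

Lemma measurable_section1 x : measurable_fun setT (f x).
Proof. exact: (measurableT_comp mf (pair1_measurable x)). Qed.

Lemma measurable_section2 y : measurable_fun setT (f ^~ y).
Proof. exact: (measurableT_comp mf (pair2_measurable y)). Qed.

Lemma measurable_integral_norm :
  measurable_fun setT (fun x => \int[mu]_y `|f x y|%:E)%E.
Proof.
apply: (@measurable_fun_fubini_tonelli_F _ _ _ _ _ mu (fun p => `|f p.1 p.2|%:E)) => //=.
by apply/measurable_EFinP; exact: measurableT_comp.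
Qed.

Variable g : R -> R.
Hypothesis fg : forall x, (\int[mu]_y `|f x y|%:E <= (g x)%:E)%E.
Hypothesis gi : L1 g.

Lemma integrable_section x : L1 (f x).
Proof.
apply/integrableP; split; first by apply/measurable_EFinP; exact: measurable_section1.
by rewrite (le_lt_trans (fg x))// ltry.
Qed.

Lemma integrable_prod : (mu \x mu)%E.-integrable setT (fun p => (f p.1 p.2)%:E).
Proof.
apply/integrable12ltyP; first exact/measurable_EFinP.
apply: (@le_lt_trans _ _ (\int[mu]_x (g x)%:E)%E).
  apply: ge0_le_integral => //.
  - by move=> x _; exact: integral_ge0.
  - exact: measurable_integral_norm.
  - exact: measurable_int gi.
  - by move=> x _; exact: fg.
exact: integrable_lty.
Qed.

Lemma integrable_Fubini2 : L1 (fun y => I (f ^~ y)).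
Proof.
have mG := measurable_fubini_G integrable_prod.
have h := (integrable21ltyP mu mu (measurable_int _ integrable_prod)).1 integrable_prod.
apply/integrableP; split.
  by apply/measurable_EFinP; apply: measurableT_comp mG.
apply: le_lt_trans h; apply: ge0_le_integral => //.
- apply: measurableT_comp => //.
  by apply/measurable_EFinP; apply: measurableT_comp mG.
- have := @measurable_fun_fubini_tonelli_G _ _ _ _ _ mu (fun p => `|(f p.1 p.2)%:E|)%E.
  by apply => //; apply: measurableT_comp => //; apply/measurable_EFinP.
- move=> y _; have /measurable_EFinP my := measurable_section2 y.
  apply: (le_trans _ (le_abse_integral mu measurableT my)) => /=.
  by rewrite /Rintegral; case: (integral _ _ _) => [r| |] //=; rewrite ?normr0 ?leey.
Qed.

Lemma Rintegral_Fubini : I (fun x => I (f x)) = I (fun y => I (f ^~ y)).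
Proof.
rewrite {1}/Rintegral.
have -> : (\int[mu]_x (I (f x))%:E = \int[mu]_x \int[mu]_y (f x y)%:E)%E.
  by apply: eq_integral => x _; rewrite RintegralE//; exact: integrable_section.
rewrite (Fubini integrable_prod) [RHS]/Rintegral; congr fine.
apply: ae_eq_integral => //.
- exact: measurable_fubini_G integrable_prod.
- by have /integrableP[] := integrable_Fubini2.
(* Sections at fixed y are integrable only for almost every y, so the inner real integrals agree
   with the extended ones only almost everywhere. *)
- have := ae_integrable2 integrable_prod; apply: filterS => y yi _.
  by rewrite /= RintegralE.
Qed.

End Fubini.

Lemma continuous_FTC_line (F f : R -> R) l1 l2 :
  (forall x : R, is_derive x (1 : R) F (f x)) -> continuous f -> L1 f ->
  F x @[x --> -oo] --> l1 -> F x @[x --> +oo] --> l2 -> I f = l2 - l1.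
Proof.
move=> dF cf fi F1 F2.
have mf := L1_measurable fi.
pose f_ n := f \_ `](- n%:R), (n%:R)[.
have IfE n : I (f_ n.+1) = F n.+1%:R - F (- n.+1%:R).
  rewrite -Rintegral_mkcond.
  have -> : \int[mu]_(x in `](- n.+1%:R), n.+1%:R[) f x =
            \int[mu]_(x in `[(- n.+1%:R), n.+1%:R]) f x.
    by rewrite Rintegral_itv_bndo_bndc ?Rintegral_itv_obnd_cbnd//;
      exact: (integrableS measurableT).
  have n0 : (- n.+1%:R < n.+1%:R :> R) by rewrite gtrN.
  have dF1 x : derivable F x 1 by exact: ex_derive.
  have cF : continuous F.
    by move=> x; apply: differentiable_continuous; exact/derivable1_diffP.
  rewrite /Rintegral (continuous_FTC2 n0 (F := F))//=.
  - exact: continuous_subspaceT.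
  - split => //.
    + by apply: cvg_at_right_filter; exact: cF.
    + by apply: cvg_at_left_filter; exact: cF.
  - by move=> x _; rewrite derive1E; apply: derive_val.
have [|||||_ c1] := @Rintegral_dominated_cvg f_ f (fun x => `|f x|) 0.
- move=> n; apply/measurable_restrict => //; exact: measurable_funTS.
- exact: mf.
- exact: (integrable_norm fi).
- by move=> n x; rewrite /f_ patchE; case: ifPn => //; rewrite normr0.
- move=> x _; apply: cvg_near_cst; near=> n; rewrite /f_ patchE ifT// inE/= in_itv/=.
  by rewrite -ltr_norml; near: n; exact: nbhs_infty_gtr.
have c2 : I (f_ n) @[n --> \oo] --> l2 - l1.
  have cn : (n.+1%:R : R) @[n --> \oo] --> +oo.
    apply/cvgryPge => A; near=> n; apply: (@le_trans _ _ n%:R).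
      by near: n; exact: nbhs_infty_ger.
    by rewrite ler_nat.
  have cNn : (- n.+1%:R : R) @[n --> \oo] --> -oo.
    apply/cvgrNyPle => A; near=> n; rewrite lerNl.
    by near: n; move/cvgryPge : cn; exact.
  rewrite -cvg_shiftS /=; under eq_fun do rewrite IfE.
  apply: cvgB; first exact: (cvg_comp _ F cn F2).
  exact: (cvg_comp _ F cNn F1).
exact: cvg_unique c1 c2.
Unshelve. all: by end_near. Qed.

(** Common majorant of the integrands on horizontal lines. *)
Definition expabs (b x : R) := expR (- b * `|x|).

Lemma continuous_expabs b : continuous (expabs b).
Proof.
move=> x; apply: continuous_comp; last exact: continuous_expR.
by apply: continuousM; [exact: cst_continuous|exact: norm_continuous].
Qed.

Lemma expabs_ge0 b x : 0 <= expabs b x.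
Proof. exact: expR_ge0. Qed.

Lemma L1_expabs b : 0 < b -> L1 (expabs b).
Proof.
move=> b0; apply: ge0_L1P; first by apply: continuous_measurable_fun; exact: continuous_expabs.
  exact: expabs_ge0.
rewrite ge0_symfun_integralT//; last 3 first.
- exact: expabs_ge0.
- exact: continuous_expabs.
- by move=> x /=; rewrite /expabs normrN.
apply: lte_mul_pinfty => //.
(* On the half-line this is 1 / b times the exponential density, of total mass 1. *)
have -> : (\int[mu]_(x in [set x | (0 <= x)%R]) (expabs b x)%:E =
           \int[mu]_x (b^-1%:E * (exponential_pdf b x)%:E))%E.
  rewrite integral_mkcond; apply: eq_integral => x _.
  rewrite /exponential_pdf !patchE /=; have [x0|x0] := leP 0 x.
    rewrite !mem_set//= ?in_itv/= ?x0// -EFinM mulrA mulVf ?lt0r_neq0// mul1r.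
    by rewrite /expabs ger0_norm.
  by rewrite !memNset ?mule0//= ?in_itv/= ?andbT; apply/negP; rewrite -ltNge.
rewrite ge0_integralZl_EFin//.
- by rewrite integral_exponential_pdf// mule1 ltry.
- by move=> x _; rewrite lee_fin exponential_pdf_ge0// ltW.
- by apply/measurable_EFinP; exact: measurable_exponential_pdf.
- by rewrite invr_ge0 ltW.
Qed.

End real_line_integrals.

(** * Shift of horizontal contours *)

Section complex_modulus.
Context {R : realType}.
Implicit Types z w : R[i].

Lemma normc_sqr z : normc z ^+ 2 = Re z ^+ 2 + Im z ^+ 2.
Proof. by case: z => a b /=; rewrite sqr_sqrtr// addr_ge0 ?sqr_ge0. Qed.

Lemma normc_ge0 z : 0 <= normc z.
Proof. by case: z => a b; exact: sqrtr_ge0. Qed.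

Lemma normRe_le z : `|Re z| <= normc z.
Proof.
rewrite -(@ler_pXn2r _ 2)// ?nnegrE ?normc_ge0// normc_sqr real_normK ?num_real//.
by rewrite lerDl sqr_ge0.
Qed.

Lemma normIm_le z : `|Im z| <= normc z.
Proof.
rewrite -(@ler_pXn2r _ 2)// ?nnegrE ?normc_ge0// normc_sqr real_normK ?num_real//.
by rewrite lerDr sqr_ge0.
Qed.

Lemma normc_le_Re_Im z : normc z <= `|Re z| + `|Im z|.
Proof.
rewrite -(@ler_pXn2r _ 2)// ?nnegrE ?normc_ge0 ?addr_ge0// normc_sqr.
rewrite sqrrD !real_normK ?num_real// -addrA lerD2l lerDr mulrn_wge0//.
Qed.

Lemma normc_triangle z w : normc (z + w) <= normc z + normc w.
Proof.
have := @lec_normD R z w; rewrite /= /lec /= => /andP[_].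
done.
Qed.

Lemma normcN z : normc (- z) = normc z.
Proof. by case: z => a b /=; rewrite !sqrrN. Qed.

Lemma cReM z w : Re (z * w) = Re z * Re w - Im z * Im w.
Proof. by case: z; case: w. Qed.

Lemma cImM z w : Im (z * w) = Re z * Im w + Im z * Re w.
Proof. by case: z; case: w. Qed.

Lemma cReD z w : Re (z + w) = Re z + Re w.
Proof. by case: z; case: w. Qed.

Lemma cImD z w : Im (z + w) = Im z + Im w.
Proof. by case: z; case: w. Qed.

Lemma cReN z : Re (- z) = - Re z. Proof. by case: z. Qed.

Lemma cImN z : Im (- z) = - Im z. Proof. by case: z. Qed.

Lemma cReV z : Re z^-1 = Re z / (Re z ^+ 2 + Im z ^+ 2).
Proof. by case: z. Qed.

Lemma cImV z : Im z^-1 = - (Im z / (Re z ^+ 2 + Im z ^+ 2)).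
Proof. by case: z. Qed.

Lemma Re2Im2_gt0 z : z != 0 -> 0 < Re z ^+ 2 + Im z ^+ 2.
Proof.
move=> z0; rewrite -normc_sqr exprn_even_gt0//=.
by apply: contra z0 => /eqP /eq0_normc ->.
Qed.

Definition cexp (x t : R) : R[i] := Complex (expR x * cos t) (expR x * sin t).

Lemma cexpD x t y u : cexp (x + y) (t + u) = cexp x t * cexp y u.
Proof.
rewrite /cexp expRD cosD sinD; apply/eqP; rewrite eq_complex /=.
by apply/andP; split; apply/eqP; ring.
Qed.

Lemma cexp0 : cexp 0 0 = 1.
Proof. by rewrite /cexp expR0 cos0 sin0 mul1r mulr0. Qed.

Lemma normc_cexp x t : normc (cexp x t) = expR x.
Proof.
by rewrite /= !exprMn -mulrDr cos2Dsin2 mulr1 sqrtr_sqr ger0_norm// expR_ge0.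
Qed.

Lemma cexp_neq0 x t : cexp x t != 0.
Proof.
apply/negP => /eqP h; have := normc_cexp x t; rewrite h normc0 => /esym /eqP.
by rewrite gt_eqF// expR_gt0.
Qed.

End complex_modulus.

(** * Holomorphic functions in real coordinates, and contour shift *)

Section holomorphic.
Context {R : realType}.
Implicit Types Z D : R -> R -> R[i].

Definition ccont Z (x t : R) :=
  (Re (Z p.1 p.2) @[p --> (x, t)] --> Re (Z x t)) /\
  (Im (Z p.1 p.2) @[p --> (x, t)] --> Im (Z x t)).

(* [D] is the derivative of [Z] at [w = x + i t] in the complex sense: the
   [t]-derivative is [i D]. *)
Definition holo Z D (x t : R) :=
  [/\ is_derive x (1 : R) (fun y => Re (Z y t)) (Re (D x t)) /\
      is_derive x (1 : R) (fun y => Im (Z y t)) (Im (D x t)),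
      is_derive t (1 : R) (fun u => Re (Z x u)) (- Im (D x t)) /\
      is_derive t (1 : R) (fun u => Im (Z x u)) (Re (D x t)),
      ccont Z x t & ccont D x t].

Lemma ccontM Z1 Z2 x t : ccont Z1 x t -> ccont Z2 x t ->
  ccont (fun x t => Z1 x t * Z2 x t) x t.
Proof.
move=> [r1 i1] [r2 i2]; rewrite /ccont; split.
  under eq_fun do rewrite cReM; rewrite cReM; apply: cvgB; exact: cvgM.
under eq_fun do rewrite cImM; rewrite cImM; apply: cvgD; exact: cvgM.
Qed.

Lemma ccontD Z1 Z2 x t : ccont Z1 x t -> ccont Z2 x t ->
  ccont (fun x t => Z1 x t + Z2 x t) x t.
Proof.
move=> [r1 i1] [r2 i2]; rewrite /ccont; split.
  by under eq_fun do rewrite cReD; rewrite cReD; apply: cvgD.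
by under eq_fun do rewrite cImD; rewrite cImD; apply: cvgD.
Qed.

Lemma ccontN Z x t : ccont Z x t -> ccont (fun x t => - Z x t) x t.
Proof.
move=> [r1 i1]; rewrite /ccont; split.
  by under eq_fun do rewrite cReN; rewrite cReN; apply: cvgN.
by under eq_fun do rewrite cImN; rewrite cImN; apply: cvgN.
Qed.

Lemma ccontV Z x t : Z x t != 0 -> ccont Z x t ->
  ccont (fun x t => (Z x t)^-1) x t.
Proof.
move=> Z0 [r1 i1]; rewrite /ccont; have N0 := Re2Im2_gt0 Z0.
have c : (Re (Z p.1 p.2) ^+ 2 + Im (Z p.1 p.2) ^+ 2)^-1 @[p --> (x, t)] -->
         (Re (Z x t) ^+ 2 + Im (Z x t) ^+ 2)^-1.
  apply: cvgV; first by rewrite gt_eqF.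
  by under eq_fun do rewrite !expr2; rewrite !expr2; apply: cvgD; exact: cvgM.
split.
  by under eq_fun do rewrite cReV; rewrite cReV; apply: cvgM.
by under eq_fun do rewrite cImV; rewrite cImV; apply: cvgN; apply: cvgM.
Qed.

Lemma ccont_cst (c : R[i]) x t : ccont (fun _ _ => c) x t.
Proof. by split; exact: cvg_cst. Qed.

Lemma ccont_cexp k x t : ccont (fun x t => cexp (k * x) (k * t)) x t.
Proof.
have c1 : k * p.1 @[p --> (x, t)] --> k * x.
  by apply: cvgM; [exact: cvg_cst|exact: cvg_fst].
have c2 : k * p.2 @[p --> (x, t)] --> k * t.
  by apply: cvgM; [exact: cvg_cst|exact: cvg_snd].
have c3 := cvg_comp _ _ c1 (@continuous_expR R (k * x)).
split; (apply: cvgM; first exact: c3).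
  exact: (cvg_comp _ _ c2 (@continuous_cos R (k * t))).
exact: (cvg_comp _ _ c2 (@continuous_sin R (k * t))).
Qed.

Lemma holo_cst c x t : holo (fun _ _ => c) (fun _ _ => 0) x t.
Proof.
by split; [split|split|exact: ccont_cst|exact: ccont_cst] => /=;
  rewrite ?oppr0; exact: is_derive_cst.
Qed.

Lemma holoD Z1 D1 Z2 D2 x t : holo Z1 D1 x t -> holo Z2 D2 x t ->
  holo (fun x t => Z1 x t + Z2 x t) (fun x t => D1 x t + D2 x t) x t.
Proof.
move=> [[a1 a2] [a3 a4] a5 a6] [[b1 b2] [b3 b4] b5 b6].
split; [split|split|exact: ccontD|exact: ccontD].
- under eq_fun do rewrite cReD; rewrite cReD; exact: is_deriveD.
- under eq_fun do rewrite cImD; rewrite cImD; exact: is_deriveD.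
- under eq_fun do rewrite cReD; rewrite cImD opprD; exact: is_deriveD.
- under eq_fun do rewrite cImD; rewrite cReD; exact: is_deriveD.
Qed.

Lemma holoN Z D x t : holo Z D x t ->
  holo (fun x t => - Z x t) (fun x t => - D x t) x t.
Proof.
move=> [[a1 a2] [a3 a4] a5 a6].
split; [split|split|exact: ccontN|exact: ccontN].
- under eq_fun do rewrite cReN; rewrite cReN; exact: is_deriveN.
- under eq_fun do rewrite cImN; rewrite cImN; exact: is_deriveN.
- under eq_fun do rewrite cReN; rewrite cImN; exact: is_deriveN.
- under eq_fun do rewrite cImN; rewrite cReN; exact: is_deriveN.
Qed.

Lemma holoM Z1 D1 Z2 D2 x t : holo Z1 D1 x t -> holo Z2 D2 x t ->
  holo (fun x t => Z1 x t * Z2 x t)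
       (fun x t => D1 x t * Z2 x t + Z1 x t * D2 x t) x t.
Proof.
move=> [[a1 a2] [a3 a4] a5 a6] [[b1 b2] [b3 b4] b5 b6].
split; [split|split|exact: ccontM|apply: ccontD; exact: ccontM].
- under eq_fun do rewrite cReM; rewrite cReD !cReM.
  apply: (is_derive_eq (is_deriveB (is_deriveM a1 b1) (is_deriveM a2 b2))).
  by rewrite /GRing.scale /=; ring.
- under eq_fun do rewrite cImM; rewrite cImD !cImM.
  apply: (is_derive_eq (is_deriveD (is_deriveM a1 b2) (is_deriveM a2 b1))).
  by rewrite /GRing.scale /=; ring.
- under eq_fun do rewrite cReM; rewrite cImD !cImM.
  apply: (is_derive_eq (is_deriveB (is_deriveM a3 b3) (is_deriveM a4 b4))).
  by rewrite /GRing.scale /=; ring.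
- under eq_fun do rewrite cImM; rewrite cReD !cReM.
  apply: (is_derive_eq (is_deriveD (is_deriveM a3 b4) (is_deriveM a4 b3))).
  by rewrite /GRing.scale /=; ring.
Qed.

(** With f and g the real and imaginary parts of Z this differentiates Re (1 / Z); exchanging them
    gives - Im (1 / Z), so one formula serves all four partial derivatives in [holoV]. *)
Lemma is_derive_sqnormV (f g : R -> R) y df dg : f y ^+ 2 + g y ^+ 2 != 0 ->
  is_derive y (1 : R) f df -> is_derive y (1 : R) g dg ->
  is_derive y (1 : R) (fun y => f y / (f y ^+ 2 + g y ^+ 2))
   ((df * (g y ^+ 2 - f y ^+ 2) - 2 * f y * g y * dg) / (f y ^+ 2 + g y ^+ 2) ^+ 2).
Proof.
move=> n0 Df Dg.
have D1 := is_deriveD (is_deriveM Df Df) (is_deriveM Dg Dg).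
have n1 : (f * f + g * g) y != 0 by rewrite [X in X != 0]/= !fctE -!expr2.
have D2 := is_deriveM Df (is_deriveV n1 D1).
have -> : (fun y => f y / (f y ^+ 2 + g y ^+ 2)) = 
    f * (fun y => ((f * f + g * g) y)^-1).
  by apply/funext => z; rewrite !fctE !expr2.
apply: (is_derive_eq D2); rewrite !fctE /GRing.scale /=.
by field.
Qed.

Lemma holoV Z D x t : Z x t != 0 -> holo Z D x t ->
  holo (fun x t => (Z x t)^-1) (fun x t => - (D x t * ((Z x t)^-1 * (Z x t)^-1))) x t.
Proof.
move=> Z0 [[a1 a2] [a3 a4] a5 a6].
have N0 := lt0r_neq0 (Re2Im2_gt0 Z0).
have N0' : Im (Z x t) ^+ 2 + Re (Z x t) ^+ 2 != 0 by rewrite addrC.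
split; [split|split|exact: ccontV|].
- under eq_fun do rewrite cReV; rewrite cReN !(cReM, cImM, cReV, cImV).
  apply: (is_derive_eq (is_derive_sqnormV N0 a1 a2)).
  by field.
- under eq_fun do rewrite cImV addrC; rewrite cImN !(cReM, cImM, cReV, cImV).
  apply: (is_derive_eq (is_deriveN (is_derive_sqnormV N0' a2 a1))).
  by field; rewrite N0.
- under eq_fun do rewrite cReV; rewrite cImN !(cReM, cImM, cReV, cImV).
  apply: (is_derive_eq (is_derive_sqnormV N0 a3 a4)).
  by field.
- under eq_fun do rewrite cImV addrC; rewrite cReN !(cReM, cImM, cReV, cImV).
  apply: (is_derive_eq (is_deriveN (is_derive_sqnormV N0' a4 a3))).
  by field; rewrite N0.
- by apply: ccontN; apply: ccontM => //; apply: ccontM; exact: ccontV.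
Qed.

Lemma holo_cexp k x t : holo (fun x t => cexp (k * x) (k * t))
  (fun x t => k%:C%C * cexp (k * x) (k * t)) x t.
Proof.
split; [split|split|exact: ccont_cexp|].
- rewrite /= mul0r subr0; apply: is_derive_eq.
  by rewrite /GRing.scale /=; ring.
- rewrite /= mul0r addr0; apply: is_derive_eq.
  by rewrite /GRing.scale /=; ring.
- rewrite /= mul0r addr0; apply: is_derive_eq.
  by rewrite /GRing.scale /=; ring.
- rewrite /= mul0r subr0; apply: is_derive_eq.
  by rewrite /GRing.scale /=; ring.
- by apply: ccontM; [exact: ccont_cst|exact: ccont_cexp].
Qed.

Lemma holo_Re_bounded_box Z D p q A : (forall x t, p < t < q -> holo Z D x t) ->
  forall t1 t2, p < t1 -> t2 < q ->
  exists2 M, 0 <= M & forall x t, x \in `[-A, A] -> t \in `[t1, t2] ->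
    `|Re (D x t)| <= M.
Proof.
move=> hZ t1 t2 pt1 t2q.
pose K := `[-A, A]%classic `*` `[t1, t2]%classic : set (R * R).
have cK : compact K by apply: compact_setX; exact: segment_compact.
have cf : {within K, continuous (fun p : R * R => Re (D p.1 p.2))}.
  apply: continuous_in_subspaceT => -[x t]; rewrite inE /K /= => -[_].
  rewrite in_itv/= => /andP[h1 h2].
  have [|_ _ _ []//] := hZ x t.
  by rewrite (lt_le_trans pt1)//= (le_lt_trans h2).
have [M [_ HM]] := compact_bounded (continuous_compact cf cK).
exists `|M + 1|; first exact: normr_ge0.
move=> x t hx ht; apply: (le_trans _ (ler_norm _)).
apply: HM; first by rewrite ltrDl.
by exists (x, t).
Qed.

Lemma continuous_section_Re Z x t : ccont Z x t -> {for x, continuous (fun x => Re (Z x t))}.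
Proof.
move=> [h _]; apply: (cvg_comp (fun x => (x, t)) _ _ h).
by apply: (@cvg_pair R R R (nbhs x) (nbhs x) (nbhs t) _ _ _ id (cst t));
  [exact: cvg_id|exact: cvg_cst].
Qed.

Lemma continuous_section_Im Z x t : ccont Z x t -> {for x, continuous (fun x => Im (Z x t))}.
Proof.
move=> [_ h]; apply: (cvg_comp (fun x => (x, t)) _ _ h).
by apply: (@cvg_pair R R R (nbhs x) (nbhs x) (nbhs t) _ _ _ id (cst t));
  [exact: cvg_id|exact: cvg_cst].
Qed.

Notation mu := (@lebesgue_measure R).

(** By the Cauchy-Riemann equations the t-derivative of the integral of Im Z is the integral of Re
    D, that is Re Z (A, t) - Re Z (- A, t): only the vertical edges contribute, and the mean value
    theorem concludes. *)
Lemma rectangle_shift Z D p q A e : (forall x t, p < t < q -> holo Z D x t) ->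
  0 < A ->
  (forall t, p < t < q -> `|Re (Z A t)| <= e) ->
  (forall t, p < t < q -> `|Re (Z (- A) t)| <= e) ->
  forall t1 t2, p < t1 -> t1 < t2 -> t2 < q ->
  `|\int[mu]_(x in `[-A, A]) Im (Z x t2) - \int[mu]_(x in `[-A, A]) Im (Z x t1)|
    <= 2 * e * (t2 - t1).
Proof.
move=> hZ A0 e1 e2 t1 t2 pt1 t12 t2q.
(* Differentiation under the integral needs an open interval around t and a bound on D there; []u,
   v[] contains [t1, t2] and its closure stays inside []p, q[]. *)
pose u := (p + t1) / 2; pose v := (t2 + q) / 2.
have pu : p < u by rewrite /u; lra.
have ut1 : u < t1 by rewrite /u; lra.
have t2v : t2 < v by rewrite /v; lra.
have vq : v < q by rewrite /v; lra.
have [M M0 HM] := holo_Re_bounded_box A hZ pu vq.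
have AA : - A < A by rewrite gtrN.
pose f (t x : R) := Im (Z x t).
have dF t : t1 <= t <= t2 -> is_derive t (1 : R)
    (fun t => \int[mu]_(x in `[-A, A]) Im (Z x t)) (Re (Z A t) - Re (Z (- A) t)).
  move=> /andP[tt1 tt2].
  have It : t \in `]u, v[ by rewrite in_itv/=; apply/andP; split; lra.
  have inI s : `]u, v[%classic s -> p < s < q.
    by rewrite /= in_itv/= => /andP[? ?]; apply/andP; split; lra.
  have intf s : `]u, v[%classic s -> mu.-integrable `[-A, A] (EFin \o f s).
    move=> /inI sI; apply: continuous_compact_integrable; first exact: segment_compact.
    apply: continuous_subspaceT => x; have [_ _ c _] := hZ x s sI.
    exact: continuous_section_Im c.
  have df s x : `]u, v[%classic s -> is_derive s (1 : R) (f ^~ x) (Re (D x s)).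
    by move=> /inI sI; have [_ [_ ?] _ _] := hZ x s sI.
  have derf s x : `]u, v[%classic s -> `[-A, A]%classic x -> derivable (f ^~ x) s 1.
    by move=> /(df _ x) ? _; exact: ex_derive.
  have d1E s x : `]u, v[%classic s -> partial1of2 f s x = Re (D x s).
    by move=> sI; rewrite partial1of2E; have := df s x sI => ?; exact: derive_val.
  have Gi : mu.-integrable `[-A, A] (EFin \o cst M).
    apply: continuous_compact_integrable; first exact: segment_compact.
    by apply: continuous_subspaceT; exact: cst_continuous.
  have G_ub s x : `]u, v[%classic s -> `[-A, A]%classic x -> `|partial1of2 f s x| <= cst M x.
    move=> sI xA; rewrite d1E//; apply: HM => //.
    by move: sI; rewrite /= !in_itv/= => /andP[? ?]; apply/andP; split; exact: ltW.
  have mA : measurable (`[-A, A]%classic : set R) by [].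
  have dI := @derivable_under_integral R _ (measurableTypeR R) mu f _ mA
    t u v It intf derf (cst M) (fun=> M0) Gi G_ub.
  have vI := @differentiation_under_integral R _ (measurableTypeR R) mu f _ mA
    t u v It intf derf (cst M) (fun=> M0) Gi G_ub.
  apply: DeriveDef; first exact: dI.
  rewrite -derive1E vI.
  have -> : \int[mu]_(x in `[-A, A]) partial1of2 f t x = \int[mu]_(x in `[-A, A]) Re (D x t).
    by apply: eq_Rintegral => x _; exact: d1E.
  have tI := inI _ It.
  have cZ (x : R) : {for x, continuous (fun x => Re (Z x t))}.
    by have [_ _ c _] := hZ x t tI; exact: continuous_section_Re c.
  rewrite /Rintegral (continuous_FTC2 AA (F := fun x => Re (Z x t)))//.
  - apply: continuous_subspaceT => x; have [_ _ _ c] := hZ x t tI.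
    exact: continuous_section_Re c.
  - split.
    + by move=> x _; have [[? _] _ _ _] := hZ x t tI; exact: ex_derive.
    + by apply: cvg_at_right_filter; exact: cZ.
    + by apply: cvg_at_left_filter; exact: cZ.
  - by move=> x _; have [[? _] _ _ _] := hZ x t tI; rewrite derive1E; exact: derive_val.
pose g t := \int[mu]_(x in `[-A, A]) Im (Z x t).
have [||c cI gE] := @MVT_segment R g (fun t => Re (Z A t) - Re (Z (- A) t)) t1 t2 (ltW t12).
- by move=> t; rewrite in_itv/= => /andP[? ?]; apply: dF; apply/andP; split; exact: ltW.
- apply: continuous_in_subspaceT => t; rewrite inE/= in_itv/= => tI.
  apply: differentiable_continuous; apply/derivable1_diffP.
  by have ? := dF t tI; exact: ex_derive.
rewrite -/(g t1) -/(g t2) gE normrM [X in _ * X]gtr0_norm ?subr_gt0// ler_pM2r ?subr_gt0//.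
have cpq : p < c < q by move: cI; rewrite in_itv/= => /andP[? ?]; apply/andP; split; lra.
apply: (le_trans (ler_normB _ _)); have := e1 c cpq; have := e2 c cpq; lra.
Qed.

Lemma Rintegral_box_cvg (f : R -> R) : L1 f ->
  \int[mu]_(x in `[- n.+1%:R, n.+1%:R]) f x @[n --> \oo] --> I f.
Proof.
move=> fi; have mf := L1_measurable fi.
have [|||||_ c1] := @Rintegral_dominated_cvg R (fun n => f \_ `[- n.+1%:R, n.+1%:R]) f
  (fun x => `|f x|) 0.
- by move=> n; apply/measurable_restrict => //; exact: measurable_funTS.
- exact: mf.
- exact: (integrable_norm fi).
- by move=> n x; rewrite patchE; case: ifPn => //; rewrite normr0.
- move=> x _; apply: cvg_near_cst; near=> n; rewrite patchE ifT// inE/= in_itv/=.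
  rewrite -ler_norml; apply: (@le_trans _ _ n%:R); last by rewrite ler_nat.
  by near: n; exact: nbhs_infty_ger.
by under eq_fun do rewrite Rintegral_mkcond.
Unshelve. all: by end_near. Qed.

(** The vertical edges at x = n + 1 and x = - (n + 1) contribute at most a constant times e^(- b (n
    + 1)). *)
Lemma contour_shift Z D p q b C : 0 < b ->
  (forall x t, p < t < q -> holo Z D x t) ->
  (forall x t, p < t < q -> normc (Z x t) <= C * expabs b x) ->
  forall t1 t2, p < t1 -> t1 < t2 -> t2 < q ->
  I (fun x => Im (Z x t2)) = I (fun x => Im (Z x t1)).
Proof.
move=> b0 hZ bZ t1 t2 pt1 t12 t2q.
have ZL1 t : p < t < q -> L1 (fun x => Im (Z x t)).
  move=> tI; apply: (@L1_dominated R _ (fun x => C * expabs b x)).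
  - apply: continuous_measurable_fun => x; have [_ _ c _] := hZ x t tI.
    exact: continuous_section_Im c.
  - have := integrableZl measurableT C (L1_expabs b0).
    by apply: eq_integrable.
  - by move=> x; apply: (le_trans (normIm_le _)); exact: bZ.
have t1I : p < t1 < q by apply/andP; split; lra.
have t2I : p < t2 < q by apply/andP; split; lra.
have c1 := Rintegral_box_cvg (ZL1 _ t1I); have c2 := Rintegral_box_cvg (ZL1 _ t2I).
have c0 : (\int[mu]_(x in `[- n.+1%:R, n.+1%:R]) Im (Z x t2) -
    \int[mu]_(x in `[- n.+1%:R, n.+1%:R]) Im (Z x t1)) @[n --> \oo] --> (0 : R).
  have ce : 2 * (C * expabs b n.+1%:R) * (t2 - t1) @[n --> \oo] --> (0 : R).
    rewrite -(mul0r (t2 - t1)); apply: cvgM; last exact: cvg_cst.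
    rewrite -(mulr0 2); apply: cvgM; first exact: cvg_cst.
    rewrite -(mulr0 C); apply: cvgM; first exact: cvg_cst.
    have -> : (fun n => expabs b n.+1%:R) = (fun x => expR (- x)) \o (fun n => b * n.+1%:R).
      by apply/funext => n; rewrite /expabs /= normr_nat mulNr.
    apply: (cvg_comp _ _ _ (@cvgr_expR R)).
    apply/cvgryPge => A; near=> n; rewrite -ler_pdivrMl//.
    apply: (@le_trans _ _ n%:R); last by rewrite ler_nat.
    by near: n; exact: nbhs_infty_ger.
  apply/norm_cvg0P; apply: (squeeze_cvgr _ (cvg_cst 0) ce); near=> n.
  rewrite normr_ge0/=; apply: (rectangle_shift hZ) => //.
    by move=> t tI; apply: (le_trans (normRe_le _)); exact: bZ.
  move=> t tI; apply: (le_trans (normRe_le _)); apply: (le_trans (bZ _ _ tI)).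
  by rewrite /expabs normrN.
by apply/eqP; rewrite -subr_eq0; apply/eqP; exact: (cvg_unique _ (cvgB c2 c1) c0).
Unshelve. all: by end_near. Qed.

End holomorphic.

(** * A Cauchy integral in a sector *)

Section sector.
Context {R : realType}.
Notation mu := (@lebesgue_measure R).

Lemma normc_real (r : R) : normc (r%:C)%C = `|r|.
Proof. by rewrite /= expr0n/= addr0 sqrtr_sqr. Qed.

Lemma normc_cexpDr_sqr x t (r : R) :
  normc (cexp x t + r%:C%C) ^+ 2 = expR x ^+ 2 + 2 * expR x * r * cos t + r ^+ 2.
Proof.
rewrite normc_sqr /= addr0.
have -> : (expR x * sin t) ^+ 2 = expR x ^+ 2 * (1 - cos t ^+ 2).
  by rewrite exprMn sin2cos2.
ring.
Qed.

(** This is cos^2 (q / 2): a point of argument at most q < pi cannot cancel against a positive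
    real. *)
Definition sector_cst (q : R) := (1 + cos q) / 2.

Lemma sector_cst_gt0 q : 0 <= q < pi -> 0 < sector_cst q.
Proof.
move=> /andP[q0 qpi]; rewrite divr_gt0// -ltrBlDl sub0r -cospi.
by rewrite ltr_cos// in_itv/= ?q0 ?pi_ge0 ?lexx ?ltW.
Qed.

Lemma sector_cst_le1 q : sector_cst q <= 1.
Proof. by rewrite /sector_cst; have := cos_le1 q; lra. Qed.

Lemma sector_lower_bound x t (r q : R) : 0 <= r -> 0 <= t <= q -> q < pi ->
  sector_cst q * (expR x + r) <= normc (cexp x t + r%:C%C).
Proof.
move=> r0 /andP[t0 tq] qpi.
have c0 : 0 < sector_cst q by apply: sector_cst_gt0; rewrite qpi (le_trans t0).
have c1 := sector_cst_le1 q.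
have A0 := expR_ge0 x.
rewrite -(@ler_pXn2r _ 2)// ?nnegrE ?normc_ge0//; last first.
  by rewrite mulr_ge0 ?addr_ge0// ltW.
rewrite normc_cexpDr_sqr.
have ct : 2 * sector_cst q - 1 <= cos t.
  have -> : 2 * sector_cst q - 1 = cos q by rewrite /sector_cst; field.
  have [->//|tq'] := eqVneq t q; rewrite ltW// ltr_cos ?in_itv/=.
  - by rewrite lt_neqAle tq'.
  - by rewrite t0/= (le_trans tq)// ltW.
  - by rewrite (le_trans t0)//= ltW.
move: c0 c1 A0 ct; move: (sector_cst q) (expR x) (cos t) => c A k c0 c1 A0 ct.
(* A^2 + 2 A r (2 c - 1) + r^2 = c (A + r)^2 + (1 - c) (A - r)^2, and c >= c^2 since c <= 1. *)
have h1 : 2 * A * r * (2 * c - 1) <= 2 * A * r * k.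
  by apply: ler_wpM2l => //; rewrite !mulr_ge0.
have h2 : 0 <= c * (1 - c) * (A + r) ^+ 2.
  apply: mulr_ge0; last exact: sqr_ge0.
  by rewrite mulr_ge0 ?subr_ge0// ltW.
have h3 : 0 <= (1 - c) * (A - r) ^+ 2 by rewrite mulr_ge0 ?sqr_ge0// subr_ge0.
nra.
Qed.

Lemma lipschitz1_at0 (f df : R -> R) : (forall y, is_derive y (1 : R) f (df y)) ->
  (forall y, `|df y| <= 1) -> forall y, `|f y - f 0| <= `|y|.
Proof.
move=> Df df1 y.
have cf : continuous f.
  by move=> z; apply: differentiable_continuous; apply/derivable1_diffP; exact: ex_derive.
have cf' a b : {within `[a, b], continuous f} by apply: continuous_subspaceT.
have [y0|y0] := leP 0 y.
  have [|c _ ->] := @MVT_segment R f df 0 y y0 (fun z _ => Df z); first exact: cf'.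
  by rewrite subr0 normrM ler_piMl.
have [|c _ e] := @MVT_segment R f df y 0 (ltW y0) (fun z _ => Df z); first exact: cf'.
by rewrite distrC e sub0r normrM normrN ler_piMl.
Qed.

Lemma norm_sin_le (y : R) : `|sin y| <= `|y|.
Proof.
have := @lipschitz1_at0 sin cos (fun y => is_derive_sin y) (@cos_max R) y.
by rewrite sin0 subr0.
Qed.

Lemma norm_cosB1_le (y : R) : `|cos y - 1| <= `|y|.
Proof.
have := @lipschitz1_at0 cos (fun y => - sin y) (fun y => is_derive_cos y) _ y.
by rewrite cos0; apply => z; rewrite normrN; exact: sin_max.
Qed.

Lemma norm_expRB1_le (y : R) : `|expR y - 1| <= `|y| * expR `|y|.
Proof.
have [y0|y0] := leP 0 y.
  rewrite !ger0_norm// ?subr_ge0 ?leNgt ?expR_lt1 -?leNgt//.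
  have := expR_ge1Dx (- y); have := expRxMexpNx_1 y; have := expR_gt0 y; nra.
rewrite !ltr0_norm// ?subr_lt0 ?expR_lt1//.
have := expR_ge1Dx y; have : 1 <= expR (- y) by rewrite leNgt expR_lt1 -leNgt oppr_ge0 ltW.
nra.
Qed.

(** sinh (x + i t); the factors 1 and - 1 are kept so that [holo_cexp] and [ccont_cexp] apply as
    they stand. *)
Definition csinh (x t : R) : R[i] :=
  (cexp (1 * x) (1 * t) - cexp (- 1 * x) (- 1 * t)) * (2^-1)%:C%C.

(** Source of the lower bounds that follow: |sin t| and |x| / 2 serve near the pole w = 0, and e^|x|
    / 4 at infinity. *)
Lemma normc_csinh_sqr x t :
  normc (csinh x t) ^+ 2 = ((expR x - expR (- x)) / 2) ^+ 2 + sin t ^+ 2.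
Proof.
rewrite normc_sqr /csinh !mul1r !mulN1r /= !mulr0 !subr0 add0r cosN sinN.
have e := expRxMexpNx_1 x; have c := sin2cos2 t.
move: e c; move: (expR x) (expR (- x)) (sin t) (cos t) => u v s k e c.
have -> : ((u * k - v * k) * 2^-1) ^+ 2 + ((u * s - v * - s) * 2^-1) ^+ 2 =
  ((u - v) / 2) ^+ 2 * (k ^+ 2 + s ^+ 2) + u * v * s ^+ 2 by field.
by rewrite c e mul1r; congr (_ + _); ring.
Qed.

Lemma csinh_ge_sin x t : `|sin t| <= normc (csinh x t).
Proof.
rewrite -(@ler_pXn2r _ 2)// ?nnegrE ?normc_ge0// normc_csinh_sqr.
by rewrite real_normK ?num_real// lerDr sqr_ge0.
Qed.

Lemma csinh_ge_sinh x t : `|expR x - expR (- x)| / 2 <= normc (csinh x t).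
Proof.
rewrite -(@ler_pXn2r _ 2)// ?nnegrE ?normc_ge0 ?divr_ge0// normc_csinh_sqr.
by rewrite exprMn real_normK ?num_real// -exprMn lerDl sqr_ge0.
Qed.

Lemma norm_sinh_sym (x : R) : `|expR x - expR (- x)| = `|expR `|x| - expR (- `|x|)|.
Proof.
by have [x0|x0] := leP 0 x; rewrite ?(ger0_norm x0)// (ltr0_norm x0) opprK distrC.
Qed.

Lemma csinh_ge_id x t : `|x| / 2 <= normc (csinh x t).
Proof.
rewrite (le_trans _ (csinh_ge_sinh x t))// ler_pM2r// norm_sinh_sym.
have := normr_ge0 x; move: (`|x|) => y y0; rewrite (le_trans _ (ler_norm _))//.
have := expR_ge1Dx y; have := expRxMexpNx_1 y; have := expR_gt0 (- y); nra.
Qed.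

Lemma csinh_ge_exp x t : 1 <= `|x| -> expR `|x| / 4 <= normc (csinh x t).
Proof.
move=> x1; rewrite (le_trans _ (csinh_ge_sinh x t))// norm_sinh_sym.
move: x1; move: (`|x|) => y y1.
have := expR_ge1Dx y; have := expRxMexpNx_1 y; have := expR_gt0 (- y).
have := ler_norm (expR y - expR (- y)); nra.
Qed.

Lemma csinh_neq0 x t : 0 < t < pi -> csinh x t != 0.
Proof.
move=> /sin_gt0_pi st; have := csinh_ge_sin x t; rewrite gtr0_norm// => h.
by apply: contraTneq h => ->; rewrite normc0 -ltNge.
Qed.

Lemma csinh_neq0_axis x : x != 0 -> csinh x 0 != 0.
Proof.
move=> x0; have := csinh_ge_id x 0 => h.
by apply: contraTneq h => ->; rewrite normc0 -ltNge divr_gt0// normr_gt0.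
Qed.

Lemma ccont_csinh x t : ccont csinh x t.
Proof.
apply: ccontM; last exact: ccont_cst.
by apply: ccontD; [exact: ccont_cexp|apply: ccontN; exact: ccont_cexp].
Qed.

Lemma Im_csinhV (x t : R) : Im ((csinh x t)^-1) = - ((expR x + expR (- x)) / 2 * sin t /
  (((expR x - expR (- x)) / 2) ^+ 2 + sin t ^+ 2)).
Proof.
rewrite cImV -normc_sqr normc_csinh_sqr; congr (- (_ / _)).
by rewrite /csinh !mulN1r !mul1r /= mulr0 add0r sinN; field.
Qed.

Lemma L1_Im_csinhV (t : R) : 0 < t < pi -> L1 (fun x => Im ((csinh x t)^-1)).
Proof.
move=> tpi; have s0 := sin_gt0_pi tpi.
have e1 : 1 <= expR 1 :> R by rewrite leNgt expR_lt1 -leNgt.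
(* e / sin t covers |x| <= 1, where e^(-|x|) >= 1 / e; 4 covers |x| > 1. *)
pose C := 4 + expR 1 / sin t.
have C0 : 0 <= expR 1 / sin t by rewrite divr_ge0 ?expR_ge0// ltW.
apply: (@L1_dominated R _ (fun x => C * expabs 1 x)).
- apply: continuous_measurable_fun => x; apply: (continuous_section_Im (Z := fun x t => (csinh x t)^-1)).
  by apply: ccontV; [exact: csinh_neq0|exact: ccont_csinh].
- by have := integrableZl measurableT C (L1_expabs (@ltr01 R)); apply: eq_integrable.
- move=> x; apply: (le_trans (normIm_le _)); rewrite normcV.
  have [x1|x1] := leP (`|x|) 1.
    apply: (@le_trans _ _ (sin t)^-1).
      by rewrite lef_pV2 ?posrE// -?[leLHS](gtr0_norm s0) ?csinh_ge_sin//
        (lt_le_trans s0)// (le_trans (ler_norm _))// csinh_ge_sin.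
    rewrite /C mulrDl (@le_trans _ _ (expR 1 / sin t * expabs 1 x))//; last first.
      by rewrite lerDr mulr_ge0// expR_ge0.
    rewrite mulrAC -[leLHS]mul1r ler_pM2r ?invr_gt0// -expRD -[leLHS]expR0 ler_expR.
    by rewrite mulN1r subr_ge0.
  apply: (@le_trans _ _ (4 * expabs 1 x)); last by rewrite ler_wpM2r ?expR_ge0// lerDl.
  rewrite /expabs mulN1r expRN -[4]invrK -invfM lef_pV2 ?posrE ?mulr_gt0 ?expR_gt0//.
    by rewrite mulrC csinh_ge_exp// ltW.
  by rewrite (lt_le_trans _ (csinh_ge_exp _ (ltW x1)))// divr_gt0// expR_gt0.
Qed.

(* [- Im (1 / sinh w)] is the derivative of [atan (sinh x / sin t)]. *)
Lemma Rintegral_Im_csinhV (t : R) : 0 < t < pi -> I (fun x => Im ((csinh x t)^-1)) = - pi.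
Proof.
move=> tpi; have s0 := sin_gt0_pi tpi.
pose G x := - atan ((expR x - expR (- x)) / 2 / sin t).
have dG (x : R) : is_derive x (1 : R) G (Im ((csinh x t)^-1)).
  have D1 : is_derive x (1 : R) (fun x => (expR x - expR (- x)) / 2 / sin t)
      ((expR x + expR (- x)) / 2 / sin t).
    apply: is_derive_eq; rewrite /GRing.scale /=; field; exact: lt0r_neq0.
  pose y := (expR x - expR (- x)) / 2 / sin t.
  have D2 : is_derive y (1 : R) (@atan R) ((1 + y ^+ 2)^-1).
    by apply: DeriveDef; [exact: derivable_atan|rewrite -derive1E derive1_atan].
  have D3 := @is_derive1_comp R (@atan R) (fun x => (expR x - expR (- x)) / 2 / sin t) x _ _ D2 D1.
  apply: (is_derive_eq (is_deriveN D3)).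
  rewrite Im_csinhV /y /GRing.scale /=; congr (- _).
  move: (_ / 2) ((expR x - _) / 2) (sin t) s0 => ch sh s s0.
  have n1 : sh ^+ 2 + s ^+ 2 != 0 by rewrite lt0r_neq0// ltr_wpDl ?sqr_ge0// exprn_gt0.
  have n2 : s != 0 by exact: lt0r_neq0.
  have -> : 1 + (sh / s) ^+ 2 = (sh ^+ 2 + s ^+ 2) / s ^+ 2 by field.
  by field; rewrite n1 n2.
have cIm : continuous (fun x => Im ((csinh x t)^-1)).
  move=> x; apply: (continuous_section_Im (Z := fun x t => (csinh x t)^-1)).
  by apply: ccontV; [exact: csinh_neq0|exact: ccont_csinh].
have sh_y : (expR x - expR (- x)) / 2 / sin t @[x --> +oo] --> +oo.
  apply/cvgryPge => A; near=> x.
  rewrite ler_pdivlMr//.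
  have : 0 <= x by near: x; exact: nbhs_pinfty_ge.
  have : 2 * `|A * sin t| <= x by near: x; apply: nbhs_pinfty_ge; rewrite num_real.
  have := csinh_ge_id x t; have := expR_ge1Dx x; have := expRxMexpNx_1 x.
  have := expR_gt0 (- x); have := ler_norm (A * sin t).
  move: (A * sin t) => As; nra.
have Gy : G x @[x --> +oo] --> - (pi / 2).
  by apply: cvgN; exact: (cvg_comp _ _ sh_y (@cvgy_atan R)).
have GNy : G x @[x --> -oo] --> pi / 2.
  apply/cvgNy_compNP.
  have -> : G \o -%R = fun x => - G x.
    apply/funext => x; rewrite /G /= !opprK -atanN; congr (atan _).
    by field; exact: lt0r_neq0.
  by rewrite -[pi / 2]opprK; apply: cvgN.
rewrite (continuous_FTC_line dG cIm (L1_Im_csinhV tpi) GNy Gy).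
by field.
Unshelve. all: by end_near. Qed.

Variable q : R.
Hypothesis q0 : 0 < q.

(** A Lipschitz bound at the origin only, which is all that is required to cancel the simple pole of
    1 / sinh w at w = 0. *)
Definition lip0 (Z : R -> R -> R[i]) := exists2 L, 0 <= L &
  forall x t, `|x| <= 1 -> 0 <= t <= q -> normc (Z x t - Z 0 0) <= L * (`|x| + t).

Lemma lip0_cst c : lip0 (fun _ _ => c).
Proof.
exists 0 => // x t _ /andP[t0 _].
by rewrite subrr normc0 mul0r.
Qed.

Lemma lip0D Z W : lip0 Z -> lip0 W -> lip0 (fun x t => Z x t + W x t).
Proof.
move=> [L L0 hL] [M M0 hM]; exists (L + M); first exact: addr_ge0.
move=> x t hx ht; have -> : Z x t + W x t - (Z 0 0 + W 0 0) =
  (Z x t - Z 0 0) + (W x t - W 0 0) by ring.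
by rewrite (le_trans (normc_triangle _ _))// mulrDl lerD// ?hL ?hM.
Qed.

Lemma lip0M Z W : lip0 Z -> lip0 W -> lip0 (fun x t => Z x t * W x t).
Proof.
move=> [L L0 hL] [M M0 hM].
exists (L * (normc (W 0 0) + M * (1 + q)) + normc (Z 0 0) * M).
  by rewrite !(addr_ge0, mulr_ge0)// ?normc_ge0// ?ltW.
move=> x t hx ht; have -> : Z x t * W x t - Z 0 0 * W 0 0 =
  (Z x t - Z 0 0) * W x t + Z 0 0 * (W x t - W 0 0) by ring.
rewrite (le_trans (normc_triangle _ _))// !normcM mulrDl; apply: lerD; last first.
  by rewrite -mulrA ler_wpM2l ?normc_ge0// hM.
rewrite mulrAC; apply: ler_pM; rewrite ?normc_ge0// ?hL//.
have -> : W x t = W 0 0 + (W x t - W 0 0) by ring.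
rewrite (le_trans (normc_triangle _ _))// lerD2l (le_trans (hM _ _ hx ht))//.
by case/andP: ht => ? ?; rewrite ler_wpM2l// lerD.
Qed.

Lemma lip0V Z m : 0 < m ->
  (forall x t, `|x| <= 1 -> 0 <= t <= q -> m <= normc (Z x t)) ->
  lip0 Z -> lip0 (fun x t => (Z x t)^-1).
Proof.
move=> m0 hm [L L0 hL]; exists (L / (m * m)).
  by rewrite divr_ge0// mulr_ge0// ltW.
move=> x t hx ht; have mx := hm _ _ hx ht.
have m00 : m <= normc (Z 0 0) by rewrite hm// ?normr0// lexx ltW.
have n0 (z : R[i]) : m <= normc z -> z != 0.
  by move=> h; apply: contraTneq h => ->; rewrite normc0 -ltNge.
have -> : (Z x t)^-1 - (Z 0 0)^-1 = - (Z x t - Z 0 0) * ((Z x t)^-1 * (Z 0 0)^-1).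
  by field; rewrite !n0.
rewrite normcM normcN mulrAC; apply: ler_pM; rewrite ?normc_ge0// ?hL//.
rewrite normcM !normcV -invfM lef_pV2 ?posrE ?mulr_gt0 ?(lt_le_trans m0)//.
by apply: ler_pM => //; exact: ltW.
Qed.

Lemma lip0_cexp k : lip0 (fun x t => cexp (k * x) (k * t)).
Proof.
exists (3 * (`|k| * expR `|k|)); first by rewrite !mulr_ge0 ?expR_ge0.
move=> x t hx /andP[t0 tq].
rewrite !mulr0 cexp0; set e := expR `|k|.
have e1 : 1 <= e by rewrite leNgt expR_lt1 -leNgt.
have nkx : `|k * x| <= `|k| by rewrite normrM ler_piMr.
have ex : `|expR (k * x) - 1| <= `|k| * `|x| * e.
  rewrite (le_trans (norm_expRB1_le _))// normrM ler_wpM2l// ?mulr_ge0//.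
  by rewrite ler_expR -normrM.
have ekx : expR (k * x) <= e by rewrite ler_expR (le_trans (ler_norm _)).
have nkt : `|k * t| = `|k| * t by rewrite normrM (ger0_norm t0).
have ct := norm_cosB1_le (k * t); have st := norm_sin_le (k * t).
rewrite nkt in ct st.
have k0 := normr_ge0 k; have x0 := normr_ge0 x.
rewrite (le_trans (normc_le_Re_Im _))//=.
have h1 : `|expR (k * x) * cos (k * t) - 1| <= `|k| * `|x| * e + `|k| * t.
  have -> : expR (k * x) * cos (k * t) - 1 =
    (expR (k * x) - 1) * cos (k * t) + (cos (k * t) - 1) by ring.
  rewrite (le_trans (ler_normD _ _))// lerD// normrM.
  by rewrite (le_trans _ ex)// ler_piMr// cos_max.
have h2 : `|expR (k * x) * sin (k * t) - 0| <= e * (`|k| * t).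
  by rewrite subr0 normrM ler_pM// ger0_norm// expR_ge0.
rewrite (le_trans (lerD h1 h2))//.
have kt0 : 0 <= `|k| * t by exact: mulr_ge0.
have kx0 : 0 <= `|k| * `|x| by exact: mulr_ge0.
have -> : 3 * (`|k| * e) * (`|x| + t) = 3 * e * (`|k| * `|x|) + 3 * e * (`|k| * t) by ring.
nra.
Qed.

(** Half angles stay below pi / 2, where cos is positive and decreasing: the mean value theorem
    bounds sin (t / 2) from below, and sin t = 2 sin (t / 2) cos (t / 2). *)
Lemma sin_lower_bound t : 0 <= t <= q -> q < pi -> cos (q / 2) ^+ 2 * t <= sin t.
Proof.
move=> /andP[t0 tq] qpi.
have q2 : 0 < cos (q / 2) by apply: cos_gt0_pihalf; lra.
have cmono c : 0 <= c <= q / 2 -> cos (q / 2) <= cos c.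
  move=> /andP[c0 cq]; have [->//|cq'] := eqVneq c (q / 2).
  by rewrite ltW// ltr_cos ?in_itv/= ?lt_neqAle ?cq'//; apply/andP; split; lra.
have st : sin (t / 2) >= cos (q / 2) * (t / 2).
  have cs : {within `[0, t / 2], continuous (@sin R)}.
    by apply: continuous_subspaceT; exact: continuous_sin.
  have t20 : 0 <= t / 2 by lra.
  have [c] := MVT_segment t20 (fun z _ => is_derive_sin z) cs.
  rewrite in_itv/= sin0 !subr0 => /andP[c0 ct] ->.
  by rewrite ler_wpM2r// cmono// c0/=; lra.
have -> : t = (t / 2) *+ 2 by rewrite mulr2n; field.
rewrite sin_mulr2n.
have : cos (q / 2) <= cos (t / 2) by apply: cmono; apply/andP; split; lra.
rewrite !mulr2n; move: st q2; move: (cos (q / 2)) (sin (t / 2)) (cos (t / 2)) => k s c.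
move=> st k0 kc.
have h1 : k * (k * (t / 2)) <= k * s by rewrite ler_pM2l.
have h2 : k * s <= c * s by apply: ler_wpM2r => //; rewrite (le_trans _ st)// mulr_ge0 ?divr_ge0// ltW.
have -> : k ^+ 2 * (t / 2 + t / 2) = k * (k * (t / 2)) + k * (k * (t / 2)) by ring.
lra.
Qed.

End sector.

Section sector_identity.
Context {R : realType}.
Notation mu := (@lebesgue_measure R).
Variables (al lam : R).
Hypothesis al0 : 0 <= al.
Hypothesis lam0 : 0 < lam.

Definition den (x t : R) : R[i] := cexp (al * x) (al * t) + lam%:C%C.

(* In terms of [z = e^w], [w = x + i t], this is [z^k / (z^al + lam)]. *)
Definition Psi (k x t : R) : R[i] := cexp (k * x) (k * t) * (den x t)^-1.

Variable q : R.
Hypothesis q0 : 0 < q.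
Hypothesis qpi : q < pi.
Hypothesis alq : al * q < pi.

Let c := sector_cst (al * q).

Let c_gt0 : 0 < c.
Proof. by apply: sector_cst_gt0; rewrite alq mulr_ge0// ltW. Qed.

Lemma den_ge x t : 0 <= t <= q -> c * (expR (al * x) + lam) <= normc (den x t).
Proof.
move=> /andP[t0 tq]; apply: sector_lower_bound => //; first exact: ltW.
by rewrite mulr_ge0//= ler_wpM2l.
Qed.

Lemma den_neq0 x t : 0 <= t <= q -> den x t != 0.
Proof.
move=> /(den_ge x) h; apply: contraTneq h => ->.
by rewrite normc0 -ltNge mulr_gt0// addr_gt0// expR_gt0.
Qed.

Lemma normc_Psi_le k x t : 0 <= t <= q ->
  normc (Psi k x t) <= expR (k * x) / (c * (expR (al * x) + lam)).
Proof.
move=> ht; rewrite normcM normcV normc_cexp ler_pM2l ?expR_gt0//.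
rewrite lef_pV2 ?posrE ?den_ge//; first by rewrite (lt_le_trans _ (den_ge _ ht))// mulr_gt0// addr_gt0// expR_gt0.
by rewrite mulr_gt0// addr_gt0// expR_gt0.
Qed.

Lemma ccont_den x t : ccont den x t.
Proof. by apply: ccontD; [exact: ccont_cexp|exact: ccont_cst]. Qed.

Lemma ccont_Psi k x t : 0 <= t <= q -> ccont (Psi k) x t.
Proof.
move=> ht; apply: ccontM; first exact: ccont_cexp.
by apply: ccontV; [exact: den_neq0|exact: ccont_den].
Qed.

Variable a : R.
Hypothesis a1 : -1 < a.
Hypothesis aal : a < al.

(* Since [(1 + e^-w) / (2 sinh w) = - 1 / (1 - e^w)], the integrand
   [e^((a + 1) w) / ((e^(al w) + lam) (1 - e^w))] equals [F - Q(0) / sinh w],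
   where the pole at [w = 0] of [F] is removed; as [t] tends to [0] the integral
   of [Im F] tends to [0], and the integral of [Im (1 / sinh w)] is [- pi]. *)
Let Q x t := Psi (a + 1) x t * (1 + cexp (- 1 * x) (- 1 * t)) * (2^-1)%:C%C.
Let F x t := - ((Q x t - Q 0 0) * (csinh x t)^-1).
(** Decay rate of F: e^((a + 1) x) at - oo, e^((a - al) x) at + oo, and e^(-|x|) from Q(0) / sinh
    w. *)
Let b := Num.min (Num.min (a + 1) (al - a)) 1.

Let b_gt0 : 0 < b.
Proof. by rewrite !lt_min ltr01 subr_gt0 aal -ltrBlDr sub0r a1. Qed.

Let ba : b <= a + 1. Proof. by rewrite !ge_min lexx. Qed.
Let bal : b <= al - a. Proof. by rewrite !ge_min lexx orbT. Qed.
Let b1 : b <= 1. Proof. by rewrite !ge_min lexx orbT. Qed.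

Let ccontQ x t : 0 <= t <= q -> ccont Q x t.
Proof.
move=> ht; apply: ccontM; last exact: ccont_cst.
apply: ccontM; first exact: ccont_Psi.
by apply: ccontD; [exact: ccont_cst|exact: ccont_cexp].
Qed.

Let ccontF x t : 0 <= t <= q -> csinh x t != 0 -> ccont F x t.
Proof.
move=> ht s0; apply: ccontN; apply: ccontM; last by apply: ccontV => //; exact: ccont_csinh.
by apply: ccontD; [exact: ccontQ|exact: ccont_cst].
Qed.

Let dF : exists D, forall x t, 0 < t < q -> holo F D x t.
Proof.
eexists => x t /andP[t0 tq]; apply: holoN; apply: holoM.
  apply: holoD; last exact: holo_cst.
  apply: holoM; last exact: holo_cst.
  apply: holoM; last by apply: holoD; [exact: holo_cst|exact: holo_cexp].
  apply: holoM; first exact: holo_cexp.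
  apply: holoV; first by apply: den_neq0; rewrite !ltW.
  by apply: holoD; [exact: holo_cexp|exact: holo_cst].
apply: holoV; first by apply: csinh_neq0; rewrite t0 (lt_trans tq).
apply: holoM; last exact: holo_cst.
by apply: holoD; [exact: holo_cexp|apply: holoN; exact: holo_cexp].
Qed.

Let lip0Q : lip0 q Q.
Proof.
apply: lip0M => //; last exact: lip0_cst.
apply: lip0M => //; last by apply: lip0D => //; [exact: lip0_cst|exact: lip0_cexp].
apply: lip0M => //; first exact: lip0_cexp.
apply: (@lip0V _ _ q0 _ (c * lam)) => //; first by rewrite mulr_gt0.
  move=> x t _ ht; rewrite (le_trans _ (den_ge x ht))// ler_pM2l//.
  by rewrite lerDr expR_ge0.
by apply: lip0D => //; [exact: lip0_cexp|exact: lip0_cst].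
Qed.

Let C1 := c^-1 * (1 + lam^-1).

Let Q_le x t : 0 <= t <= q -> normc (Q x t) * expR (- `|x|) <= C1 * expabs b x.
Proof.
move=> ht.
have h1 : normc (1 + cexp (- 1 * x) (- 1 * t)) <= 1 + expR (- x).
  rewrite (le_trans (normc_triangle _ _))// -[1 in leLHS]/(1%:C%C) normc_real normr1.
  by rewrite normc_cexp mulN1r.
have h2 : normc (Q x t) <= normc (Psi (a + 1) x t) * ((1 + expR (- x)) / 2).
  rewrite !normcM normc_real gtr0_norm// -mulrA ler_wpM2l ?mulr_ge0 ?normc_ge0// -?normcV ?normc_ge0//.
  by rewrite ler_wpM2r.
have hP := normc_Psi_le (a + 1) x ht.
have ea := expR_gt0 (al * x).
rewrite (le_trans (ler_wpM2r (expR_ge0 _) h2))//.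
have [x0|x0] := leP 0 x.
  have e1 : (1 + expR (- x)) / 2 <= 1.
    by rewrite ler_pdivrMr// mul1r -lerBrDl -[X in _ <= X]/(1 + 1 - 1) addrK;
      rewrite leNgt expR_gt1 -leNgt oppr_le0.
  have hP2 : normc (Psi (a + 1) x t) <= c^-1 * expR ((a + 1 - al) * x).
    rewrite (le_trans hP)// mulrBl expRB mulrCA ler_pM2l ?expR_gt0//.
    rewrite invfM ler_pM2l ?invr_gt0// lef_pV2 ?posrE ?addr_gt0//.
    by rewrite lerDl ltW.
  apply: (@le_trans _ _ (c^-1 * expR ((a + 1 - al) * x) * expR (- `|x|))).
    rewrite ler_wpM2r ?expR_ge0// (le_trans _ hP2)//.
    by rewrite ler_piMr ?normc_ge0.
  rewrite -!mulrA ler_pM2l ?invr_gt0// -expRD ger0_norm//.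
  rewrite -[leLHS]mul1r; apply: ler_pM => //.
    by rewrite lerDl invr_ge0 ltW.
  have -> : (a + 1 - al) * x - x = (a - al) * x by ring.
  by rewrite /expabs ler_expR ger0_norm// ler_wpM2r// lerNr opprB.
have e1 : (1 + expR (- x)) / 2 <= expR (- x).
  have : 1 <= expR (- x) by rewrite leNgt expR_lt1 -leNgt oppr_ge0 ltW.
  lra.
have hP2 : normc (Psi (a + 1) x t) <= c^-1 * lam^-1 * expR ((a + 1) * x).
  rewrite (le_trans hP)// mulrC -invfM ler_pM2r ?expR_gt0//.
  have p1 : 0 < c * lam by exact: mulr_gt0.
  have p2 : 0 < c * (expR (al * x) + lam) by rewrite mulr_gt0// addr_gt0.
  by rewrite lef_pV2 ?posrE// ler_pM2l// lerDr ltW.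
apply: (@le_trans _ _ (c^-1 * lam^-1 * expR ((a + 1) * x) * expR (- x) * expR (- `|x|))).
  by rewrite ler_wpM2r ?expR_ge0// ler_pM ?normc_ge0// divr_ge0// addr_ge0 ?expR_ge0.
rewrite -!mulrA ler_pM2l ?invr_gt0// -!expRD ltr0_norm// opprK addNr addr0.
apply: ler_pM; rewrite ?invr_ge0 ?expR_ge0//; first exact: ltW.
  by rewrite lerDr.
rewrite /expabs ler_expR ltr0_norm// mulrNN; rewrite ler_nM2r//.
Qed.

(** The bound is uniform down to t = 0, so that dominated convergence applies when the line descends
    to the real axis. *)
Let F_le : exists2 C, 0 <= C & forall x t, 0 < t < q -> normc (F x t) <= C * expabs b x.
Proof.
have [L L0 hL] := lip0Q.
have q2 : 0 < cos (q / 2) ^+ 2.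
  by rewrite exprn_gt0// cos_gt0_pihalf//; have := q0; have := qpi; lra.
set k := cos (q / 2) ^+ 2 in q2.
have e1 : 1 <= expR 1 :> R by rewrite leNgt expR_lt1 -leNgt.
(* For |x| <= 1 the quotient is at most L (2 + 1 / k), since |x| <= 2 |sinh w| and k t <= sin t <=
   |sinh w|; the factor e compensates e^(- b |x|) >= 1 / e. C3 is for |x| > 1. *)
pose C2 := L * (2 + k^-1) * expR 1; pose C3 := 4 * (C1 + normc (Q 0 0)).
have C10 : 0 <= C1 by rewrite mulr_ge0 ?addr_ge0 ?invr_ge0// ltW.
have C20 : 0 <= C2 by rewrite !mulr_ge0 ?addr_ge0 ?invr_ge0 ?expR_ge0// ltW.
have C30 : 0 <= C3 by rewrite mulr_ge0// addr_ge0// normc_ge0.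
exists (C2 + C3); first exact: addr_ge0.
move=> x t /andP[t0 tq].
have ht : 0 <= t <= q by rewrite !ltW.
have s0 : 0 < normc (csinh x t).
  rewrite (lt_le_trans _ (csinh_ge_sin x t))// normr_gt0 gt_eqF//.
  by rewrite sin_gt0_pi// t0 (lt_trans tq).
rewrite normcN normcM normcV mulrDl.
have [x1|x1] := leP (`|x|) 1.
  apply: (@le_trans _ _ (C2 * expabs b x)); last by rewrite lerDl mulr_ge0// expR_ge0.
  apply: (@le_trans _ _ (L * (2 + k^-1))).
    rewrite ler_pdivrMr// (le_trans (hL _ _ x1 ht))// -mulrA ler_wpM2l// mulrDl.
    apply: lerD; first by have := csinh_ge_id x t; lra.
    rewrite mulrC ler_pdivlMr// mulrC (le_trans _ (csinh_ge_sin x t))//.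
    by rewrite (le_trans _ (ler_norm _))// sin_lower_bound.
  rewrite /C2 -[leLHS]mulr1 -[leRHS]mulrA ler_wpM2l//.
    by rewrite mulr_ge0// addr_ge0// invr_ge0 ltW.
  rewrite -expRD -[leLHS]expR0 ler_expR mulNr subr_ge0.
  by rewrite (le_trans _ b1)// ler_piMr// ltW.
apply: (@le_trans _ _ (C3 * expabs b x)); last by rewrite lerDr mulr_ge0// expR_ge0.
have S1 : (normc (csinh x t))^-1 <= 4 * expR (- `|x|).
  rewrite expRN -[4]invrK -invfM lef_pV2 ?posrE// ?mulr_gt0 ?expR_gt0//.
  by rewrite mulrC csinh_ge_exp// ltW.
apply: (@le_trans _ _ ((normc (Q x t) + normc (Q 0 0)) * (4 * expR (- `|x|)))).
  apply: ler_pM => //; rewrite ?normc_ge0 ?invr_ge0 ?normc_ge0//.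
  by rewrite (le_trans (normc_triangle _ _))// normcN.
rewrite mulrCA /C3 -mulrA ler_pM2l// !mulrDl; apply: lerD; first exact: Q_le.
rewrite ler_wpM2l ?normc_ge0// /expabs ler_expR mulNr lerN2.
by rewrite ler_piMl.
Qed.

Let cexpN1 (x t : R) : cexp (- 1 * x) (- 1 * t) = (cexp (1 * x) (1 * t))^-1.
Proof.
apply: (mulIf (cexp_neq0 (1 * x) (1 * t))).
by rewrite mulVf ?cexp_neq0// -cexpD !mulN1r !mul1r !addNr cexp0.
Qed.

Let half : (2^-1)%:C%C = 2^-1 :> R[i].
Proof. by rewrite fmorphV rmorph_nat. Qed.

Let Q00 : Q 0 0 = ((1 + lam)^-1)%:C%C.
Proof.
rewrite /Q /Psi /den !mulr0 !cexp0 half mul1r fmorphV rmorphD rmorph1.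
have : (1 + lam%:C%C : R[i]) != 0.
  rewrite -[1]/(1%:C%C) -rmorphD eq_complex /= eqxx andbT.
  by rewrite gt_eqF// addr_gt0.
by move=> h; field.
Qed.

Definition sector_integrand (x t : R) : R[i] :=
  Psi (a + 1) x t * (1 - cexp (1 * x) (1 * t))^-1.

Let F_E x t : 0 < t < q ->
  F x t = sector_integrand x t + ((1 + lam)^-1)%:C%C * (csinh x t)^-1.
Proof.
move=> /andP[t0 tq].
have s0 : csinh x t != 0 by apply: csinh_neq0; rewrite t0 (lt_trans tq).
rewrite /F Q00 /Q /sector_integrand; move: s0; rewrite /csinh cexpN1 half.
have e0 := cexp_neq0 (1 * x) (1 * t).
move: (cexp _ _) (Psi _ _ _) (_%:C%C) e0 => e P r e0 s0.
have e2 : e * e - 1 != 0.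
  have ee : e - e^-1 = (e * e - 1) / e by field.
  by apply: contra s0 => /eqP h; rewrite ee h !mul0r.
have e3 : 1 - e != 0.
  have ee : e * e - 1 = - (1 - e) * (1 + e) by ring.
  by apply: contra e2 => /eqP h; rewrite ee h oppr0 mul0r.
by field; rewrite e0 e2 e3.
Qed.

(** Cauchy's formula at z = 1 for z^a / (z^al + lam), the two conjugate rays being combined into one
    imaginary part. *)
Lemma L1_Im_sector_integrand t : 0 < t < q -> L1 (fun x => Im (sector_integrand x t)) /\
  I (fun x => Im (sector_integrand x t)) = pi / (1 + lam).
Proof.
move=> tq; have tpi : 0 < t < pi by case/andP: tq => -> /lt_trans -> .
have [C C0 hF] := F_le; have [D hD] := dF.
have FL1 s : 0 < s < q -> L1 (fun x => Im (F x s)).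
  move=> sq; apply: (@L1_dominated R _ (fun x => C * expabs b x)).
  - apply: continuous_measurable_fun => x; have [_ _ cF _] := hD x s sq.
    exact: continuous_section_Im cF.
  - by have := integrableZl measurableT C (L1_expabs b_gt0); apply: eq_integrable.
  - by move=> x; apply: (le_trans (normIm_le _)); exact: hF.
have IF0 : I (fun x => Im (F x t)) = 0.
  (* Heights tending to 0; the shift by 2 keeps them strictly below t, as [contour_shift]
     requires. *)
  pose u n := t / n.+2%:R.
  have u_gt0 n : 0 < u n by rewrite divr_gt0//; case/andP: tq.
  have u_lt n : u n < t.
    by rewrite ltr_pdivrMr// ltr_pMr ?ltr1n//; case/andP: tq.
  have uq n : 0 < u n < q by rewrite u_gt0 (lt_trans (u_lt n))//; case/andP: tq.
  have IE n : I (fun x => Im (F x (u n))) = I (fun x => Im (F x t)).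
    by symmetry; apply: (contour_shift b_gt0 hD hF) => //; case/andP: tq.
  have u0 : u n @[n --> \oo] --> (0 : R).
    rewrite -(mulr0 t); apply: cvgM; first exact: cvg_cst.
    have := @cvg_harmonic R; rewrite -(cvg_shiftS _) => h; exact: h.
  have [|||||_] := @Rintegral_dominated_cvg R (fun n x => Im (F x (u n))) (cst 0)
      (fun x => C * expabs b x) 0.
  - by move=> n; exact: L1_measurable (FL1 _ (uq n)).
  - exact: measurable_cst.
  - by have := integrableZl measurableT C (L1_expabs b_gt0); apply: eq_integrable.
  - by move=> n x; apply: (le_trans (normIm_le _)); exact: hF.
  - move=> x x0; have q00 : 0 <= (0 : R) <= q by rewrite lexx ltW.
    have [_ cI] := ccontF q00 (csinh_neq0_axis x0).
    (* On the real axis F is real, so the limit integrand vanishes. *)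
    have -> : cst 0 x = Im (F x 0).
      have cr k : cexp (k * x) (k * 0) = (expR (k * x))%:C%C :> R[i].
        by rewrite /cexp mulr0 cos0 sin0 mulr1 mulr0.
      have r1 : 1 = (1 : R)%:C%C :> R[i] by [].
      rewrite /F Q00 /Q /Psi /den /csinh !cr r1.
      by rewrite -!(rmorphD, rmorphM, rmorphN, fmorphV).
    apply: (cvg_comp (fun n => (x, u n)) _ _ cI).
    by apply: (@cvg_pair _ _ _ _ (nbhs x) (nbhs 0) _ _ _ (cst x) u); [exact: cvg_cst|].
  under eq_fun do rewrite IE.
  have cc : I (fun x => Im (F x t)) @[n --> \oo] --> I (fun x => Im (F x t)).
    exact: cvg_cst.
  by move=> h; rewrite (cvg_unique _ cc h)// /Rintegral integral0.
have iS := L1_Im_csinhV tpi.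
have kS : L1 (fun x => (1 + lam)^-1 * Im ((csinh x t)^-1)).
  by have := integrableZl measurableT (1 + lam)^-1 iS; apply: eq_integrable.
have HE : (fun x => Im (sector_integrand x t)) =
    fun x => Im (F x t) - (1 + lam)^-1 * Im ((csinh x t)^-1).
  apply/funext => x; rewrite F_E// cImD.
  have ImZ r (z : R[i]) : Im (r%:C%C * z) = r * Im z by rewrite cImM /= mul0r addr0.
  by rewrite ImZ addrK.
rewrite HE; split.
  by have := integrableB measurableT (FL1 t tq) kS; apply: eq_integrable.
rewrite RintegralB//; last exact: FL1.
by rewrite IF0 RintegralZl// Rintegral_Im_csinhV// sub0r mulrN opprK mulrC.
Qed.

End sector_identity.

(** * Power kernels and fractional integrals *)

Section power_kernel.
Context {R : realType}.
Notation mu := (@lebesgue_measure R).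
Implicit Types f g : R -> R.

Lemma integral_restrict_EFin f (D : set R) :
  (\int[mu]_x ((f \_ D) x)%:E = \int[mu]_(x in D) (f x)%:E)%E.
Proof.
rewrite [RHS]integral_mkcond; apply: eq_integral => x _.
by rewrite !patchE; case: ifP.
Qed.

(** Finiteness is the point, so an upper bound suffices: the primitive t^nu / nu is regular away
    from 0, and monotone convergence over [1 / (i + 2), 1] exhausts the interval. *)
Lemma integral_powR_le (nu : R) : 0 < nu ->
  (\int[mu]_(t in `]0%R, 1%R]) (t `^ (nu - 1))%:E <= (nu^-1)%:E)%E.
Proof.
move=> nu0.
pose F (i : nat) := `[(i.+2%:R^-1 : R), 1]%classic.
have i0 (i : nat) : 0 < i.+2%:R^-1 :> R by rewrite invr_gt0.
have i1 (i : nat) : i.+2%:R^-1 < 1 :> R by rewrite invf_lt1// ltr1n.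
have FU : `]0%R, 1%R]%classic = \bigcup_i F i.
  apply/seteqP; split => x /=.
    rewrite in_itv/= => /andP[x0 x1].
    exists (Num.truncn x^-1) => //; rewrite /F /= in_itv/= x1 andbT.
    rewrite invf_ple ?posrE// (le_trans (ltW (truncnS_gt _)))//.
    by rewrite ler_nat.
  by move=> [i _]; rewrite /F /= !in_itv/= => /andP[ix ->]; rewrite (lt_le_trans _ ix).
have IF i : (\int[mu]_(t in F i) (t `^ (nu - 1))%:E <= (nu^-1)%:E)%E.
  rewrite (continuous_FTC2 (i1 i) (F := fun t => t `^ nu / nu))//.
  - rewrite powR1 mul1r -EFinB lee_fin gerBl divr_ge0 ?powR_ge0//.
    exact: ltW.
  - apply: continuous_in_subspaceT => x; rewrite inE/= in_itv/= => /andP[ix _].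
    have x0 := lt_le_trans (i0 i) ix.
    apply: differentiable_continuous; apply/derivable1_diffP.
    by have ? := is_derive1_powR (nu - 1) x0; exact: ex_derive.
  - have dF x : 0 < x -> derivable (fun t => t `^ nu / nu) x 1.
      by move=> x0; have ? := is_derive1_powR nu x0; exact: ex_derive.
    have cF x : 0 < x -> {for x, continuous (fun t => t `^ nu / nu)}.
      move=> x0; apply: differentiable_continuous; apply/derivable1_diffP; exact: dF.
    split.
    + by move=> x; rewrite in_itv/= => /andP[ix _]; apply: dF; exact: lt_trans ix.
    + by apply: cvg_at_right_filter; exact: cF.
    + by apply: cvg_at_left_filter; exact: cF.
  - move=> x; rewrite in_itv/= => /andP[ix _]; have x0 := lt_trans (i0 i) ix.
    have D := is_derive1_powR nu x0.
    rewrite derive1E; apply: derive_val; apply: is_derive_eq.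
    by rewrite /GRing.scale /=; field; exact: lt0r_neq0.
rewrite FU.
have /cvg_lim <- // : (\int[mu]_(t in F i) (t `^ (nu - 1))%:E @[i --> \oo] -->
  \int[mu]_(t in \bigcup_i F i) (t `^ (nu - 1))%:E)%E.
  apply: ge0_nondecreasing_set_cvg_integral.
  - apply/nondecreasing_seqP => i; rewrite subsetEset => x.
    rewrite /F /= !in_itv/= => /andP[ix ->]; rewrite andbT (le_trans _ ix)//.
    by rewrite lef_pV2 ?posrE// ler_nat.
  - by move=> i; exact: measurable_itv.
  - by move=> i; apply/measurable_EFinP; apply: measurable_funTS.
  - by move=> i x _; rewrite lee_fin powR_ge0.
apply: lime_le; last exact: nearW.
apply: ereal_nondecreasing_is_cvgn.
apply: ge0_nondecreasing_set_nondecreasing_integral.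
- apply/nondecreasing_seqP => i; rewrite subsetEset => x.
  rewrite /F /= !in_itv/= => /andP[ix ->]; rewrite andbT (le_trans _ ix)//.
  by rewrite lef_pV2 ?posrE// ler_nat.
- by move=> i; exact: measurable_itv.
- by move=> i; apply/measurable_EFinP; apply: measurable_funTS.
- by move=> i x _; rewrite lee_fin powR_ge0.
Qed.

Lemma powR_le_expR (p s : R) : 0 < s -> exists2 C, 0 <= C &
  forall t, 0 < t -> 1 <= t -> t `^ p <= C * expR (s * t).
Proof.
(* Chosen so that |p| e <= s; the bound then follows from ln (e t) <= e t - 1. *)
move=> s0; pose e := s / (`|p| + 1).
have p1 : 0 < `|p| + 1 by rewrite ltr_wpDl.
have e0 : 0 < e by rewrite divr_gt0.
exists (expR (`|p| * (- ln e))); first exact: expR_ge0.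
move=> t t0 t1; rewrite /powR gt_eqF// -expRD ler_expR.
have l0 : 0 <= ln t by exact: ln_ge0.
apply: (@le_trans _ _ (`|p| * ln t)); first by rewrite ler_wpM2r// ler_norm.
have : ln (e * t) <= e * t - 1.
  have := @le_ln1Dx R (e * t - 1); rewrite (_ : 1 + (e * t - 1) = e * t); last by ring.
  by apply; rewrite ltrBrDr addNr mulr_gt0.
rewrite lnM ?posrE// => h.
have h2 : `|p| * ln t <= `|p| * (e * t - ln e) by rewrite ler_wpM2l//; lra.
rewrite (le_trans h2)// mulrBr addrC mulrN lerD2l mulrA ler_pM2r//.
by rewrite /e mulrA ler_pdivrMr// mulrC ler_pM2l// lerDl.
Qed.

(** Restriction to the positive half-line, not the positive part max (f, 0). *)
Definition pos_part (f : R -> R) := f \_ `]0, +oo[.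

Lemma in_pos (t : R) : (t \in `]0, +oo[%classic) = (0 < t).
Proof. by apply/idP/idP; rewrite inE/= in_itv/= andbT. Qed.

Lemma pos_partE f t : pos_part f t = if 0 < t then f t else 0.
Proof. by rewrite /pos_part patchE in_pos. Qed.

Lemma measurable_pos_part f : measurable_fun setT f -> measurable_fun setT (pos_part f).
Proof. by move=> mf; apply/measurable_restrict => //; exact: measurable_funTS. Qed.

Lemma L1_powR_exp (nu s : R) : 0 < nu -> 0 < s ->
  L1 (pos_part (fun t => t `^ (nu - 1) * expR (- s * t))).
Proof.
move=> nu0 s0.
have m1 : measurable_fun setT (fun t : R => t `^ (nu - 1)) by exact: measurable_powR.
have m2 : measurable_fun setT (fun t : R => expR (- s * t)).
  apply: measurableT_comp => //; exact: mulrl_measurable.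
have s2 : 0 < s / 2 by lra.
have [C C0 hC] := powR_le_expR (nu - 1) s2.
have i1 : L1 ((fun t : R => t `^ (nu - 1)) \_ `]0, 1]).
  apply: ge0_L1P.
  - by apply/measurable_restrict => //; exact: measurable_funTS.
  - by move=> x; rewrite patchE; case: ifPn => // _; exact: powR_ge0.
  - rewrite integral_restrict_EFin (le_lt_trans (integral_powR_le nu0))//.
    exact: ltry.
apply: (@L1_dominated R _
   (fun t => (fun t : R => t `^ (nu - 1)) \_ `]0, 1] t + C * expabs (s / 2) t)).
- by apply: measurable_pos_part; exact: measurable_funM.
- have i2 : L1 (fun t => C * expabs (s / 2) t).
    by have := integrableZl measurableT C (L1_expabs s2); apply: eq_integrable.
  by have := integrableD measurableT i1 i2; apply: eq_integrable.
- move=> t; rewrite pos_partE; case: ifPn => [t0|_]; last first.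
    rewrite normr0 addr_ge0 ?mulr_ge0 ?expR_ge0// patchE; case: ifPn => // _.
    exact: powR_ge0.
  rewrite ger0_norm ?mulr_ge0 ?powR_ge0 ?expR_ge0//.
  have [t1|t1] := leP t 1.
    rewrite patchE mem_set/= ?in_itv/= ?t0// -[leLHS]addr0 lerD//.
      rewrite -[leRHS]mulr1 ler_wpM2l ?powR_ge0// -expR0 ler_expR mulNr oppr_le0.
      by rewrite mulr_ge0// ltW.
    by rewrite mulr_ge0 ?expR_ge0.
  rewrite -[leLHS]add0r lerD//.
    by rewrite patchE; case: ifPn => // _; exact: powR_ge0.
  rewrite (le_trans (ler_wpM2r (expR_ge0 _) (hC _ t0 (ltW t1))))//.
  rewrite -[leLHS]mulrA; apply: ler_wpM2l => //; rewrite -expRD /expabs ler_expR gtr0_norm//; lra.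
Qed.

Lemma Gamma_gt0E (nu : R) : 0 < nu ->
  Gamma nu = I (pos_part (fun t => t `^ (nu - 1) * expR (- t))).
Proof. by move=> nu0; rewrite /Gamma nu0 Rintegral_mkcond. Qed.

Lemma Gamma_gt0 (nu : R) : 0 < nu -> 0 < Gamma nu.
Proof.
move=> nu0; rewrite Gamma_gt0E//.
have i : L1 (pos_part (fun t => t `^ (nu - 1) * expR (- t))).
  have := L1_powR_exp nu0 ltr01; apply: eq_integrable => // t _ /=.
  by under eq_fun do rewrite mulN1r.
pose m := Num.min 1 (2 `^ (nu - 1)).
have m0 : 0 < m :> R by rewrite lt_min ltr01 powR_gt0.
have mle (t : R) : 1 <= t -> t <= 2 -> m <= t `^ (nu - 1).
  move=> t1 t2; have [n1|n1] := leP 0 (nu - 1).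
    rewrite ge_min; apply/orP; left.
    by rewrite -[leLHS](powRr0 t) ler_powR.
  rewrite ge_min; apply/orP; right.
  rewrite /powR !gt_eqF//; last exact: lt_le_trans t1.
  by rewrite ler_expR ler_nM2l// ler_ln// posrE// (lt_le_trans _ t1).
have hle t : 0 <= (cst (m * expR (- 2)) \_ `[1, 2]) t <=
    pos_part (fun t => t `^ (nu - 1) * expR (- t)) t.
  rewrite patchE pos_partE; case: ifPn => [|_].
    rewrite inE/= in_itv/= => /andP[t1 t2]; rewrite (lt_le_trans _ t1)//.
    rewrite mulr_ge0 ?expR_ge0 ?(ltW m0)//=.
    by apply: ler_pM; rewrite ?expR_ge0 ?(ltW m0) ?mle// ler_expR lerN2.
  by rewrite lexx/=; case: ifPn => // _; rewrite mulr_ge0 ?powR_ge0 ?expR_ge0.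
apply: (@lt_le_trans _ _ (I ((cst (m * expR (- 2))) \_ `[1, 2]))).
  rewrite -Rintegral_mkcond Rintegral_cst//= lebesgue_measure_itv/= lte_fin ltr1n.
  by rewrite -EFinB/= mulr_gt0// ?mulr_gt0 ?expR_gt0//; lra.
apply: le_Rintegral => //; last by move=> t _; have /andP[] := hle t.
apply: (L1_dominated _ i).
  by apply/measurable_restrict.
by move=> t; have /andP[h1 h2] := hle t; rewrite ger0_norm.
Qed.

Lemma Gamma1 : Gamma (1 : R) = 1.
Proof.
rewrite Gamma_gt0E// /Rintegral.
rewrite integral_restrict_EFin.
have -> : (\int[mu]_(x in `]0%R, +oo[) (x `^ (1 - 1) * expR (- x))%:E =
  \int[mu]_(x in `[0%R, +oo[) (expR (- x))%:E)%E.
  rewrite -integral_itv_obnd_cbnd.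
    by apply: eq_integral => x _; rewrite subrr powRr0 mul1r.
  apply/measurable_EFinP; apply: measurable_funTS; apply: measurableT_comp => //.
have := @integral_exponential_pdf R 1 ltr01.
rewrite /exponential_pdf integral_restrict_EFin => e.
rewrite -[RHS]/(fine (1%:E)) -[1%:E]e; congr fine; apply: eq_integral => x _.
by rewrite mul1r mulN1r.
Qed.

(** The kernel of J^nu extended by 0, so that fractional integrals become convolutions on the whole
    line. *)
Definition kap (nu t : R) : R := pos_part (fun t => t `^ (nu - 1) / Gamma nu) t.

Lemma kap_ge0 nu t : 0 < nu -> 0 <= kap nu t.
Proof.
move=> nu0; rewrite /kap pos_partE; case: ifPn => // _.
by rewrite divr_ge0 ?powR_ge0// ltW// Gamma_gt0.
Qed.

Lemma measurable_kap nu : measurable_fun setT (kap nu).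
Proof.
apply: measurable_pos_part; apply: measurable_funM => //; exact: measurable_powR.
Qed.

Lemma kap_eq0 nu t : t <= 0 -> kap nu t = 0.
Proof. by move=> t0; rewrite /kap pos_partE ltNge t0. Qed.

Lemma kap_posE nu t : 0 < t -> kap nu t = t `^ (nu - 1) / Gamma nu.
Proof. by move=> t0; rewrite /kap pos_partE t0. Qed.

Lemma L1_kap nu s : 0 < nu -> 0 < s -> L1 (fun t => expR (- s * t) * kap nu t).
Proof.
move=> nu0 s0; have := integrableZl measurableT (Gamma nu)^-1 (L1_powR_exp nu0 s0).
apply: eq_integrable => // t _ /=; rewrite -EFinM; congr EFin.
by rewrite /kap !pos_partE; case: ifPn => _; rewrite ?mulr0//; ring.
Qed.

Lemma laplace_kap nu s : 0 < nu -> 0 < s ->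
  I (fun t => expR (- s * t) * kap nu t) = s `^ (- nu).
Proof.
move=> nu0 s0; rewrite (Rintegral_affine 0 (a := s^-1)); last 2 first.
  by rewrite invr_gt0.
  exact: L1_kap.
have G0 := Gamma_gt0 nu0.
have -> : (fun x => expR (- s * (s^-1 * x + 0)) * kap nu (s^-1 * x + 0)) =
   fun x => s `^ (1 - nu) / Gamma nu * pos_part (fun t => t `^ (nu - 1) * expR (- t)) x.
  apply/funext => x; rewrite addr0 /kap !pos_partE pmulr_rgt0 ?invr_gt0//.
  case: ifPn => [x0|_]; last by rewrite !mulr0.
  have -> : - s * (s^-1 * x) = - x by field; exact: lt0r_neq0.
  rewrite powRM ?invr_ge0 ?(ltW s0) ?(ltW x0)// -[in s^-1](powRr1 (ltW s0)) -powRN -powRrM.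
  rewrite mulN1r opprB; ring.
rewrite RintegralZl//; last first.
  have := L1_powR_exp nu0 ltr01; apply: eq_integrable => // t _ /=.
  by under eq_fun do rewrite mulN1r.
rewrite -Gamma_gt0E// divfK ?lt0r_neq0//.
by rewrite -[s^-1]powR_inv1 ?ltW// -powRD ?(lt0r_neq0 s0) ?implybT//; congr (_ `^ _); ring.
Qed.

Definition convolution f g (t : R) : R := I (fun z => f z * g (t - z)).

Lemma measurable_conv_pair f g : measurable_fun setT f -> measurable_fun setT g ->
  measurable_fun setT (fun p : R * R => f p.1 * g (p.2 - p.1)).
Proof.
move=> mf mg; apply: measurable_funM.
  exact: (measurableT_comp mf measurable_fst).
by apply: (measurableT_comp mg); exact: measurable_funB.
Qed.

Lemma measurable_conv_integrand f g t : measurable_fun setT f ->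
  measurable_fun setT g -> measurable_fun setT (fun z => f z * g (t - z)).
Proof.
move=> mf mg; apply: measurable_funM => //.
by apply: (measurableT_comp mg); exact: measurable_funB.
Qed.

Lemma conv_L1 f g : L1 f -> L1 g -> L1 (convolution f g) /\ I (convolution f g) = I f * I g.
Proof.
move=> fi gi; have mf := L1_measurable fi; have mg := L1_measurable gi.
have mfg := measurable_conv_pair mf mg.
have gni : L1 (fun x => `|g x|) by exact: integrable_norm gi.
have key (z : R) : (\int[mu]_t `|f z * g (t - z)|%:E <= (`|f z| * I (fun x => `|g x|))%:E)%E.
  rewrite EFinM -RintegralE// -(ge0_integral_translation (- z) (f := fun x => `|g x|%:E))//;
    last exact: measurable_int gni.
  rewrite -ge0_integralZl_EFin//.
    by under [leLHS]eq_integral do rewrite normrM EFinM.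
  apply/measurable_EFinP; apply: measurableT_comp => //.
  by apply: (measurableT_comp mg); apply: measurable_funD.
have hi : L1 (fun z => `|f z| * I (fun x => `|g x|)).
  have := integrableZr measurableT (I (fun x => `|g x|)) (integrable_norm fi).
  by apply: eq_integrable => // x _.
have F2 := integrable_Fubini2 mfg key hi.
split; first exact: F2.
rewrite -[LHS](Rintegral_Fubini mfg key hi).
rewrite -RintegralZr//; apply: eq_Rintegral => z _.
by rewrite RintegralZl ?Rintegral_translation//; exact: integrable_translation.
Qed.

(** Integrability is not assumed: positive and negative parts both scale, and if either integral is
    infinite [fine] returns 0 on both sides. *)
Lemma Rintegral_scale k f : 0 < k -> measurable_fun setT f ->
  I (fun x => k * f x) = k * I f.
Proof.
move=> k0 mf; rewrite /Rintegral integralE [in RHS]integralE.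
have mEf : measurable_fun setT (EFin \o f) by exact/measurable_EFinP.
have -> : ((fun x => (k * f x)%:E)^\+ = fun x => k%:E * (EFin \o f)^\+ x)%E.
  by rewrite -(ge0_funeposM _ (ltW k0)).
have -> : ((fun x => (k * f x)%:E)^\- = fun x => k%:E * (EFin \o f)^\- x)%E.
  by rewrite -(ge0_funenegM _ (ltW k0)).
rewrite !ge0_integralZl_EFin//; [|exact: measurable_funeneg|exact: ltW|
  exact: measurable_funepos|exact: ltW].
have : (0 <= \int[mu]_x (EFin \o f)^\+ x)%E by exact: integral_ge0.
have : (0 <= \int[mu]_x (EFin \o f)^\- x)%E by exact: integral_ge0.
case: (integral _ _ _) => [y| |]//; case: (integral _ _ _) => [x| |]// _ _;
  rewrite ?gt0_muley ?lte_fin//= ?mulr0//.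
by rewrite -mulrBr.
Qed.

Lemma conv_expR s f g t : measurable_fun setT f -> measurable_fun setT g ->
  expR (- s * t) * convolution f g t =
  convolution (fun z => expR (- s * z) * f z) (fun z => expR (- s * z) * g z) t.
Proof.
move=> mf mg.
have e z : expR (- s * z) * f z * (expR (- s * (t - z)) * g (t - z)) =
  expR (- s * t) * (f z * g (t - z)).
  rewrite (_ : - s * t = - s * z + - s * (t - z)) ?expRD; ring.
rewrite /convolution.
have -> : (fun z => expR (- s * z) * f z * (expR (- s * (t - z)) * g (t - z))) =
  (fun z => expR (- s * t) * (f z * g (t - z))) by apply/funext => z; exact: e.
rewrite Rintegral_scale ?expR_gt0//.
exact: measurable_conv_integrand.
Qed.

Lemma kap_scale nu k z : 0 < k -> kap nu (k * z) = k `^ (nu - 1) * kap nu z.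
Proof.
move=> k0; rewrite /kap !pos_partE pmulr_rgt0//; case: ifPn => [z0|_]; last by rewrite mulr0.
by rewrite powRM ?ltW// mulrA.
Qed.

Section convolution_of_powers.
Variables nu1 nu2 : R.
Hypothesis nu1_gt0 : 0 < nu1.
Hypothesis nu2_gt0 : 0 < nu2.

(** Extended real, since finiteness is known only once the constant has been computed. *)
Let c t := (\int[mu]_z (kap nu1 z * kap nu2 (t - z))%:E)%E.

Let mk (t : R) : measurable_fun setT (fun z => kap nu1 z * kap nu2 (t - z)).
Proof. by apply: measurable_conv_integrand; exact: measurable_kap. Qed.

Let k0 (t z : R) : 0 <= kap nu1 z * kap nu2 (t - z).
Proof. by rewrite mulr_ge0 ?kap_ge0. Qed.

Let c_scale t : 0 < t -> c t = ((t `^ (nu1 + nu2 - 1))%:E * c 1)%E.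
Proof.
move=> t0; rewrite /c (ge0_integral_affine 0 t0); last 2 first.
  by apply/measurable_EFinP; exact: mk.
  by move=> x; rewrite lee_fin.
have -> : (fun x => (kap nu1 (t * x + 0) * kap nu2 (t - (t * x + 0)))%:E) =
  (fun x => ((t `^ (nu1 - 1) * t `^ (nu2 - 1))%:E * (kap nu1 x * kap nu2 (1 - x))%:E)%E).
  apply/funext => x; rewrite addr0 -[X in X - _]mulr1 -mulrBr !kap_scale//.
  by rewrite -EFinM; congr EFin; ring.
rewrite ge0_integralZl_EFin//.
- rewrite muleA -EFinM -powRD ?(lt0r_neq0 t0) ?implybT//.
  rewrite -[X in X * _](powRr1 (ltW t0)) -powRD ?(lt0r_neq0 t0) ?implybT//.
  by congr ((_ `^ _)%:E * _)%E; ring.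
- by move=> x _; rewrite lee_fin.
- by apply/measurable_EFinP; exact: mk.
- by rewrite mulr_ge0 ?powR_ge0.
Qed.

Let conv_scale t : 0 < t ->
  convolution (kap nu1) (kap nu2) t = t `^ (nu1 + nu2 - 1) * convolution (kap nu1) (kap nu2) 1.
Proof.
move=> t0; rewrite /convolution /Rintegral -!/(c _) c_scale//.
have : (0 <= c 1)%E by apply: integral_ge0 => x _; rewrite lee_fin.
case: (c 1) => [r||]//= _.
by rewrite gt0_muley ?lte_fin ?powR_gt0//= mulr0.
Qed.

Let c_le0 t : t <= 0 -> c t = 0%E.
Proof.
move=> t0; rewrite /c integral0_eq// => x _.
have [x0|x0] := leP x 0; first by rewrite kap_eq0// mul0r.
by rewrite [X in _ * X]kap_eq0 ?mulr0// subr_le0 (le_trans t0)// ltW.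
Qed.

(** The Beta integral without evaluating it: by homogeneity the convolution is a multiple of t^(nu1
    + nu2 - 1), and integrating against e^(-t) determines the factor. *)
Let conv1 : convolution (kap nu1) (kap nu2) 1 = (Gamma (nu1 + nu2))^-1.
Proof.
have nu0 : 0 < nu1 + nu2 by exact: addr_gt0.
have [_] := conv_L1 (L1_kap nu1_gt0 ltr01) (L1_kap nu2_gt0 ltr01).
rewrite !laplace_kap// !powR1 mulr1.
have -> : convolution (fun t => expR (- 1 * t) * kap nu1 t) (fun t => expR (- 1 * t) * kap nu2 t) =
  (fun t => convolution (kap nu1) (kap nu2) 1 *
    pos_part (fun t => t `^ (nu1 + nu2 - 1) * expR (- 1 * t)) t).
  apply/funext => t; rewrite -conv_expR//; [|exact: measurable_kap|exact: measurable_kap].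
  rewrite pos_partE; case: ifPn => [t0|]; first by rewrite conv_scale//; ring.
  rewrite -leNgt mulr0 => t0.
  have -> : convolution (kap nu1) (kap nu2) t = 0 by rewrite /convolution /Rintegral -/(c t) c_le0.
  by rewrite mulr0.
rewrite RintegralZl//; last exact: L1_powR_exp.
have -> : I (pos_part (fun t => t `^ (nu1 + nu2 - 1) * expR (-1 * t))) = Gamma (nu1 + nu2).
  rewrite (Gamma_gt0E nu0); apply: eq_I => t.
  by rewrite !pos_partE mulN1r.
move=> h; apply: (mulIf (lt0r_neq0 (Gamma_gt0 nu0))).
by rewrite h mulVf// lt0r_neq0// Gamma_gt0.
Qed.

Lemma integral_kap_kap t :
  (\int[mu]_z (kap nu1 z * kap nu2 (t - z))%:E = (kap (nu1 + nu2) t)%:E)%E.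
Proof.
have nu0 : 0 < nu1 + nu2 by exact: addr_gt0.
have [t0|t0] := leP t 0; first by rewrite kap_eq0// -/(c t) c_le0.
rewrite -/(c t) c_scale// kap_posE// EFinM; congr (_ * _)%E.
move: conv1; rewrite /convolution /Rintegral -/(c 1).
have : (0 <= c 1)%E by apply: integral_ge0 => x _; rewrite lee_fin.
(* Were c 1 infinite, its real value would be 0, whereas [conv1] makes it a nonzero inverse. *)
case: (c 1) => [r _ /= ->//||]//= _ /esym /eqP.
by rewrite invr_eq0 gt_eqF ?Gamma_gt0.
Qed.

Lemma L1_kap_kap t : L1 (fun z => kap nu1 z * kap nu2 (t - z)).
Proof.
apply: ge0_L1P; [exact: mk|exact: k0|].
by have -> := integral_kap_kap t; rewrite ltry.
Qed.

Lemma conv_kap_kap t : convolution (kap nu1) (kap nu2) t = kap (nu1 + nu2) t.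
Proof. by rewrite /convolution /Rintegral integral_kap_kap. Qed.

End convolution_of_powers.

(** [kap nu] is not integrable on the line. Weighting both factors by e^(-t) makes Fubini available;
    the weight is removed afterwards. *)
Lemma measurable_conv_kap f nu : 0 < nu -> L1 f -> (forall z, z <= 0 -> f z = 0) ->
  measurable_fun setT (convolution f (kap nu)).
Proof.
move=> nu0 fi f0.
have ei : L1 (fun z => expR (- 1 * z) * f z).
  apply: (L1_dominated _ (integrable_norm fi)).
    apply: measurable_funM; last exact: L1_measurable.
    by apply: measurableT_comp => //; exact: mulrl_measurable.
  move=> z /=; have [z0|z0] := leP z 0; first by rewrite f0// mulr0 normr0.
  rewrite normrM ler_piMl// ger0_norm ?expR_ge0// -[leRHS]expR0 ler_expR.
  by rewrite mulN1r oppr_le0 ltW.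
have [ci _] := conv_L1 ei (L1_kap nu0 ltr01).
have -> : convolution f (kap nu) = (fun t => expR t * convolution (fun z => expR (- 1 * z) * f z)
    (fun z => expR (- 1 * z) * kap nu z) t).
  apply/funext => t; rewrite -conv_expR; [|exact: L1_measurable|exact: measurable_kap].
  by rewrite mulrA -expRD mulN1r subrr expR0 mul1r.
by apply: measurable_funM => //; exact: L1_measurable.
Qed.

Lemma kap_le nu t z : 1 <= nu -> 0 < z -> kap nu (t - z) <= `|t| `^ (nu - 1) / Gamma nu.
Proof.
move=> nu1 z0; have nu0 : 0 < nu by exact: lt_le_trans nu1.
have [tz|tz] := leP (t - z) 0.
  by rewrite kap_eq0// divr_ge0 ?powR_ge0// ltW// Gamma_gt0.
rewrite kap_posE// ler_pM2r ?invr_gt0 ?Gamma_gt0//.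
apply: ge0_ler_powR; rewrite ?nnegrE ?subr_ge0//; first by rewrite -subr_ge0 ltW.
by rewrite (le_trans _ (ler_norm _))// gerBl ltW.
Qed.

(** The condition 1 <= nu1 + nu2 bounds [kap (nu1 + nu2) (t - z)] over z > 0, so that Fubini holds
    at every t. *)
Lemma conv_kap_assoc f nu1 nu2 t : 0 < nu1 -> 0 < nu2 -> 1 <= nu1 + nu2 ->
  L1 f -> (forall z, z <= 0 -> f z = 0) ->
  convolution (convolution f (kap nu1)) (kap nu2) t = convolution f (kap (nu1 + nu2)) t.
Proof.
move=> n1 n2 n12 fi f0.
pose F (z w : R) := f z * (kap nu1 (w - z) * kap nu2 (t - w)).
pose M := `|t| `^ (nu1 + nu2 - 1) / Gamma (nu1 + nu2).
have mF : measurable_fun setT (fun p : R * R => F p.1 p.2).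
  apply: measurable_funM.
    exact: (measurableT_comp (L1_measurable fi) measurable_fst).
  apply: measurable_funM; apply: (measurableT_comp (measurable_kap _));
  by apply: measurable_funB.
have shift (z : R) : (fun w => kap nu1 (w - z) * kap nu2 (t - w)) =
    (fun w => (fun u => kap nu1 u * kap nu2 ((t - z) - u)) (w + - z)).
  by apply/funext => w /=; congr (_ * kap _ _); ring.
have L1s (z : R) : L1 (fun w => kap nu1 (w - z) * kap nu2 (t - w)).
  by rewrite shift; exact: (integrable_translation (- z) (L1_kap_kap n1 n2 (t - z))).
have Is (z : R) : I (fun w => kap nu1 (w - z) * kap nu2 (t - w)) = kap (nu1 + nu2) (t - z).
  rewrite shift (Rintegral_translation (- z) (L1_kap_kap n1 n2 (t - z))).
  exact: conv_kap_kap.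
have key (z : R) : (\int[mu]_w `|F z w|%:E <= (`|f z| * M)%:E)%E.
  have -> : (\int[mu]_w `|F z w|%:E = `|f z|%:E * (kap (nu1 + nu2) (t - z))%:E)%E.
    rewrite -Is -RintegralE// -ge0_integralZl_EFin//.
    - apply: eq_integral => w _; rewrite -EFinM; congr EFin.
      by rewrite /F normrM (ger0_norm (mulr_ge0 _ _)) ?kap_ge0.
    - by move=> w _; rewrite lee_fin mulr_ge0 ?kap_ge0.
    - exact: measurable_int (L1s z).
  rewrite -EFinM lee_fin.
  have [z0|z0] := leP z 0; first by rewrite f0// normr0 !mul0r.
  by rewrite ler_wpM2l// kap_le.
have hi : L1 (fun z => `|f z| * M).
  have := integrableZr measurableT M (integrable_norm fi).
  by apply: eq_integrable => // x _.
have h1 : convolution f (kap (nu1 + nu2)) t = I (fun z => I (F z)).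
  by apply: eq_I => z; rewrite /F RintegralZl// Is.
rewrite h1 (Rintegral_Fubini mF key hi) {1}/convolution; apply: eq_I => w.
have [/eqP kw|kw] := boolP (kap nu2 (t - w) == 0).
  rewrite kw mulr0 /F; under eq_fun do rewrite kw !mulr0.
  by rewrite /Rintegral integral0.
have -> : F ^~ w = (fun z => kap nu2 (t - w) * (f z * kap nu1 (w - z))).
  by apply/funext => z; rewrite /F; ring.
rewrite Rintegral_scale//; first by rewrite mulrC.
- by rewrite lt_neqAle eq_sym kw kap_ge0.
- by apply: measurable_conv_integrand; [exact: L1_measurable|exact: measurable_kap].
Qed.

(** T is any horizon beyond t, since the kernel vanishes for z >= t; one truncated function thus
    serves all t <= T. *)
Lemma RL_integralE (nu : R) f (t T : R) : 0 < nu -> 0 < t -> t <= T ->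
  measurable_fun `]0, T[%classic f ->
  RL_integral nu f t = convolution (f \_ `]0, T[) (kap nu) t.
Proof.
move=> nu0 t0 tT mf; rewrite /RL_integral gt_eqF// Rintegral_mkcond -Rintegral_scale.
- apply: eq_I => z; rewrite !patchE /=.
  rewrite !mem_setE !in_itv/=; have [z0|z0] /= := ltP 0 z; last by rewrite mulr0 mul0r.
  have [zt|zt] := ltP z t.
    by rewrite (lt_le_trans zt tT) kap_posE ?subr_gt0//; ring.
  by rewrite mulr0 kap_eq0 ?mulr0// subr_le0.
- by rewrite invr_gt0 Gamma_gt0.
- apply/measurable_restrict => //; apply: measurable_funM.
    apply: measurable_funS mf => // z [_]; rewrite /= !in_itv/= => /andP[-> zt].
    exact: lt_le_trans tT.
  apply: measurable_funTS; apply: (measurableT_comp (measurable_powR _)).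
  exact: measurable_funB.
Qed.

Lemma RL_integral_eq nu f g t : nu != 0 -> (forall z, 0 < z < t -> f z = g z) ->
  RL_integral nu f t = RL_integral nu g t.
Proof.
move=> nu0 fg; rewrite /RL_integral (negbTE nu0); congr (_ * _).
by apply: eq_Rintegral => z; rewrite inE/= in_itv/= => zt; rewrite fg.
Qed.

Lemma L1_restrict_itv f (T : R) : mu.-integrable `]0, T[ (EFin \o f) -> L1 (f \_ `]0, T[).
Proof.
move=> fi; rewrite -restrict_EFin.
have := (integrable_mkcond (mu := mu) (EFin \o f) (measurable_itv `]0, T[)).1.
by apply.
Qed.

Lemma RL_integral_RL f (nu1 nu2 t : R) : 0 < nu1 -> 0 < nu2 -> 1 <= nu1 + nu2 -> 0 < t ->
  mu.-integrable `]0, t[ (EFin \o f) ->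
  RL_integral nu2 (RL_integral nu1 f) t = RL_integral (nu1 + nu2) f t.
Proof.
move=> n1 n2 n12 t0 fi.
have fti := L1_restrict_itv fi.
have mf : measurable_fun `]0, t[%classic f by have /integrableP[/measurable_EFinP] := fi.
have f0 z : z <= 0 -> (f \_ `]0, t[) z = 0.
  by move=> z0; rewrite patchE memNset//= in_itv/= ltNge z0.
have mc := measurable_conv_kap n1 fti f0.
have RLc z : 0 < z <= t -> RL_integral nu1 f z = convolution (f \_ `]0, t[) (kap nu1) z.
  by move=> /andP[z0 zt]; apply: RL_integralE.
rewrite (RL_integral_eq (g := convolution (f \_ `]0, t[) (kap nu1))); last 2 first.
  exact: lt0r_neq0.
  by move=> z /andP[z0 zt]; apply: RLc; rewrite z0 ltW.
rewrite (RL_integralE n2 t0 (lexx t)); last exact: measurable_funTS.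
rewrite (RL_integralE (addr_gt0 n1 n2) t0 (lexx t) mf).
rewrite -(conv_kap_assoc t n1 n2 n12 fti f0); apply: eq_I => z.
rewrite patchE; case: ifPn => //; rewrite !mem_setE in_itv/= negb_and -!leNgt.
move=> /orP[z0|tz]; last by rewrite kap_eq0 ?mulr0// subr_le0.
suff -> : convolution (f \_ `]0, t[) (kap nu1) z = 0 by [].
rewrite /convolution (eq_I (g := cst 0)); first by rewrite /Rintegral integral0.
move=> w; have [w0|w0] := leP w 0; first by rewrite f0// mul0r.
by rewrite kap_eq0 ?mulr0// subr_le0 (le_trans z0)// ltW.
Qed.

End power_kernel.

(** * Laplace transforms and Volterra equations *)

Section linearity.
Context {R : realType}.
Implicit Types f g : R -> R.

Lemma le_I f g : L1 f -> L1 g -> (forall x, f x <= g x) -> I f <= I g.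
Proof. by move=> fi gi fg; apply: le_Rintegral => // x _; exact: fg. Qed.

Lemma L1D f g : L1 f -> L1 g -> L1 (fun x => f x + g x).
Proof. by move=> fi gi; have := integrableD measurableT fi gi; exact: eq_integrable. Qed.

Lemma L1Z k f : L1 f -> L1 (fun x => k * f x).
Proof. by move=> fi; have := integrableZl measurableT k fi; exact: eq_integrable. Qed.

Lemma ID f g : L1 f -> L1 g -> I (fun x => f x + g x) = I f + I g.
Proof. by move=> fi gi; rewrite RintegralD. Qed.

Lemma IZ k f : L1 f -> I (fun x => k * f x) = k * I f.
Proof. by move=> fi; rewrite RintegralZl. Qed.

End linearity.

(** * Injectivity of the Laplace transform *)

Section Laplace_uniqueness.
Context {R : realType}.
Notation mu := (@lebesgue_measure R).
Implicit Types f g h : R -> R.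

Lemma norm_series_exp_coeff (x : R) N :
  `|series (exp_coeff x) N| <= expR `|x|.
Proof.
rewrite /series /=; apply: (le_trans (ler_norm_sum _ _ _)).
apply: (@le_trans _ _ (series (exp_coeff `|x|) N)).
  rewrite /series /=; apply: ler_sum => i _.
  by rewrite /exp_coeff /= normrM normrX (ger0_norm (x := _^-1)).
apply: nondecreasing_cvgn_le; last exact: is_cvg_series_exp_coeff.
apply/nondecreasing_seqP => n; rewrite /series /= big_nat_recr//= lerDl.
by rewrite /exp_coeff /= divr_ge0// exprn_ge0.
Qed.

Lemma L1_restrict f (D : set R) : measurable D -> L1 f -> L1 (f \_ D).
Proof.
move=> mD fi; have mf := L1_measurable fi.
apply: (L1_dominated _ (integrable_norm fi)).
  by apply/measurable_restrict => //; exact: measurable_funTS.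
by move=> t /=; rewrite patchE; case: ifPn => _ //; rewrite -[X in `|X|]/(0 : R) normr0.
Qed.

Lemma expR_cvgNy : expR (x : R) @[x --> -oo] --> 0.
Proof.
by apply/cvgNy_compNP; exact: cvgr_expR.
Qed.

Lemma expR_cvgy : expR (x : R) @[x --> +oo] --> +oo.
Proof.
apply/cvgryPge => A; near=> x; apply: (@le_trans _ _ (1 + x)); last exact: expR_ge1Dx.
by rewrite ler_wpDl//; near: x; exact: nbhs_pinfty_ge.
Unshelve. all: by end_near. Qed.

Section vanishing_transform.
Variable g : R -> R.
Hypothesis gi : L1 g.
Hypothesis g_neg : forall t, t <= 0 -> g t = 0.
Hypothesis g_moment : forall m : nat, I (fun t => expR (- m%:R * t) * g t) = 0.

Let L1_moment (m : nat) : L1 (fun t => expR (- m%:R * t) * g t).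
Proof.
have mg := L1_measurable gi.
apply: (L1_dominated (g := fun t => `|g t|)).
- apply: measurable_funM => //; apply: measurableT_comp => //; exact: mulrl_measurable.
- exact: integrable_norm gi.
- move=> t; have [t0|t0] := leP t 0; first by rewrite g_neg// mulr0 normr0.
  rewrite normrM ler_piMl// ger0_norm ?expR_ge0// -[leRHS]expR0 ler_expR.
  by rewrite mulNr oppr_le0 mulr_ge0// ltW.
Qed.

(* As [n] grows, [double_exp n x] approximates the indicator of [x < t], while
   for fixed [n] it is a power series in [expR (- n t)], whose terms are
   orthogonal to [g]. *)
Let double_exp (n : nat) (x t : R) := expR (- expR (n%:R * (x - t))).

Let moment_sum (n N : nat) (x : R) :
  let f t := series (exp_coeff (- expR (n%:R * (x - t)))) N * g t in
  L1 f /\ I f = 0.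
Proof.
move=> f; rewrite {}/f; elim: N => [|N [ih1 ih2]].
  have -> : (fun t => series (exp_coeff (- expR (n%:R * (x - t)))) 0 * g t) = cst 0.
    by apply/funext => t; rewrite /series /= big_nil mul0r.
  by split; [exact: integrable0|rewrite /Rintegral integral0].
pose c := (- expR (n%:R * x)) ^+ N / N`!%:R.
have e t : series (exp_coeff (- expR (n%:R * (x - t)))) N.+1 * g t =
  series (exp_coeff (- expR (n%:R * (x - t)))) N * g t +
  c * (expR (- (n * N)%:R * t) * g t).
  rewrite /series /= big_nat_recr//= mulrDl; congr (_ + _).
  rewrite /exp_coeff /c /= (_ : - expR (n%:R * (x - t)) = - expR (n%:R * x) * expR (- (n%:R * t))).
    by rewrite exprMn (_ : - _ * t = N%:R * (- (n%:R * t))) ?expRM_natl ?natrM; ring.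
  by rewrite mulNr -expRD; congr (- expR _); ring.
have i1 := integrableZl measurableT c (L1_moment (n * N)).
have i2 : L1 (fun t => c * (expR (- (n * N)%:R * t) * g t)).
  by apply: eq_integrable i1.
under eq_fun do rewrite e; split.
  by have := integrableD measurableT ih1 i2; apply: eq_integrable.
by rewrite RintegralD//= ih2 RintegralZl//; rewrite g_moment mulr0 addr0.
Qed.

Let double_exp_moment n x : I (fun t => double_exp n x t * g t) = 0.
Proof.
have mg := L1_measurable gi.
have mS : measurable_fun setT (fun t : R => n%:R * (x - t)).
  by apply: measurable_funM => //; exact: measurable_funB.
pose f_ N t := series (exp_coeff (- expR (n%:R * (x - t)))) N * g t.
(* Where g is nonzero t > 0, so the partial sums are at most exp (e^(n (x - t))) <= exp (e^(n
   x)). *)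
have [|||||_ c1] := @Rintegral_dominated_cvg R f_ (fun t => double_exp n x t * g t)
    (fun t => expR (expR (n%:R * x)) * `|g t|) 0.
- by move=> N; exact: L1_measurable (moment_sum n N x).1.
- apply: measurable_funM => //; apply: measurableT_comp => //.
  by apply: measurable_funN; exact: measurableT_comp.
- have := integrableZl measurableT (expR (expR (n%:R * x))) (integrable_norm gi).
  by apply: eq_integrable.
- move=> N t; have [t0|t0] := leP t 0; first by rewrite /f_ g_neg// mulr0 normr0 mulr0.
  rewrite normrM ler_wpM2r//; apply: (le_trans (norm_series_exp_coeff _ _)).
  rewrite normrN ger0_norm ?expR_ge0// !ler_expR ler_wpM2l// gerBl; exact: ltW.
- by move=> t _; apply: cvgMl; exact: is_cvg_series_exp_coeff.
apply: cvg_unique c1 _ => //.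
rewrite (_ : (fun N => I (f_ N)) = cst 0); first exact: cvg_cst.
by apply/funext => N; exact: (moment_sum n N x).2.
Qed.

(** As n grows in [double_exp_moment], the integral of g beyond x is seen to be 0; the moment m = 0
    is the total integral and yields the other half. *)
Lemma integral_vanishing_transform x : 0 < x -> I (g \_ `]-oo, x]) = 0.
Proof.
move=> x0; have mg := L1_measurable gi.
have [|||||_ c1] := @Rintegral_dominated_cvg R (fun n t => double_exp n x t * g t)
    (g \_ `]x, +oo[) (fun t => `|g t|) x.
- move=> n; apply: measurable_funM => //; apply: measurableT_comp => //.
  apply: measurable_funN; apply: measurableT_comp => //.
  by apply: measurable_funM => //; exact: measurable_funB.
- by apply/measurable_restrict => //; exact: measurable_funTS.
- exact: integrable_norm gi.
- move=> n t; rewrite normrM ler_piMl// ger0_norm ?expR_ge0//.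
  by rewrite -[leRHS]expR0 ler_expR oppr_le0 expR_ge0.
- move=> t tx; have nD : (n%:R : R) @[n --> \oo] --> +oo by exact: cvgr_idn.
  have [lt|lt] := ltP x t.
    rewrite patchE mem_set/= ?in_itv/= ?lt// -[X in _ --> X]mul1r.
    apply: cvgMl.
    have -> : (1 : R) = expR (- 0) by rewrite oppr0 expR0.
    apply: (cvg_comp _ expR); last exact: continuous_expR.
    apply: cvgN; apply: (@cvg_comp _ _ _ _ expR _ -oo); last exact: expR_cvgNy.
    apply: (@cvg_comp _ _ _ (fun n : nat => n%:R : R) (fun r => r * (x - t)) _ +oo) => //.
    rewrite (_ : (fun r => _) = (fun r => - r * (t - x))).
      by apply: gt0_cvgMlNy; [rewrite subr_gt0|apply/cvgNrNy; exact: cvg_id].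
    by apply/funext => n /=; ring.
  have {tx}lt : t < x by rewrite lt_neqAle tx.
  rewrite patchE memNset/=; last by apply/negP; rewrite in_itv/= andbT -leNgt ltW.
  rewrite -[X in _ --> X]/(0 : R) -(mul0r (g t)); apply: cvgMl.
  apply: (@cvg_comp _ _ _ _ expR _ -oo); last exact: expR_cvgNy.
  apply/cvgNrNy; apply: (@cvg_comp _ _ _ _ expR _ +oo); last exact: expR_cvgy.
  apply: (@cvg_comp _ _ _ (fun n : nat => n%:R : R) (fun r => r * (x - t)) _ +oo) => //.
  by apply: gt0_cvgMly; [rewrite subr_gt0|exact: cvg_id].
have i2 : L1 (g \_ `]x, +oo[) by exact: L1_restrict.
have I0 : I (g \_ `]x, +oo[) = 0.
  apply: cvg_unique c1 _ => //.
  rewrite (_ : (fun n => _) = cst 0); first exact: cvg_cst.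
  by apply/funext => n; exact: double_exp_moment.
have := g_moment 0; rewrite (eq_I (g := fun t => (g \_ `]-oo, x]) t + (g \_ `]x, +oo[) t)).
  rewrite RintegralD//=; first by rewrite I0 addr0.
  exact: L1_restrict.
move=> t; rewrite oppr0 mul0r expR0 mul1r !patchE !mem_setE !in_itv/= andbT leNgt.
by case: ltP => _; rewrite /= ?addr0 ?add0r.
Qed.

Lemma vanishing_transform x : 0 < x -> {for x, continuous g} -> g x = 0.
Proof.
move=> x0 cx.
have [||dF <-] := @continuous_FTC1 R g -oo%O x (x + 1) _ _ (ltNyr _) cx.
- by rewrite ltrDl.
- by apply: integrableS gi.
rewrite derive1E.
rewrite (near_eq_derive (g := cst 0)) ?derive_cst//.
near=> y; rewrite /= Rintegral_mkcond integral_vanishing_transform//.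
by near: y; exact: lt_nbhsr.
Unshelve. all: by end_near. Qed.

End vanishing_transform.

(** Only the values s = s0 + m with m a natural number enter: e^(- s0 t) h is integrable and all its
    moments against e^(- m t) vanish. *)
Lemma Laplace_transform_inj h s0 :
  (forall t, 0 < t -> {for t, continuous h}) ->
  (forall s, s0 <= s -> L1 (fun t => expR (- s * t) * pos_part h t) /\
     I (fun t => expR (- s * t) * pos_part h t) = 0) ->
  forall t, 0 < t -> h t = 0.
Proof.
move=> ch hI t t0.
pose g t := expR (- s0 * t) * pos_part h t.
have g_neg z : z <= 0 -> g z = 0 by move=> z0; rewrite /g pos_partE ltNge z0 mulr0.
have gm (m : nat) : I (fun t => expR (- m%:R * t) * g t) = 0.
  have [|_ <-] := hI (m%:R + s0); first by rewrite lerDr.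
  by apply: eq_I => z; rewrite /g mulrA -expRD; congr (expR _ * _); ring.
have gt := @vanishing_transform g (hI _ (lexx _)).1 g_neg gm t t0.
suff cg : {for t, continuous g}.
  by move/eqP : (gt cg); rewrite /g pos_partE t0 mulf_eq0 expR_eq0 => /eqP.
apply: cvgM.
  apply: (cvg_comp _ expR); last exact: continuous_expR.
  by apply: cvgMr; exact: cvg_id.
rewrite /= pos_partE t0.
have c := ch t t0; apply: cvg_trans c; apply: near_eq_cvg.
by near=> z; rewrite pos_partE ifT//; near: z; exact: lt_nbhsr.
Unshelve. all: by end_near. Qed.

End Laplace_uniqueness.

(** * Volterra equations: a priori bound and transform *)

Section Volterra.
Context {R : realType}.
Notation mu := (@lebesgue_measure R).
Implicit Types f g h : R -> R.

Lemma pos_part_bigcup : `]0, +oo[%classic = \bigcup_(i : nat) `]0 : R, i.+1%:R[%classic.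
Proof.
apply/seteqP; split => x /=; rewrite in_itv/= ?andbT.
  move=> x0; exists (Num.trunc x) => //=; rewrite in_itv/= x0/=; exact: truncnS_gt.
by move=> [i _ /=]; rewrite in_itv/= => /andP[].
Qed.

Lemma L1_pos_part f C :
  (forall T, 0 < T -> L1 (f \_ `]0, T[) /\ I (fun t => `|(f \_ `]0, T[) t|) <= C) ->
  L1 (pos_part f).
Proof.
move=> fC.
have mf (i : nat) : measurable_fun (`]0%R, i.+1%:R[%classic : set R) f.
  by apply/(measurable_restrictT f (measurable_itv _)); apply: L1_measurable (fC _ _).1.
have mp : measurable_fun setT (pos_part f).
  apply/(measurable_restrictT f (measurable_itv _)).
  by rewrite pos_part_bigcup; apply/measurable_fun_bigcup.
apply/integrableP; split; first exact/measurable_EFinP.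
have -> : (\int[mu]_x `|(EFin \o pos_part f) x| = \int[mu]_(x in `]0%R, +oo[) `|f x|%:E)%E.
  rewrite [RHS]integral_mkcond; apply: eq_integral => x _.
  by rewrite /= /pos_part !patchE; case: ifPn => // _; rewrite -[point]/(0 : R) normr0.
rewrite pos_part_bigcup.
have cv := @ge0_nondecreasing_set_cvg_integral _ (measurableTypeR R) R (fun i : nat => `]0 : R, i.+1%:R[%classic)
  (fun x => `|f x|%:E) (@lebesgue_measure R).
apply: (@le_lt_trans _ _ C%:E); last exact: ltry.
apply: (cvge_le _ (cv _ _ _ _)) => //.
2: by move=> i j ij; apply/subsetPset; apply: subset_itvl; rewrite bnd_simp ler_nat ltnS.
2: by move=> i; apply/measurable_EFinP; apply: measurableT_comp => //; exact: mf.
apply: nearW => i; have [fi fiC] := fC i.+1%:R ltac:(by []).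
rewrite integral_mkcond.
rewrite (_ : integral _ _ _ = \int[mu]_x (`|(f \_ `]0, i.+1%:R[) x|)%:E)%E; last first.
  apply: eq_integral => x _.
  by rewrite /= !patchE; case: ifPn => // _; rewrite -[X in `|X|]/(0 : R) normr0.
by rewrite RintegralE ?lee_fin//; exact: integrable_norm fi.
Qed.

Lemma le_absorb (N A l p : R) : 0 <= N -> N <= A + l * (N * p) -> l * p <= 2^-1 -> N <= 2 * A.
Proof. by move=> N0 h lp; have := ler_wpM2l N0 lp; lra. Qed.

Lemma conv_kap_restrict (nu : R) f (t T : R) : t <= T ->
  convolution (f \_ `]0, T[) (kap nu) t = convolution (pos_part f) (kap nu) t.
Proof.
move=> tT; apply: eq_I => z; rewrite pos_partE patchE mem_setE in_itv/=.
have [z0|z0] //= := ltP 0 z; have [zT|zT] // := ltP z T.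
by rewrite kap_eq0 ?mulr0// subr_le0 (le_trans tT).
Qed.

Section Volterra_equation.
Variables (Y : R -> R) (al nu lam c : R).
Hypothesis al_gt0 : 0 < al.
Hypothesis nu_gt0 : 0 < nu.
Hypothesis lam_gt0 : 0 < lam.
Hypothesis mY : measurable_fun setT (pos_part Y).
Hypothesis bounded_Y : forall T, 0 < T -> exists M, forall t, 0 < t < T -> `|Y t| <= M.
Hypothesis equation : forall t, 0 < t ->
  Y t + lam * RL_integral al Y t = c * kap nu t.

(** From (2 lam)^(1 / al) on, lam times the mass s^(-al) of the weighted kernel is at most 1/2. *)
Let s0 := Num.max 1 ((2 * lam) `^ al^-1).

Let s0_gt0 : 0 < s0. Proof. by rewrite lt_max ltr01. Qed.

Let s0P s : s0 <= s -> lam * s `^ (- al) <= 2^-1.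
Proof.
move=> s0s; have s_gt0 : 0 < s by exact: lt_le_trans s0s.
rewrite powRN ler_pdivrMr ?powR_gt0// mulrC ler_pdivlMr// mulrC.
have -> : 2 * lam = ((2 * lam) `^ al^-1) `^ al.
  by rewrite -powRrM mulVf ?lt0r_neq0// powRr1// mulr_ge0// ltW.
apply: ge0_ler_powR; rewrite ?nnegrE ?powR_ge0//; try exact: ltW.
by rewrite (le_trans _ s0s)// le_max lexx orbT.
Qed.

Section fixed_s.
Variable s : R.
Hypothesis s0s : s0 <= s.
Let s_gt0 : 0 < s. Proof. exact: lt_le_trans s0s. Qed.

Let y t := expR (- s * t) * pos_part Y t.
Let k t := expR (- s * t) * kap al t.
Let q t := expR (- s * t) * kap nu t.
(** The truncation has finite norm by local boundedness of Y alone, and absorbing a term into the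
    left-hand side requires a finite norm. *)
Let yT T t := expR (- s * t) * (Y \_ `]0, T[) t.

Let mexp : measurable_fun setT (fun t : R => expR (- s * t)).
Proof. by apply: measurableT_comp => //; exact: mulrl_measurable. Qed.

Let my : measurable_fun setT y. Proof. exact: measurable_funM. Qed.

Let mk : measurable_fun setT k.
Proof. by apply: measurable_funM => //; exact: measurable_kap. Qed.

Let k_ge0 t : 0 <= k t. Proof. by rewrite mulr_ge0 ?expR_ge0 ?kap_ge0. Qed.

Let y_equation t : y t + lam * convolution y k t = c * q t.
Proof.
have ykE : convolution y k t = expR (- s * t) * convolution (pos_part Y) (kap al) t.
  by rewrite conv_expR//; exact: measurable_kap.
have [t0|t0] := leP t 0.
  rewrite ykE /y /q pos_partE ltNge t0/= kap_eq0//.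
  rewrite [X in _ * (_ * X)](eq_I (g := cst 0)); first by rewrite /Rintegral integral0 !mulr0 addr0.
  move=> z; rewrite pos_partE; case: ltP => z0; last by rewrite mul0r.
  by rewrite kap_eq0 ?mulr0// subr_le0 (le_trans t0)// ltW.
have := equation t0; rewrite (RL_integralE al_gt0 t0 (lexx t)); last first.
  have : measurable_fun (`]0%R, +oo[%classic : set R) Y by apply/(measurable_restrictT Y).
  by apply: measurable_funS => //; exact: subset_itvl.
rewrite conv_kap_restrict// ykE /y /q pos_partE t0 => e.
by rewrite [RHS]mulrCA -e; ring.
Qed.

Let yT_y T : yT T = y \_ `]0, T[.
Proof.
apply/funext => t; rewrite /yT !patchE /y pos_partE mem_setE in_itv/=.
by case: ltP => t0 /=; [case: ltP => //|]; rewrite -[point]/(0 : R) mulr0.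
Qed.

Let yT_bound T : 0 < T -> exists2 M, 0 <= M & forall t, `|yT T t| <= M * kap 1 t.
Proof.
move=> T0; have [M hM] := bounded_Y T0; exists (Num.max 0 M); first by rewrite le_max lexx.
move=> t; rewrite /yT patchE mem_setE in_itv/=.
have [t0|t0] /= := ltP 0 t; last by rewrite kap_eq0// -[point]/(0 : R) !mulr0 normr0.
rewrite kap_posE// subrr powRr0 Gamma1 invr1 !mulr1.
case: ltP => tT; last by rewrite -[point]/(0 : R) mulr0 normr0 le_max lexx.
rewrite normrM ger0_norm ?expR_ge0//.
apply: (@le_trans _ _ `|Y t|); last by rewrite le_max hM ?orbT// t0.
by rewrite ler_piMl// -[leRHS]expR0 ler_expR mulNr oppr_le0 mulr_ge0// ltW.
Qed.

Let L1_yT T : 0 < T -> L1 (yT T).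
Proof.
move=> T0; have [M M0 hM] := yT_bound T0.
have m1 : measurable_fun setT (yT T).
  by rewrite yT_y; apply/measurable_restrict => //; exact: measurable_funTS.
have := integrableZl measurableT (M * expR T) (L1_kap ltr01 ltr01) => /=.
apply: le_integrable => //; first exact/measurable_EFinP.
move=> t _; rewrite -EFinM !abse_EFin lee_fin /=.
have [tT|tT] := ltP t T; last first.
  by rewrite yT_y patchE mem_setE in_itv/= (ltNge t T) tT andbF -[point]/(0 : R) normr0.
apply: (le_trans (hM t)); apply: (le_trans _ (ler_norm _)).
rewrite -mulrA ler_wpM2l// mulrA -expRD ler_peMl ?kap_ge0//.
by rewrite -[leLHS]expR0 ler_expR mulN1r subr_ge0 ltW.
Qed.

Let L1_yT_section T t : 0 < T -> L1 (fun z => yT T z * k (t - z)).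
Proof.
move=> T0; have [M M0 hM] := yT_bound T0.
have := integrableZl measurableT M (L1_kap_kap ltr01 al_gt0 t) => /=.
apply: le_integrable => //.
  by apply/measurable_EFinP; apply: measurable_conv_integrand => //; exact: L1_measurable (L1_yT T0).
move=> z _; rewrite -EFinM !abse_EFin lee_fin /= normrM; apply: (le_trans _ (ler_norm _)).
rewrite mulrA ler_pM// ger0_norm ?k_ge0// /k.
have [tz|tz] := leP (t - z) 0; first by rewrite kap_eq0// mulr0.
by rewrite ler_piMl ?kap_ge0// -[leRHS]expR0 ler_expR mulNr oppr_le0 mulr_ge0// ltW.
Qed.

Let L1k : L1 k. Proof. exact: L1_kap. Qed.
Let L1q : L1 q. Proof. exact: L1_kap. Qed.

(** The bound is independent of T, so monotone convergence makes [y] integrable without any growth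
    condition on Y. *)
Let norm_yT T : 0 < T -> I (fun t => `|yT T t|) <= 2 * (`|c| * s `^ (- nu)).
Proof.
move=> T0; have yi := L1_yT T0.
have yni : L1 (fun t => `|yT T t|) by exact: integrable_norm yi.
have [ci cE] := conv_L1 yni L1k.
have qi : L1 (fun t => `|c| * q t).
  by have := integrableZl measurableT `|c| L1q; apply: eq_integrable.
have lci : L1 (fun t => lam * convolution (fun t => `|yT T t|) k t).
  by have := integrableZl measurableT lam ci; apply: eq_integrable.
have le_y t : `|yT T t| <= `|c| * q t + lam * convolution (fun t => `|yT T t|) k t.
  have q0 : 0 <= q t by rewrite mulr_ge0 ?expR_ge0 ?kap_ge0.
  have c0 : 0 <= convolution (fun t => `|yT T t|) k t by apply: Rintegral_ge0 => z _; rewrite mulr_ge0.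
  have [tT|tT] := ltP t T; last first.
    rewrite {1}yT_y patchE mem_setE in_itv/= (ltNge t T) tT andbF -[point]/(0 : R) normr0.
    by apply: addr_ge0; apply: mulr_ge0 => //; exact: ltW.
  have -> : yT T t = c * q t - lam * convolution (yT T) k t.
    have [t0|t0] := leP t 0.
      rewrite {1}/yT /q patchE mem_setE in_itv/= ltNge t0 kap_eq0//.
      rewrite [X in _ - _ * X](eq_I (g := cst 0)); first by rewrite /Rintegral integral0 -[point]/(0 : R) !mulr0 subr0.
      move=> z; rewrite yT_y /y patchE mem_setE in_itv/=; case: ltP => z0 /=; last by rewrite mul0r.
      by rewrite /k kap_eq0 ?mulr0 ?mulr0// subr_le0 (le_trans t0)// ltW.
    rewrite -y_equation {1}yT_y patchE mem_setE in_itv/= t0 tT.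
    (* The kernel is causal: at t < T only times before T are seen, so truncation leaves the
       equation intact. *)
    suff -> : convolution (yT T) k t = convolution y k t by rewrite addrK.
    apply: eq_I => z; rewrite yT_y patchE mem_setE in_itv/=.
    have [z0|z0] //= := ltP 0 z; last by rewrite /y pos_partE ltNge z0/= !mulr0 !mul0r.
    have [zT|zT] // := ltP z T.
    by rewrite /k kap_eq0 ?mulr0 ?mulr0// subr_le0 (le_trans _ zT)// ltW.
  apply: (le_trans (ler_normB _ _)); rewrite (normrM c) (normrM lam) (ger0_norm q0) lerD2l.
  rewrite (gtr0_norm lam_gt0); apply: ler_wpM2l; first exact: ltW.
  apply: (le_trans (le_normr_Rintegral measurableT (L1_yT_section t T0))).
  by rewrite le_eqVlt; apply/orP; left; apply/eqP; apply: eq_I => z; rewrite normrM (ger0_norm (k_ge0 _)).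
have := le_I yni (L1D qi lci) le_y.
rewrite (ID qi lci) (IZ _ L1q) (IZ _ ci) cE !laplace_kap// => h.
have N0 : 0 <= I (fun t => `|yT T t|) by exact: Rintegral_ge0.
exact: le_absorb N0 h (s0P s0s).
Qed.

Lemma Volterra_L1_fixed : L1 y /\ I y = c * s `^ (- nu) / (1 + lam * s `^ (- al)).
Proof.
have yi : L1 y.
  have -> : y = pos_part y.
    by apply/funext => t; rewrite pos_partE /y pos_partE; case: ifP; rewrite ?mulr0.
  apply: (@L1_pos_part _ (2 * (`|c| * s `^ (- nu)))) => T T0.
  by rewrite -yT_y; split; [exact: L1_yT|exact: norm_yT].
split => //.
have [ci cE] := conv_L1 yi L1k.
have lci : L1 (fun t => lam * convolution y k t).
  by have := integrableZl measurableT lam ci; apply: eq_integrable.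
have : I (fun t => y t + lam * convolution y k t) = I (fun t => c * q t).
  by apply: eq_I => t; exact: y_equation.
rewrite RintegralD// !RintegralZl// cE !laplace_kap// => e.
have d0 : 1 + lam * s `^ (- al) != 0.
  by apply: lt0r_neq0; rewrite ltr_wpDr// mulr_ge0 ?powR_ge0// ltW.
by apply: (mulIf d0); rewrite divfK// -e; ring.
Qed.

End fixed_s.

Lemma Volterra_laplace : exists2 s0, 0 < s0 & forall s, s0 <= s ->
  L1 (fun t => expR (- s * t) * pos_part Y t) /\
  I (fun t => expR (- s * t) * pos_part Y t) = c * s `^ (- nu) / (1 + lam * s `^ (- al)).
Proof. by exists s0 => // s s0s; exact: Volterra_L1_fixed. Qed.

End Volterra_equation.
End Volterra.

(** * Hankel representation of the modes *)

Section half_line.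
Context {R : realType}.
Implicit Types f F : R -> R.

Lemma kap1 (t : R) : kap 1 t = pos_part (cst 1) t.
Proof. by rewrite /kap !pos_partE subrr powRr0 Gamma1 divr1. Qed.

Lemma continuous_FTC_half F f l :
  (forall t : R, is_derive t (1 : R) F (f t)) -> continuous f -> L1 (pos_part f) ->
  F t @[t --> +oo] --> l -> I (pos_part f) = l - F 0.
Proof.
move=> dF cf fi Fl.
have mf : measurable_fun setT f by exact: continuous_measurable_fun.
pose f_ n := f \_ `]0, (n.+1%:R)[.
have cF : continuous F.
  by move=> x; apply: differentiable_continuous; apply/derivable1_diffP; exact: ex_derive.
have IfE n : I (f_ n) = F n.+1%:R - F 0.
  have n0 : (0 < n.+1%:R :> R) by [].
  have ci : lebesgue_measure.-integrable `[0%R, n.+1%:R] (EFin \o f).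
    by apply: continuous_compact_integrable; [exact: segment_compact|exact: continuous_subspaceT].
  rewrite -Rintegral_mkcond Rintegral_itv_bndo_bndc.
    rewrite Rintegral_itv_obnd_cbnd.
      rewrite /Rintegral (continuous_FTC2 n0 (F := F))//=.
      - exact: continuous_subspaceT.
      - split => //.
        + by apply: cvg_at_right_filter; exact: cF.
        + by apply: cvg_at_left_filter; exact: cF.
      - by move=> x _; rewrite derive1E; apply: derive_val.
    by apply: integrableS ci => //; exact: subset_itv_oc_cc.
  by apply: integrableS ci => //; exact: subset_itv_oo_cc.
have [|||||_ c1] := @Rintegral_dominated_cvg R f_ (pos_part f) (fun x => `|pos_part f x|) 0.
- move=> n; apply/measurable_restrict => //; exact: measurable_funTS.
- exact: measurable_pos_part.
- exact: (integrable_norm fi).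
- move=> n x; rewrite /f_ patchE mem_setE in_itv/= pos_partE; case: ltP => //= _; case: ltP => // _.
  by rewrite -[X in `|X|]/(0 : R) normr0.
- move=> x _; apply: cvg_near_cst; near=> n; rewrite /f_ patchE mem_setE in_itv/= pos_partE.
  case: ltP => //= x0; rewrite ifT// (lt_trans (y := n%:R))// ?ltr_nat//.
  by near: n; exact: nbhs_infty_gtr.
have cn : (n.+1%:R : R) @[n --> \oo] --> +oo.
  apply/cvgryPge => A; near=> n; apply: (@le_trans _ _ n%:R).
    by near: n; exact: nbhs_infty_ger.
  by rewrite ler_nat.
apply: cvg_unique c1 _ => //; rewrite (_ : (fun n => _) = fun n => F n.+1%:R - F 0).
  by apply: cvgB; [exact: (cvg_comp _ F cn Fl)|exact: cvg_cst].
by apply/funext => n; exact: IfE.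
Unshelve. all: by end_near. Qed.

Lemma laplace_trig (c B p r : R) : 0 < c ->
  let f t := expR (- c * t) * (cos (t * B) * r + sin (t * B) * p) in
  L1 (pos_part f) /\ I (pos_part f) = (c * r + B * p) / (c ^+ 2 + B ^+ 2).
Proof.
move=> c0 f.
have cf : continuous f.
  move=> t; apply: cvgM.
    by apply: (cvg_comp _ expR); [apply: cvgMr; exact: cvg_id|exact: continuous_expR].
  apply: cvgD; apply: cvgMl.
    by apply: (cvg_comp _ cos); [apply: cvgMl; exact: cvg_id|exact: continuous_cos].
  by apply: (cvg_comp _ sin); [apply: cvgMl; exact: cvg_id|exact: continuous_sin].
have fi : L1 (pos_part f).
  apply: (L1_dominated _ (L1Z (`|r| + `|p|) (L1_kap ltr01 c0))).
    by apply: measurable_pos_part; exact: continuous_measurable_fun.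
  move=> t; rewrite kap1 !pos_partE; case: ltP => t0; last by rewrite normr0 !mulr0.
  rewrite mulr1 normrM ger0_norm ?expR_ge0// mulrC ler_wpM2r ?expR_ge0//.
  apply: (le_trans (ler_normD _ _)); rewrite !normrM lerD// ler_piMl//.
    exact: cos_max.
  exact: sin_max.
split => //.
have d0 : c ^+ 2 + B ^+ 2 != 0.
  by apply: lt0r_neq0; rewrite ltr_wpDr ?sqr_ge0// exprn_gt0.
(* u and v solve the linear system that makes e^(-c t) (u cos (B t) + v sin (B t)) a primitive of
   f. *)
pose u := - (c * r + B * p) / (c ^+ 2 + B ^+ 2).
pose v := (B * r - c * p) / (c ^+ 2 + B ^+ 2).
pose F t := expR (- c * t) * (cos (t * B) * u + sin (t * B) * v).
have -> : (c * r + B * p) / (c ^+ 2 + B ^+ 2) = 0 - F 0.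
  by rewrite /F !mulr0 mul0r expR0 cos0 sin0 /u; field.
apply: continuous_FTC_half => //.
- move=> t; have -> : f t = expR (- c * t) * (- c) * (cos (t * B) * u + sin (t * B) * v) +
    expR (- c * t) * (- sin (t * B) * B * u + cos (t * B) * B * v).
    by rewrite /f /u /v; field.
  rewrite /F; apply: is_derive_eq; rewrite /GRing.scale /=; ring.
- apply/cvgrPdist_le => e e0; near=> t; rewrite sub0r normrN normrM ger0_norm ?expR_ge0//.
  apply: (@le_trans _ _ (expR (- c * t) * (`|u| + `|v|))).
    rewrite ler_wpM2l ?expR_ge0//; apply: (le_trans (ler_normD _ _)).
    rewrite !normrM lerD// ler_piMl//; [exact: cos_max|exact: sin_max].
  near: t; have h : expR (- c * t) * (`|u| + `|v|) @[t --> +oo] --> 0.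
    rewrite -(mul0r (`|u| + `|v|)); apply: cvgMl.
    apply: (@cvg_comp _ _ _ (fun t => - c * t) expR _ -oo); last exact: expR_cvgNy.
    rewrite (_ : (fun t => _) = (fun t => - t * c)); last by apply/funext => t; ring.
    by apply: gt0_cvgMlNy => //; apply/cvgNrNy; exact: cvg_id.
  by move/cvgrPdist_le : h => /(_ _ e0); apply: filterS => t; rewrite sub0r normrN; apply: le_trans; exact: ler_norm.
Unshelve. all: by end_near. Qed.

(** With y = e^x this is y^(m + 1) <= C e^(k y) for y >= 1. *)
Lemma expR_double_exp_le (m k : R) : 0 < k -> exists2 C, 0 <= C &
  forall x, 0 <= x -> expR (m * x - k * expR x) <= C * expR (- x).
Proof.
move=> k0; have [C C0 hC] := powR_le_expR (m + 1) k0; exists C => // x x0.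
have e1 : 1 <= expR x by rewrite leNgt expR_lt1 -leNgt.
have := hC _ (expR_gt0 x) e1; rewrite -expRM => h.
rewrite expRD expRN ler_pdivrMr ?expR_gt0// mulrAC.
have -> : expR (m * x) = expR (x * (m + 1)) * expR (- x) by rewrite -expRD; congr expR; ring.
by rewrite ler_wpM2r ?expR_ge0.
Qed.

Lemma L1_expR_double_exp (m k : R) : 0 < m -> 0 < k ->
  L1 (fun x => expR (m * x - k * expR x)).
Proof.
move=> m0 k0; have [C C0 hC] := expR_double_exp_le m k0.
have b0 : 0 < Num.min m 1 by rewrite lt_min m0 ltr01.
apply: (L1_dominated _ (L1Z (C + 1) (L1_expabs b0))).
  apply: measurableT_comp => //; apply: measurable_funB; first exact: mulrl_measurable.
  by apply: measurable_funM => //.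
move=> x; rewrite ger0_norm ?expR_ge0//.
have [x0|x0] := leP 0 x.
  apply: (le_trans (hC _ x0)).
  apply: ler_pM; rewrite ?expR_ge0//; first by rewrite lerDl.
  rewrite /expabs ler_expR ger0_norm// mulNr lerN2.
  by rewrite -[leRHS]mul1r ler_wpM2r// ge_min lexx orbT.
apply: (@le_trans _ _ (expR (m * x))).
  by rewrite ler_expR lerBlDr lerDl mulr_ge0 ?expR_ge0// ltW.
rewrite -[leLHS]mul1r; apply: ler_pM; rewrite ?expR_ge0 ?lerDr//.
rewrite /expabs ler_expR ltr0_norm// mulrNN; apply: ler_wnM2r; first exact: ltW.
by rewrite ge_min lexx.
Qed.

End half_line.

(** * Laplace transform of an integral over the rays *)

Section Hankel_integral.
Context {R : realType}.
Notation mu := (@lebesgue_measure R).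
Variables (th : R).
Hypothesis th_gt : pi / 2 < th.
Hypothesis th_lt : th < pi.
Implicit Types Z : R -> R[i].

Lemma cos_th_lt0 : cos th < 0.
Proof.
have := cosDpi (th - pi); rewrite subrK => ->.
rewrite oppr_lt0 cos_gt0_pihalf//; have := th_gt; have := th_lt; have := @pi_gt0 R.
by move=> ? ? ?; apply/andP; split; lra.
Qed.

Let k := - cos th.

Lemma Ncos_th_gt0 : 0 < k. Proof. by rewrite oppr_gt0 cos_th_lt0. Qed.

(* [exp (t e^w)] on the line [w = x + i th] *)
Definition ray_exp t x := cexp (t * (expR x * cos th)) (t * (expR x * sin th)).

(** The lower ray carries complex conjugate values, so the two rays together leave twice the
    imaginary part; hence the prefactor 1 / pi in the definitions below. The factor e^w of dz = e^w
    dw belongs to Z, which explains the exponents a + 1. *)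
Definition hankel_integrand Z t x := Im (ray_exp t x * Z x).

Lemma normc_ray_exp t x : normc (ray_exp t x) = expR (- (t * k) * expR x).
Proof. by rewrite normc_cexp /k; congr expR; ring. Qed.

Lemma hankel_integrand_le Z t x :
  `|hankel_integrand Z t x| <= expR (- (t * k) * expR x) * normc (Z x).
Proof. by rewrite (le_trans (normIm_le _))// normcM normc_ray_exp. Qed.

Lemma hankel_integrandE Z t x : hankel_integrand Z t x =
  expR (t * (expR x * cos th)) *
  (cos (t * (expR x * sin th)) * Im (Z x) + sin (t * (expR x * sin th)) * Re (Z x)).
Proof. by rewrite /hankel_integrand cImM /=; ring. Qed.

Definition cont_line Z := continuous (fun x => Re (Z x)) /\ continuous (fun x => Im (Z x)).

Section fixed_function.
Variable Z : R -> R[i].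
Hypothesis cZ : cont_line Z.

Lemma measurable_hankel_integrand :
  measurable_fun setT (fun p : R * R => hankel_integrand Z p.2 p.1).
Proof.
under eq_fun do rewrite hankel_integrandE.
have mR : measurable_fun setT (fun p : R * R => Re (Z p.1)).
  apply: (measurableT_comp (f := fun x => Re (Z x)) _ measurable_fst).
  exact: continuous_measurable_fun cZ.1.
have mI : measurable_fun setT (fun p : R * R => Im (Z p.1)).
  apply: (measurableT_comp (f := fun x => Im (Z x)) _ measurable_fst).
  exact: continuous_measurable_fun cZ.2.
have mA c : measurable_fun setT (fun p : R * R => p.2 * (expR p.1 * c)).
  apply: measurable_funM => //; apply: measurable_funM => //.
  by apply: measurableT_comp => //.
apply: measurable_funM; first exact: measurableT_comp (mA _).
apply: measurable_funD; apply: measurable_funM => //.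
  by apply: (measurableT_comp (f := @cos R)) => //; exact: continuous_measurable_fun (@continuous_cos R).
by apply: (measurableT_comp (f := @sin R)) => //; exact: continuous_measurable_fun (@continuous_sin R).
Qed.

Lemma measurable_hankel_section t : measurable_fun setT (hankel_integrand Z t).
Proof.
exact: (@measurable_section2 R (fun x t => hankel_integrand Z t x) measurable_hankel_integrand t).
Qed.

Variable G : R -> R.
Hypothesis ZG : forall x, normc (Z x) <= G x.

Let G_ge0 x : 0 <= G x. Proof. exact: le_trans (normc_ge0 _) (ZG x). Qed.

Section laplace.
Variable s : R.
Hypothesis s0 : 0 < s.
Hypothesis Gi : L1 (fun x => G x / (s + k * expR x)).

Let c_gt0 x : 0 < s + k * expR x.
Proof. by rewrite addr_gt0// mulr_gt0 ?expR_gt0// Ncos_th_gt0. Qed.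

Let f (x t : R) := pos_part (fun t => expR (- s * t)) t * hankel_integrand Z t x.

Let mf : measurable_fun setT (fun p : R * R => f p.1 p.2).
Proof.
apply: measurable_funM; last exact: measurable_hankel_integrand.
apply: (measurableT_comp (f := pos_part (fun t => expR (- s * t))) _ measurable_snd).
by apply: measurable_pos_part; apply: measurableT_comp => //; exact: mulrl_measurable.
Qed.

Let f_le x t : `|f x t| <= G x * (expR (- (s + k * expR x) * t) * kap 1 t).
Proof.
rewrite /f kap1 !pos_partE; case: ltP => t0; last by rewrite mul0r normr0 !mulr0.
rewrite mulr1 normrM ger0_norm ?expR_ge0// mulrC.
apply: (le_trans (ler_wpM2r (expR_ge0 _) (hankel_integrand_le Z t x))).
have -> : - (s + k * expR x) * t = - (t * k) * expR x + - s * t by ring.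
rewrite expRD mulrA ler_wpM2r ?expR_ge0// mulrC ler_wpM2r ?expR_ge0//; exact: ZG.
Qed.

Let fg x : (\int[mu]_t `|f x t|%:E <= (G x / (s + k * expR x))%:E)%E.
Proof.
have i := L1Z (G x) (L1_kap ltr01 (c_gt0 x)).
have -> : G x / (s + k * expR x) = I (fun t => G x * (expR (- (s + k * expR x) * t) * kap 1 t)).
  by rewrite IZ ?laplace_kap ?powR_inv1// ?ltW//; exact: L1_kap.
rewrite -RintegralE//; apply: ge0_le_integral => //.
- by apply/measurable_EFinP; apply: measurableT_comp => //; exact: measurable_section1 mf x.
- exact: measurable_int i.
- by move=> t _; rewrite lee_fin; exact: f_le.
Qed.

(** At a fixed point z of the ray the integral of e^(-s t) e^(t z) over t > 0 is 1 / (s - z). Fubini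
    is allowed because the majorant integrates in t to [G x / (s + k * expR x)]. *)
Lemma laplace_hankel :
  L1 (fun t => expR (- s * t) * pos_part (fun t => I (hankel_integrand Z t)) t) /\
  I (fun t => expR (- s * t) * pos_part (fun t => I (hankel_integrand Z t)) t) =
  I (fun x => Im (Z x * (s%:C%C - cexp x th)^-1)).
Proof.
have e t : I (f ^~ t) = expR (- s * t) * pos_part (fun t => I (hankel_integrand Z t)) t.
  have [t0|t0] := leP t 0.
    rewrite pos_partE ltNge t0/= mulr0 (eq_I (g := cst 0)); first by rewrite /Rintegral integral0.
    by move=> x; rewrite /f pos_partE ltNge t0/= mul0r.
  rewrite pos_partE t0 -Rintegral_scale ?expR_gt0//; last exact: measurable_hankel_section.
  by apply: eq_I => x; rewrite /f pos_partE t0.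
have i2 := integrable_Fubini2 mf fg Gi.
have F := Rintegral_Fubini mf fg Gi.
rewrite (funext e : (fun t => I (f ^~ t)) = _) in i2 F.
split; first exact: i2.
rewrite -F; apply: eq_I => x.
have [_ h] := laplace_trig (expR x * sin th) (Re (Z x)) (Im (Z x)) (c_gt0 x).
rewrite (eq_I (g := pos_part (fun t => expR (- (s + k * expR x) * t) *
  (cos (t * (expR x * sin th)) * Im (Z x) + sin (t * (expR x * sin th)) * Re (Z x))))).
  rewrite {}h cImM cReV cImV cReD cImD cReN cImN /= /k.
  rewrite (_ : s - expR x * cos th = s + - cos th * expR x); last by ring.
  rewrite sub0r sqrrN; field; apply: lt0r_neq0.
  by rewrite ltr_pwDl ?sqr_ge0// exprn_gt0//; exact: c_gt0.
move=> t; rewrite /f !pos_partE; case: ltP => t0; last by rewrite mul0r.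
by rewrite hankel_integrandE mulrA -expRD; congr (expR _ * _); rewrite /k; ring.
Qed.

End laplace.
(** For t > t0 / 2 the majorant taken at t0 / 2 dominates. *)
Lemma continuous_hankel t0 : 0 < t0 -> (forall t, 0 < t -> L1 (fun x => expR (- (t * k) * expR x) * G x)) ->
  {for t0, continuous (fun t => I (hankel_integrand Z t))}.
Proof.
move=> t00 Gi; have t02 : 0 < t0 / 2 by rewrite divr_gt0.
have L1t t : 0 < t -> L1 (hankel_integrand Z t).
  move=> tp; apply: L1_dominated (Gi t tp) _; first exact: measurable_hankel_section.
  move=> x; apply: (le_trans (hankel_integrand_le _ _ _)).
  by rewrite ler_wpM2l ?expR_ge0.
apply: (@continuity_under_integral R _ _ mu (fun t x => hankel_integrand Z t x) setT
  measurableT (t0 / 2) (t0 + 1) _ _ (fun x => expR (- (t0 / 2 * k) * expR x) * G x)).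
- move=> t; rewrite /= in_itv/= => /andP[tp _]; apply: L1t; exact: lt_trans tp.
- apply: aeW => x _ t _; rewrite (funext (fun t => hankel_integrandE Z t x)); apply: cvgM.
    by apply: (cvg_comp _ expR); [apply: cvgMl; exact: cvg_id|exact: continuous_expR].
  apply: cvgD; apply: cvgMl.
    by apply: (cvg_comp _ cos); [apply: cvgMl; exact: cvg_id|exact: continuous_cos].
  by apply: (cvg_comp _ sin); [apply: cvgMl; exact: cvg_id|exact: continuous_sin].
- exact: Gi.
- move=> t; rewrite /= in_itv/= => /andP[tp _]; apply: aeW => x _.
  apply: (le_trans (hankel_integrand_le _ _ _)); apply: ler_pM => //; rewrite ?expR_ge0 ?normc_ge0//.
  by rewrite ler_expR ler_wpM2r ?expR_ge0// lerN2 ler_wpM2r ?ltW// Ncos_th_gt0.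
- by rewrite inE/= in_itv/= ltr_pdivrMr// ltrDl ltr01 andbT ltr_pMr// ltr1n.
Qed.

End fixed_function.
End Hankel_integral.

(** * The functions S_lam: transform, scaling and expansion *)

Section Mittag_Leffler.
Context {R : realType}.
Notation mu := (@lebesgue_measure R).
Variables (th q : R).
Hypothesis th_gt : pi / 2 < th.
Hypothesis thq : th < q.
Hypothesis q_lt : q < pi.

Let th_lt : th < pi. Proof. exact: lt_trans q_lt. Qed.
Let th_gt0 : 0 < th. Proof. by rewrite (lt_trans _ th_gt)// divr_gt0// pi_gt0. Qed.
Let q_gt0 : 0 < q. Proof. exact: lt_trans thq. Qed.
Let th_itv : 0 <= th <= q. Proof. by rewrite !ltW. Qed.
Let k := - cos th.
Let k0 : 0 < k. Proof. exact: Ncos_th_gt0. Qed.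

(** Hankel's integral of e^z z^(m - 1) / (2 pi i), which represents 1 / Gamma (1 - m). *)
Definition hankel_pow (m : R) :=
  pi^-1 * I (hankel_integrand th (fun x => cexp (m * x) (m * th)) 1).

(* The inverse Laplace transform of [s^a / (s^al + lam)], as an integral over the
   two rays of argument [th] and [- th]. *)
Definition mode_sol (al a lam t : R) :=
  pi^-1 * I (hankel_integrand th (fun x => Psi al lam (a + 1) x th) t).

Section fixed_parameters.
Variables al lam : R.
Hypothesis al0 : 0 <= al.
Hypothesis lam0 : 0 < lam.
Hypothesis alq : al * q < pi.

Let c := sector_cst (al * q).
Let c0 : 0 < c.
Proof. by apply: sector_cst_gt0; rewrite alq mulr_ge0// ltW. Qed.

Let cl0 : 0 < c * lam. Proof. exact: mulr_gt0. Qed.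
Let ck0 : 0 < c * k. Proof. exact: mulr_gt0. Qed.

Let G b x := expR (b * x) / (c * (expR (al * x) + lam)).

Let PsiG b x : normc (Psi al lam b x th) <= G b x.
Proof. exact: (normc_Psi_le al0 lam0 q_gt0 alq). Qed.

Let cont_Psi b : cont_line (fun x => Psi al lam b x th).
Proof.
by split => x; [apply: (@continuous_section_Re _ (Psi al lam b) x th)|
  apply: (@continuous_section_Im _ (Psi al lam b) x th)];
  exact: (ccont_Psi al0 lam0 q_gt0 alq).
Qed.

Let den0 x : 0 < expR (al * x) + lam.
Proof. by rewrite addr_gt0// expR_gt0. Qed.

Let mG b : measurable_fun setT (G b).
Proof.
have cm d : continuous (fun x : R => expR (d * x)).
  by move=> x; apply: (cvg_comp _ expR); [apply: cvgMr; exact: cvg_id|exact: continuous_expR].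
apply: continuous_measurable_fun => x; apply: cvgM; first exact: cm.
apply: cvgV; first by rewrite mulf_neq0 ?lt0r_neq0.
by apply: cvgMr; apply: cvgD; [exact: cm|exact: cvg_cst].
Qed.

Let G_ge0 b x : 0 <= G b x.
Proof. by rewrite divr_ge0 ?expR_ge0// mulr_ge0// ltW. Qed.

Let mE d : measurable_fun setT (fun x : R => expR (d * expR x)).
Proof. by apply: measurableT_comp => //; apply: measurable_funM. Qed.

Let G_le b x : G b x <= expR (b * x) / (c * lam).
Proof.
apply: ler_wpM2l; first exact: expR_ge0.
rewrite lef_pV2 ?posrE ?cl0 ?(mulr_gt0 c0 (den0 x))//.
by apply: ler_wpM2l; [exact: ltW|rewrite lerDr expR_ge0].
Qed.

Let L1_GE b t : 0 < b -> 0 < t -> L1 (fun x => expR (- (t * k) * expR x) * G b x).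
Proof.
move=> b0 t0.
apply: (L1_dominated _ (L1Z (c * lam)^-1 (L1_expR_double_exp b0 (mulr_gt0 t0 k0)))).
  exact: measurable_funM.
move=> x; rewrite ger0_norm; last by rewrite mulr_ge0 ?expR_ge0.
apply: (le_trans (ler_wpM2l (expR_ge0 _) (G_le b x))).
by rewrite expRD mulNr; lra.
Qed.

Lemma L1_hankel_Psi b t : 0 < b -> 0 < t ->
  L1 (hankel_integrand th (fun x => Psi al lam b x th) t).
Proof.
move=> b0 t0; apply: (L1_dominated _ (L1_GE b0 t0)).
  exact: (measurable_hankel_section th (cont_Psi b)).
move=> x; apply: (le_trans (hankel_integrand_le _ _ _ _)).
by rewrite ler_wpM2l ?expR_ge0.
Qed.

Lemma continuous_mode_sol a t : -1 < a -> 0 < t ->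
  {for t, continuous (mode_sol al a lam)}.
Proof.
move=> a1 t0; apply: cvgMr.
apply: (continuous_hankel (G := G (a + 1)) th_gt th_lt (cont_Psi _) (PsiG _) t0) => u u0.
by apply: L1_GE => //; rewrite -ltrBlDr sub0r.
Qed.

(** Discarding |z^al| in the lower bound for |z^al + lam| leaves 1 / lam times an integral in which
    lam no longer occurs. *)
Lemma mode_sol_decay b : 0 < b ->
  `|I (hankel_integrand th (fun x => Psi al lam b x th) 1)| <=
   I (fun x => expR (b * x - k * expR x)) / c / lam.
Proof.
move=> b0.
have i := L1_expR_double_exp b0 k0.
rewrite -mulrA mulrC -invfM -IZ//; apply: Rintegral_norm_le.
- exact: (measurable_hankel_section th (cont_Psi b)).
- exact: L1Z.
move=> x; apply: (le_trans (hankel_integrand_le _ _ _ _)).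
apply: (le_trans (ler_wpM2l (expR_ge0 _) (le_trans (PsiG b x) (G_le b x)))).
by rewrite expRD mul1r -/k mulNr; lra.
Qed.

Let Gi b s : 0 < b -> b - 1 < al -> 0 < s -> L1 (fun x => G b x / (s + k * expR x)).
Proof.
move=> b0 bal s0.
(* The quotient behaves like e^(b x) at - oo and e^((b - al - 1) x) at + oo; the two summands of C
   belong to the two sides. *)
have d0 : 0 < Num.min b (al + 1 - b) by rewrite lt_min b0; lra.
pose C := (c * lam * s)^-1 + (c * k)^-1.
have skx x : 0 < s + k * expR x by rewrite addr_gt0// mulr_gt0 ?expR_gt0.
apply: (L1_dominated _ (L1Z C (L1_expabs d0))).
  apply: measurable_funM => //; apply: continuous_measurable_fun => x.
  apply: cvgV; first exact: lt0r_neq0.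
  by apply: cvgD; [exact: cvg_cst|apply: cvgMr; exact: continuous_expR].
move=> x; rewrite ger0_norm; last by rewrite divr_ge0// ltW.
have Cp1 : 0 <= (c * lam * s)^-1 by rewrite invr_ge0 mulr_ge0 ?(ltW cl0) ?(ltW s0).
have Cp2 : 0 <= (c * k)^-1 by rewrite invr_ge0 ltW.
have [x0|x0] := leP 0 x.
  apply: (@le_trans _ _ ((c * k)^-1 * expR (- (al + 1 - b) * x))).
    have -> : (c * k)^-1 * expR (- (al + 1 - b) * x) = expR (b * x) / (c * (expR (al * x))) / (k * expR x).
      rewrite (_ : - (al + 1 - b) * x = b * x - (al * x) - x) ?expRD ?expRN; last by ring.
      by field; rewrite (lt0r_neq0 c0) (lt0r_neq0 k0) !lt0r_neq0 ?expR_gt0.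
    apply: ler_pM; rewrite ?invr_ge0 ?G_ge0 ?(ltW (skx x))//.
      apply: ler_wpM2l; first exact: expR_ge0.
      rewrite lef_pV2 ?posrE ?(mulr_gt0 c0 (den0 x)) ?(mulr_gt0 c0 (expR_gt0 _))//.
      by apply: ler_wpM2l; [exact: ltW|rewrite lerDl ltW].
    by rewrite lef_pV2 ?posrE ?skx ?(mulr_gt0 k0 (expR_gt0 _))// lerDr ltW.
  apply: ler_pM; rewrite ?expR_ge0//; first by rewrite /C lerDr.
  rewrite /expabs ler_expR (ger0_norm x0) !mulNr lerN2; apply: ler_wpM2r => //.
  by rewrite ge_min lexx orbT.
apply: (@le_trans _ _ ((c * lam * s)^-1 * expR (b * x))).
  have -> : (c * lam * s)^-1 * expR (b * x) = expR (b * x) / (c * lam) / s.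
    by field; rewrite (lt0r_neq0 c0) (lt0r_neq0 lam0) (lt0r_neq0 s0).
  apply: ler_pM; rewrite ?invr_ge0 ?G_ge0 ?(ltW (skx x)) ?G_le//.
  by rewrite lef_pV2 ?posrE// lerDl mulr_ge0 ?expR_ge0// ltW.
apply: ler_pM; rewrite ?expR_ge0//; first by rewrite /C lerDl.
rewrite /expabs ler_expR (ltr0_norm x0) mulrNN; apply: ler_wnM2r; first exact: ltW.
by rewrite ge_min lexx.
Qed.

Lemma den_th_neq0 x : den al lam x th != 0.
Proof. exact: (den_neq0 al0 lam0 q_gt0 alq). Qed.

(** z^b = (lam z^b + z^(b + al)) / (z^al + lam), the identity that drives the asymptotic
    expansion. *)
Lemma hankel_integrand_split b x :
  hankel_integrand th (fun x => cexp (b * x) (b * th)) 1 x =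
  lam * hankel_integrand th (fun x => Psi al lam b x th) 1 x +
  hankel_integrand th (fun x => Psi al lam (b + al) x th) 1 x.
Proof.
have ImZ (r : R) w : Im (r%:C%C * w) = r * Im w by case: w => u v /=; rewrite mul0r addr0.
rewrite /hankel_integrand -ImZ -cImD /Psi; congr (Im _).
have := den_th_neq0 x; rewrite (mulrDl b al x) (mulrDl b al th) cexpD /den => h.
by field.
Qed.

Lemma L1_hankel_cexp b : 0 < b -> L1 (hankel_integrand th (fun x => cexp (b * x) (b * th)) 1).
Proof.
move=> b0; rewrite (funext (hankel_integrand_split b)); apply: L1D; first apply: L1Z.
  exact: L1_hankel_Psi.
by apply: L1_hankel_Psi => //; rewrite ltr_wpDr.
Qed.

(** The exponent a + al may exceed the range in which [mode_sol] is an inverse transform; the decay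
    of e^z on the rays still makes the integral converge. *)
Lemma mode_sol_expansion a : -1 < a ->
  lam * mode_sol al a lam 1 = hankel_pow (a + 1) - mode_sol al (a + al) lam 1.
Proof.
move=> a1; have b0 : 0 < a + 1 by rewrite -ltrBlDr sub0r.
have b1 : 0 < a + 1 + al by rewrite ltr_wpDr.
rewrite /mode_sol /hankel_pow (eq_I (hankel_integrand_split _)).
have i1 := L1_hankel_Psi b0 ltr01; have i2 := L1_hankel_Psi b1 ltr01.
rewrite (ID (L1Z lam i1) i2) (IZ _ i1) (_ : a + al + 1 = a + 1 + al); ring.
Qed.

Lemma laplace_mode_sol_line a s : -1 < a -> a < al -> 0 < s ->
  L1 (fun t => expR (- s * t) * pos_part (mode_sol al a lam) t) /\
  I (fun t => expR (- s * t) * pos_part (mode_sol al a lam) t) =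
  pi^-1 * I (fun x => Im (Psi al lam (a + 1) x th * (s%:C%C - cexp x th)^-1)).
Proof.
move=> a1 aal s0.
have b0 : 0 < a + 1 by rewrite -ltrBlDr sub0r.
have b1 : a + 1 - 1 < al by rewrite addrK.
have [Li Ie] := laplace_hankel th_gt th_lt (cont_Psi _) (PsiG (a + 1)) s0 (Gi b0 b1 s0).
have e t : expR (- s * t) * pos_part (mode_sol al a lam) t =
  pi^-1 * (expR (- s * t) * pos_part (fun t => I (hankel_integrand th (fun x => Psi al lam (a + 1) x th) t)) t).
  by rewrite !pos_partE; case: ifP => _; rewrite /mode_sol; ring.
by rewrite (funext e); split; [exact: L1Z|rewrite IZ// Ie].
Qed.

End fixed_parameters.

Lemma cexp_real (y : R) : cexp y 0 = (expR y)%:C%C.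
Proof. by rewrite /cexp cos0 sin0 mulr0 mulr1. Qed.

(** Translating w by y multiplies z by e^y, which only rescales lam. Both the scaling law in t and
    the displacement of the pole rest on this. *)
Lemma Psi_shift (al lam b x y t : R) :
  Psi al lam b (x + y) t = (expR ((b - al) * y))%:C%C * Psi al (lam * expR (- (al * y))) b x t.
Proof.
have e m : cexp (m * (x + y)) (m * t) = cexp (m * x) (m * t) * (expR (m * y))%:C%C.
  by rewrite -cexp_real -cexpD addr0 mulrDr.
rewrite /Psi e.
have -> : den al lam (x + y) t = den al (lam * expR (- (al * y))) x t * (expR (al * y))%:C%C.
  rewrite /den e mulrDl; congr (_ + _); rewrite -rmorphM /=; congr (_%:C%C).
  by rewrite -mulrA [X in _ * X]mulrC expRxMexpNx_1 mulr1.
rewrite invfM mulrBl expRD expRN rmorphM fmorphV.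
have := lt0r_neq0 (expR_gt0 (al * y)); rewrite -(fmorph_eq0 (real_complex R)) /= => h.
by ring.
Qed.

(** Translating by ln s moves the pole from z = s to z = 1, where the sector identity applies with
    lam s^(-al) in place of lam. *)
Lemma laplace_mode_sol al a lam s : 0 <= al -> 0 < lam -> al * q < pi -> -1 < a -> a < al -> 0 < s ->
  L1 (fun t => expR (- s * t) * pos_part (mode_sol al a lam) t) /\
  I (fun t => expR (- s * t) * pos_part (mode_sol al a lam) t) = s `^ a / (s `^ al + lam).
Proof.
move=> al0 lam0 alq a1 aal s0.
have [Li ->] := laplace_mode_sol_line al0 lam0 alq a1 aal s0; split => //.
have ls0 : 0 < lam * expR (- (al * ln s)) by rewrite mulr_gt0 ?expR_gt0.
have th_itv' : 0 < th < q by rewrite th_gt0.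
have [L2 E2] := L1_Im_sector_integrand al0 ls0 q_gt0 q_lt alq a1 aal th_itv'.
pose f x := s `^ (a - al) * Im (sector_integrand al (lam * expR (- (al * ln s))) a x th).
have fi : L1 f by exact: L1Z.
rewrite (eq_I (g := fun x => f (x + - ln s))).
  rewrite Rintegral_translation// IZ// E2 /f.
  have -> : expR (- (al * ln s)) = (s `^ al)^-1 by rewrite expRN /powR gt_eqF.
  have -> : s `^ (a - al) = s `^ a / s `^ al by rewrite /powR gt_eqF// mulrBl expRD expRN.
  have h1 : s `^ al != 0 by rewrite gt_eqF// powR_gt0.
  have h2 : s `^ al + lam != 0 by rewrite gt_eqF// addr_gt0// powR_gt0.
  have h3 : pi != 0 :> R by exact: lt0r_neq0 (pi_gt0 R).
  by move: (s `^ a) (s `^ al) (pi : R) h1 h2 h3 => A L p h1 h2 h3; field; rewrite h2 h1 h3.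
move=> x; rewrite /f /sector_integrand -[in LHS](subrK (ln s) x).
move: (x - ln s) => y; rewrite Psi_shift.
have ImZ (r : R) w : Im (r%:C%C * w) = r * Im w by case: w => u v /=; rewrite mul0r addr0.
have -> : s%:C%C - cexp (y + ln s) th = s%:C%C * (1 - cexp (1 * y) (1 * th)).
  rewrite -[X in cexp _ X]addr0 cexpD cexp_real lnK ?posrE// !mul1r mulrBr mulr1; ring.
rewrite invfM mulrACA -fmorphV -rmorphM ImZ /powR gt_eqF//; congr (_ * _).
have -> : (a + 1 - al) * ln s = (a - al) * ln s + ln s by ring.
by rewrite expRD lnK ?posrE// mulfK ?gt_eqF.
Qed.

Lemma mode_sol_scale al a lam t : 0 <= al -> 0 < lam -> al * q < pi -> -1 < a -> 0 < t ->
  mode_sol al a lam t = t `^ (al - a - 1) * mode_sol al a (lam * t `^ al) 1.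
Proof.
move=> al0 lam0 alq a1 t0; have b0 : 0 < a + 1 by rewrite -ltrBlDr sub0r.
have lt0 : 0 < lam * t `^ al by rewrite mulr_gt0// powR_gt0.
rewrite /mode_sol mulrCA; congr (_ * _).
pose g x := t `^ (al - a - 1) * hankel_integrand th (fun x => Psi al (lam * t `^ al) (a + 1) x th) 1 x.
have gi : L1 g by apply: L1Z; exact: L1_hankel_Psi.
rewrite -IZ; last exact: L1_hankel_Psi.
rewrite -(Rintegral_translation (ln t) gi); apply: eq_I => x.
have ImZ (r : R) w : Im (r%:C%C * w) = r * Im w by case: w => u v /=; rewrite mul0r addr0.
rewrite /g /hankel_integrand -ImZ [X in _ = Im X]mulrCA -[in LHS](addrK (ln t) x); congr (Im (_ * _)).
  rewrite /ray_exp addrK expRD lnK ?posrE//; congr cexp; ring.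
have e1 : expR ((a + 1 - al) * - ln t) = t `^ (al - a - 1).
  by rewrite /powR gt_eqF//; congr expR; ring.
have e2 : expR (- (al * - ln t)) = t `^ al by rewrite /powR gt_eqF//; congr expR; ring.
by rewrite (Psi_shift al lam (a + 1) (x + ln t) (- ln t) th) e1 e2.
Qed.

Lemma hankel_integrand_cexp m x : hankel_integrand th (fun x => cexp (m * x) (m * th)) 1 x =
  expR (expR x * cos th + m * x) * sin (expR x * sin th + m * th).
Proof. by rewrite /hankel_integrand /ray_exp -cexpD !mul1r. Qed.

Lemma L1_hankel_pow m : 0 < m -> L1 (hankel_integrand th (fun x => cexp (m * x) (m * th)) 1).
Proof.
move=> m0; apply: (L1_hankel_cexp (al := 0) (lam := 1)) => //.
by rewrite mul0r pi_gt0.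
Qed.

(** Integration by parts: (z + m) e^z z^m is the w-derivative of e^z z^m, whose imaginary part
    vanishes at both ends. This includes m = 0, where e^z tends to 1 at - oo; it produces the zero
    of 1 / Gamma at 0. *)
Lemma hankel_pow_rec m : 0 <= m -> hankel_pow (m + 1) = - m * hankel_pow m.
Proof.
move=> m0; have m1 : 0 < m + 1 by rewrite ltr_wpDl.
pose h n := hankel_integrand th (fun x => cexp (n * x) (n * th)) 1.
have i1 : L1 (h (m + 1)) by exact: L1_hankel_pow.
have i2 : L1 (fun x => m * h m x) /\ I (fun x => m * h m x) = m * I (h m).
  have [->|mn0] := eqVneq m 0.
    rewrite mul0r (_ : (fun x => 0 * h 0 x) = cst 0); last by apply/funext => x; rewrite mul0r.
    by split; [exact: integrable0|rewrite /Rintegral integral0].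
  have i : L1 (h m) by apply: L1_hankel_pow; rewrite lt_neqAle eq_sym mn0.
  by split; [exact: L1Z|exact: IZ].
suff : I (fun x => h (m + 1) x + m * h m x) = 0 - 0.
  rewrite ID//; last exact: i2.1.
  rewrite i2.2 subr0 /hankel_pow -/(h _) -/(h _) => /eqP; rewrite addr_eq0 => /eqP ->; ring.
have fE x : h (m + 1) x + m * h m x = expR (expR x * cos th + m * x) *
   ((expR x * cos th + m) * sin (expR x * sin th + m * th) +
    cos (expR x * sin th + m * th) * (expR x * sin th)).
  rewrite /h !hankel_integrand_cexp.
  rewrite (_ : expR x * cos th + (m + 1) * x = expR x * cos th + m * x + x); last by ring.
  rewrite (_ : expR x * sin th + (m + 1) * th = expR x * sin th + m * th + th); last by ring.
  rewrite expRD sinD; ring.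
have cF (g : R -> R) (c1 c2 : R) : continuous g -> continuous (fun x => g (expR x * c1 + c2 * x)).
  move=> cg x; apply: (cvg_comp _ g); last exact: cg.
  by apply: cvgD; [apply: cvgMl; exact: continuous_expR|apply: cvgMr; exact: cvg_id].
have cF2 (g : R -> R) (c1 c2 : R) : continuous g -> continuous (fun x => g (expR x * c1 + c2)).
  move=> cg x; apply: (cvg_comp _ g); last exact: cg.
  by apply: cvgD; [apply: cvgMl; exact: continuous_expR|exact: cvg_cst].
rewrite (funext fE).
have [C C0 hC] := expR_double_exp_le m k0.
apply: (@continuous_FTC_line R (h m)).
- move=> x; rewrite /h (funext (hankel_integrand_cexp m)).
  apply: is_derive_eq; rewrite /GRing.scale /=; ring.
- move=> x; apply: cvgM; first exact: (cF expR _ _ (@continuous_expR R)).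
  apply: cvgD; apply: cvgM.
  + by apply: cvgD; [apply: cvgMl; exact: continuous_expR|exact: cvg_cst].
  + exact: (cF2 sin _ _ (@continuous_sin R)).
  + exact: (cF2 cos _ _ (@continuous_cos R)).
  + by apply: cvgMl; exact: continuous_expR.
- by rewrite -(funext fE); apply: L1D; [exact: i1|exact: i2.1].
- rewrite /h (funext (hankel_integrand_cexp m)).
  have [->|mn0] := eqVneq m 0.
    pose phi y := expR (y * cos th) * sin (y * sin th).
    have -> : (fun x => expR (expR x * cos th + 0 * x) * sin (expR x * sin th + 0 * th)) = phi \o expR.
      by apply/funext => x; rewrite /phi /= !mul0r !addr0.
    apply: (cvg_comp _ phi expR_cvgNy).
    have phi0 : phi 0 = 0 by rewrite /phi !mul0r sin0 mulr0.
    have cphi : phi y @[y --> (0 : R)] --> phi 0.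
      apply: cvgM.
        by apply: (cvg_comp _ expR); [apply: cvgMl; exact: cvg_id|exact: continuous_expR].
      by apply: (cvg_comp _ sin); [apply: cvgMl; exact: cvg_id|exact: continuous_sin].
    by rewrite phi0 in cphi.
  have mp : 0 < m by rewrite lt_neqAle eq_sym mn0.
  have h0 : expR (m * x) @[x --> -oo] --> 0.
    apply: (@cvg_comp _ _ _ (fun x => m * x) expR _ -oo); last exact: expR_cvgNy.
    by apply: gt0_cvgMrNy => //; exact: cvg_id.
  apply/norm_cvg0P; apply: (squeeze_cvgr _ (cvg_cst 0) h0); near=> x.
  rewrite normr_ge0 normrM ger0_norm ?expR_ge0//= expRD mulrAC -[leRHS]mul1r.
  rewrite ler_wpM2r ?expR_ge0// -[leRHS]mul1r ler_pM ?expR_ge0 ?sin_max//.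
  rewrite -[leRHS]expR0 ler_expR pmulr_rle0 ?expR_gt0// ltW//; exact: cos_th_lt0.
- rewrite /h (funext (hankel_integrand_cexp m)).
  have h0 : C * expR (- x) @[x --> +oo] --> 0.
    rewrite -(mulr0 C); apply: cvgMr; exact: cvgr_expR.
  apply/norm_cvg0P; apply: (squeeze_cvgr _ (cvg_cst 0) h0); near=> x.
  have x0 : 0 <= x by near: x; exact: nbhs_pinfty_ge.
  rewrite normr_ge0 (le_trans _ (hC _ x0))// normrM ger0_norm ?expR_ge0//.
  rewrite -[leRHS]mulr1 ler_pM ?expR_ge0 ?sin_max// ler_expR /k; lra.
Unshelve. all: by end_near. Qed.

(** For al = 0 and lam = 1 the denominator is the constant 2, and the transform already known, taken
    at s = 1, evaluates the Hankel integral without a further contour argument. *)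
Lemma hankel_pow_base m : 0 < m < 1 -> hankel_pow m = (Gamma (1 - m))^-1.
Proof.
move=> /andP[m0 m1]; have nu0 : 0 < 1 - m by rewrite subr_gt0.
have q' : 0 * q < pi by rewrite mul0r pi_gt0.
have a1 : -1 < m - 1 by rewrite ltrBrDr addrC subrr.
have a0 : m - 1 < 0 by rewrite subr_lt0.
have [_] := laplace_mode_sol (lexx 0) ltr01 q' a1 a0 ltr01.
have G0 := Gamma_gt0 nu0.
rewrite (eq_I (g := fun t => (Gamma (1 - m) * hankel_pow m / 2) * (expR (- 1 * t) * kap (1 - m) t))).
  rewrite IZ ?laplace_kap ?L1_kap// !powR1 mulr1 => e; apply: (mulfI (lt0r_neq0 G0)); rewrite divff ?lt0r_neq0//.
  by move: e; rewrite (_ : 1 + 1 = 2 :> R)//; lra.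
move=> t; rewrite pos_partE; case: ltP => t0; last by rewrite kap_eq0// !mulr0.
rewrite kap_posE// mode_sol_scale//.
have -> : mode_sol 0 (m - 1) (1 * t `^ 0) 1 = hankel_pow m / 2.
  (* With al = 0 the remainder is the function itself: S = [hankel_pow th m] - S. *)
  have := mode_sol_expansion (lexx 0) ltr01 q' a1.
  rewrite powRr0 !mulr1 mul1r addr0 subrK; lra.
rewrite (_ : 0 - (m - 1) - 1 = 1 - m - 1); last by ring.
by field; rewrite lt0r_neq0.
Qed.

End Mittag_Leffler.

(** * The recurrence of Gamma and Hankel's formula *)

Section reciprocal_Gamma.
Context {R : realType}.

(** The product for x has exactly one more factor than the one for x + 1 while Euler's integral is
    taken at the same point. At negative integers both sides are 0. *)
Lemma Gamma_rec (x : R) : x < 0 -> Gamma x = Gamma (x + 1) / x.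
Proof.
move=> x0; have [x1|x1] := ltP 0 (x + 1).
  rewrite [LHS]/Gamma ltNge (ltW x0)/= (_ : Num.floor (- x) = 0)/=.
    by rewrite big_ord1 addr0 /Gamma x1.
  by apply: floor_def; rewrite add0r; apply/andP; split; lra.
rewrite /Gamma [in LHS]ltNge (ltW x0)/= ltNge x1/=.
have fx : Num.floor (- x) = Num.floor (- (x + 1)) + 1.
  apply: floor_def; have := floor_itv (- (x + 1)); rewrite !rmorphD /=; lra.
have f0 : 0 <= Num.floor (- (x + 1)) by rewrite floor_ge0 oppr_ge0.
have -> : `|Num.floor (- x)|%N = `|Num.floor (- (x + 1))|.+1.
  by rewrite fx; case: (Num.floor _) f0 => // n _; rewrite -PoszD absz_nat addn1.
rewrite big_ord_recl/= addr0; set k := `|_|%N.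
have -> : x + k.+2%:R = x + 1 + k.+1%:R by rewrite -[k.+2]addn1 natrD; ring.
rewrite (eq_bigr (fun i : 'I_k.+1 => x + 1 + i%:R)); last first.
  by move=> i _; rewrite /bump /= natrD; ring.
by rewrite invfM; ring.
Qed.

Lemma Gamma0 : Gamma (0 : R) = 0.
Proof.
by rewrite /Gamma ltxx oppr0 floor0/= big_ord1 addr0 invr0 mulr0.
Qed.

End reciprocal_Gamma.

Section Hankel_formula.
Context {R : realType}.
Variables (th q : R).
Hypothesis th_gt : pi / 2 < th.
Hypothesis thq : th < q.
Hypothesis q_lt : q < pi.

(** Induction on an integer bound for m: the recurrence lowers m by 1 until it lies in ]0, 1[ or
    equals 1, where both sides are 0. *)
Lemma hankel_powE m : 0 < m -> hankel_pow th m = (Gamma (1 - m))^-1.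
Proof.
move=> m0; have [n mn] : exists n : nat, m <= n%:R.
  by exists (Num.trunc m).+1; rewrite ltW// truncnS_gt.
elim: n m m0 mn => [|n ih] m m0 mn; first by have := lt_le_trans m0 mn; rewrite ltxx.
have [m1|m1|->] := ltgtP m 1.
- by apply: (hankel_pow_base th_gt thq q_lt); rewrite m0.
- have m10 : 0 < m - 1 by rewrite subr_gt0.
  rewrite -[in LHS](subrK 1 m) (hankel_pow_rec th_gt thq q_lt (ltW m10)) ih//; last first.
    by rewrite lerBlDr -natr1 in mn *.
  rewrite (Gamma_rec (x := 1 - m)) ?subr_lt0//.
  by rewrite invfM invrK (_ : 1 - (m - 1) = 1 - m + 1); ring.
- rewrite subrr Gamma0 invr0 -[in LHS](add0r 1).
  by rewrite (hankel_pow_rec th_gt thq q_lt (lexx 0)) oppr0 mul0r.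
Qed.

End Hankel_formula.

(** * Solutions of the fractional equations *)

Section fractional_integrals.
Context {R : realType}.
Notation mu := (@lebesgue_measure R).
Implicit Types f g F : R -> R.

Definition loc_integrable f := forall T, 0 < T -> mu.-integrable `]0, T[ (EFin \o f).

Lemma RL_integral1E f t : RL_integral 1 f t = \int[mu]_(z in `]0, t[) f z.
Proof.
rewrite /RL_integral oner_eq0 Gamma1 invr1 mul1r; apply: eq_Rintegral => z _.
by rewrite subrr powRr0 mulr1.
Qed.

Lemma is_derive_RL_integral1 f t : loc_integrable f -> 0 < t -> {for t, continuous f} ->
  is_derive t (1 : R) (RL_integral 1 f) (f t).
Proof.
move=> fi t0 cf.
have i T : 0 < T -> mu.-integrable `]0, T] (EFin \o f).
  move=> T0; have Tp : 0 < T + 1 by rewrite addr_gt0.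
  apply: integrableS (fi _ Tp) => //; apply: subset_itvl; rewrite bnd_simp ltrDl//.
have t1 : t < t + 1 by rewrite ltrDl.
have tp1 : 0 < t + 1 by exact: lt_trans t1.
have [] := @continuous_FTC1 R f (BRight 0) t (t + 1) t1 (i _ tp1) t0 cf.
set F := fun x => _ => dF F'.
have e : \forall x \near t, F x = RL_integral 1 f x.
  near=> x; rewrite RL_integral1E Rintegral_itv_bndo_bndc//; apply: fi.
  by near: x; exact: lt_nbhsr.
split; first exact: near_eq_derivable dF.
by rewrite -(near_eq_derive _ e) -F' derive1E.
Unshelve. all: by end_near. Qed.

Lemma RL_integral1_cvg0 f : loc_integrable f ->
  RL_integral 1 f n.+1%:R^-1 @[n --> \oo] --> 0.
Proof.
move=> fi; have f1 := L1_restrict_itv (fi 1 ltr01).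
have n1 (n : nat) : n.+1%:R^-1 <= 1 :> R by rewrite invf_le1// ler1n.
have [|||||_ c1] := @Rintegral_dominated_cvg R (fun n => f \_ `]0, n.+1%:R^-1[) (cst 0)
   (fun x => `|(f \_ `]0, 1[) x|) 0.
- move=> n; apply: L1_measurable; apply: L1_restrict_itv; by apply: fi; rewrite invr_gt0.
- exact: measurable_cst.
- exact: integrable_norm f1.
- move=> n x; rewrite !patchE !mem_setE !in_itv/=; case: ltP => //= x0; case: ltP => [xn|_].
    by rewrite (lt_le_trans xn (n1 n)).
  by rewrite -[X in `|X| <= _]/(0 : R) normr0.
- move=> x _; have [x0|x0] := leP x 0.
    by apply: cvg_near_cst; apply: nearW => n; rewrite patchE mem_setE in_itv/= ltNge x0.
  apply: cvg_near_cst; near=> n; rewrite patchE mem_setE in_itv/= x0/= ltNge ltW//.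
  rewrite invf_plt ?posrE//; apply: (@lt_trans _ _ n%:R); last by rewrite ltr_nat.
  by near: n; exact: nbhs_infty_gtr.
rewrite (_ : (fun n => _) = fun n : nat => I (f \_ `]0, n.+1%:R^-1[)); last first.
  by apply/funext => n; rewrite RL_integral1E Rintegral_mkcond.
by move: c1; rewrite [X in _ --> X](_ : _ = 0)//; rewrite /Rintegral integral0.
Unshelve. all: by end_near. Qed.

Lemma derive0_half_line F : (forall t : R, 0 < t -> is_derive t (1 : R) F 0) ->
  forall s t : R, 0 < s -> 0 < t -> F s = F t.
Proof.
move=> dF.
suff h (s t : R) : 0 < s -> s <= t -> F s = F t.
  by move=> s t s0 t0; have [st|/ltW ts] := leP s t; [exact: h|rewrite (h t s)].
move=> s0 st.
have cF (x : R) : 0 < x -> {for x, continuous F}.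
  by move=> x0; apply: differentiable_continuous; apply/derivable1_diffP; have [] := dF _ x0.
have dFI z : z \in `]s, t[%R -> is_derive z (1 : R) F 0.
  by rewrite in_itv/= => /andP[sz _]; apply: dF; exact: lt_trans sz.
have [|c _] := @MVT_segment R F (cst 0) s t st dFI.
  apply: continuous_in_subspaceT => x; rewrite inE/= in_itv/= => /andP[sx _].
  by apply: cF; exact: lt_le_trans sx.
by rewrite /= mul0r => /eqP; rewrite subr_eq0 => /eqP.
Qed.

(** F and g are controlled only for t > 0, and g may be unbounded at 0; the constant F - J g is
    evaluated along t = 1 / (n + 1). *)
Lemma Taylor1 F g A : loc_integrable g -> (forall t : R, 0 < t -> {for t, continuous g}) ->
  (forall t : R, 0 < t -> is_derive t (1 : R) F (g t)) -> F t @[t --> 0^'+] --> A ->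
  forall t : R, 0 < t -> F t = A + RL_integral 1 g t.
Proof.
move=> gi cg dF FA t t0.
pose D t := F t - RL_integral 1 g t.
have dD (s : R) : 0 < s -> is_derive s (1 : R) D 0.
  move=> s0; have d1 := dF s s0; have d2 := is_derive_RL_integral1 gi s0 (cg s s0).
  by rewrite -(subrr (g s)); exact: is_deriveB.
have DE n : D n.+1%:R^-1 = D t by apply: derive0_half_line => //; rewrite invr_gt0.
suff e : D t = A by rewrite -e /D subrK.
have c : D n.+1%:R^-1 @[n --> \oo] --> A - 0.
  apply: cvgB; last exact: RL_integral1_cvg0.
  move/cvg_at_rightP : FA; apply; split; first by move=> n; rewrite invr_gt0.
  exact: cvg_harmonic.
rewrite subr0 (funext DE) in c.
by apply: cvg_unique (cvg_cst _) c.
Qed.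

End fractional_integrals.

Section fractional_integrals_of_bounded_functions.
Context {R : realType}.
Notation mu := (@lebesgue_measure R).
Implicit Types f g F : R -> R.

Definition bounded_measurable f (T : R) :=
  measurable_fun `]0, T[%classic f /\ exists M, forall z, 0 < z < T -> `|f z| <= M.

Lemma L1_bounded_kap f nu t : 0 < nu -> bounded_measurable f t ->
  L1 (fun z => (f \_ `]0, t[) z * kap nu (t - z)).
Proof.
move=> nu0 [mf [M fM]].
apply: (L1_dominated _ (L1Z M (L1_kap_kap ltr01 nu0 t))).
  apply: measurable_conv_integrand; last exact: measurable_kap.
  by apply/(measurable_restrictT f (measurable_itv _)).
move=> z; have [z0|z0] := leP z 0.
  have -> : (f \_ `]0, t[) z = 0 by rewrite patchE mem_setE in_itv/= ltNge z0.
  by rewrite mul0r normr0 (kap_eq0 _ z0) mul0r mulr0.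
rewrite patchE mem_setE in_itv/= kap1 pos_partE z0/=.
case: ltP => zt; last by rewrite kap_eq0 ?subr_le0// !mulr0 normr0.
rewrite mul1r normrM (ger0_norm (kap_ge0 _ nu0)) ler_wpM2r ?kap_ge0//.
by rewrite fM// z0.
Qed.

Lemma bounded_loc_integrable f : (forall T, 0 < T -> bounded_measurable f T) -> loc_integrable f.
Proof.
move=> fb T T0; have [mf [M fM]] := fb T T0.
have Tp : 0 < T + 1 by rewrite addr_gt0.
apply: measurable_bounded_integrable => //.
  by rewrite /= lebesgue_measure_itv/= lte_fin T0 -EFinB ltry.
exists M; split; first exact: num_real.
move=> x Mx z /=; rewrite in_itv/= => zT; exact: le_trans (fM z zT) (ltW Mx).
Qed.

Lemma bounded_measurableD f g t : bounded_measurable f t -> bounded_measurable g t ->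
  bounded_measurable (fun z => f z + g z) t.
Proof.
move=> [mf [M fM]] [mg [N gN]]; split; first exact: measurable_funD.
by exists (M + N) => z zt; rewrite (le_trans (ler_normD _ _))// lerD ?fM ?gN.
Qed.

Lemma bounded_measurableZ k f t : bounded_measurable f t ->
  bounded_measurable (fun z => k * f z) t.
Proof.
move=> [mf [M fM]]; split; first by apply: measurable_funM => //; exact: measurable_cst.
by exists (`|k| * M) => z zt; rewrite normrM ler_wpM2l// fM.
Qed.

Lemma RL_integralD nu f g t : 0 < nu -> 0 < t ->
  bounded_measurable f t -> bounded_measurable g t ->
  RL_integral nu (fun z => f z + g z) t = RL_integral nu f t + RL_integral nu g t.
Proof.
move=> nu0 t0 bf bg; have [mf _] := bf; have [mg _] := bg.
have [mfg _] := bounded_measurableD bf bg.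
rewrite !(RL_integralE nu0 t0 (lexx t))// /convolution -ID; try exact: L1_bounded_kap.
by apply: eq_I => z; rewrite !patchE; case: ifP => _; [ring|rewrite -[point]/(0 : R); ring].
Qed.

Lemma RL_integralZ nu k f t : 0 < nu -> 0 < t -> bounded_measurable f t ->
  RL_integral nu (fun z => k * f z) t = k * RL_integral nu f t.
Proof.
move=> nu0 t0 bf; have [mf _] := bf; have [mkf _] := bounded_measurableZ k bf.
rewrite !(RL_integralE nu0 t0 (lexx t))// /convolution -IZ; last exact: L1_bounded_kap.
by apply: eq_I => z; rewrite !patchE; case: ifP => _; [ring|rewrite -[point]/(0 : R); ring].
Qed.

Lemma RL_integral_kap (nu n t : R) : 0 < nu -> 0 < n -> 0 < t ->
  RL_integral nu (kap n) t = kap (n + nu) t.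
Proof.
move=> nu0 n0 t0; rewrite (RL_integralE nu0 t0 (lexx t)); last by apply: measurable_funTS; exact: measurable_kap.
rewrite conv_kap_restrict// -conv_kap_kap//; apply: eq_I => z; congr (_ * _).
by rewrite pos_partE; case: ltP => // z0; rewrite kap_eq0.
Qed.

Lemma bounded_kap (n t : R) : 1 <= n -> bounded_measurable (kap n) t.
Proof.
move=> n1; split; first by apply: measurable_funTS; exact: measurable_kap.
exists (`|t| `^ (n - 1) / Gamma n) => z /andP[z0 zt].
have n0 : 0 < n by exact: lt_le_trans n1.
rewrite ger0_norm ?kap_ge0//; have tz : 0 < t - z by rewrite subr_gt0.
by have := kap_le t n1 tz; rewrite subKr.
Qed.

(** The restriction n >= 1 is what keeps the kernel bounded; this is why the mode equation is
    integrated once more before it is solved. *)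
Lemma bounded_RL_integral n f t : 1 <= n -> loc_integrable f ->
  bounded_measurable (RL_integral n f) t.
Proof.
move=> n1 fi; have n0 : 0 < n by exact: lt_le_trans n1.
have [t0|t0] := leP t 0.
  split; last by exists 0 => z /andP[z0 zt]; have := lt_le_trans (lt_trans z0 zt) t0; rewrite ltxx.
  rewrite (_ : `]0, t[%classic = set0); first exact: measurable_fun_set0.
  by apply/seteqP; split => z //=; rewrite in_itv/= => /andP[z0 zt]; have := lt_le_trans (lt_trans z0 zt) t0; rewrite ltxx.
have ft := L1_restrict_itv (fi t t0).
have f0 z : z <= 0 -> (f \_ `]0, t[) z = 0 by move=> z0; rewrite patchE mem_setE in_itv/= ltNge z0.
have mf : measurable_fun `]0, t[%classic f by have /integrableP[/measurable_EFinP] := fi t t0.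
have e z : 0 < z < t -> RL_integral n f z = convolution (f \_ `]0, t[) (kap n) z.
  by move=> /andP[z0 zt]; apply: RL_integralE => //; exact: ltW.
split.
  apply: (eq_measurable_fun (convolution (f \_ `]0, t[) (kap n))).
    by move=> z; rewrite inE/= in_itv/= => zt; rewrite e.
  by apply: measurable_funTS; exact: measurable_conv_kap.
exists (t `^ (n - 1) / Gamma n * I (fun w => `|(f \_ `]0, t[) w|)) => z zt.
have ni := integrable_norm ft.
rewrite e// -IZ//; apply: Rintegral_norm_le.
- by apply: measurable_conv_integrand; [exact: L1_measurable|exact: measurable_kap].
- exact: L1Z.
move=> w; have [w0|w0] := leP w 0; first by rewrite f0// mul0r normr0 mulr0.
rewrite normrM mulrC ler_wpM2r//= ger0_norm ?kap_ge0//.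
case/andP: zt => z0 zt; apply: (le_trans (kap_le z n1 w0)).
rewrite ler_wpM2r ?invr_ge0 ?(ltW (Gamma_gt0 n0))// gtr0_norm//.
by rewrite ge0_ler_powR ?subr_ge0 ?nnegrE// ltW.
Qed.

(** Applies J^nu to a Taylor expansion term by term; [kap 1] and [kap 2] are 1 and t on the
    half-line, with the initial data A and B as coefficients. *)
Lemma RL_integral_expand (nu m : R) F g (A B : R) : 0 < nu -> 1 <= m -> loc_integrable g ->
  (forall t, 0 < t -> F t = A * kap 1 t + B * kap 2 t + RL_integral m g t) ->
  forall t, 0 < t -> RL_integral nu F t =
    A * kap (1 + nu) t + B * kap (2 + nu) t + RL_integral (m + nu) g t.
Proof.
move=> nu0 m1 gi FE t t0; have m0 : 0 < m by exact: lt_le_trans m1.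
rewrite (RL_integral_eq (g := fun t => (A * kap 1 t + B * kap 2 t) + RL_integral m g t)); last 2 first.
- exact: lt0r_neq0.
- by move=> z /andP[z0 _]; rewrite FE.
have b1 : bounded_measurable (kap 1) t by exact: bounded_kap.
have b2 : bounded_measurable (kap 2) t by apply: bounded_kap; rewrite ler1n.
have bg : bounded_measurable (RL_integral m g) t by exact: bounded_RL_integral.
have a1 := bounded_measurableZ A b1; have a2 := bounded_measurableZ B b2.
rewrite (RL_integralD nu0 t0 (bounded_measurableD a1 a2) bg).
rewrite (RL_integralD nu0 t0 a1 a2) (RL_integralZ A nu0 t0 b1) (RL_integralZ B nu0 t0 b2).
rewrite (RL_integral_kap nu0 ltr01 t0) (RL_integral_kap nu0 (ltr0Sn R 1) t0).
rewrite RL_integral_RL//; last exact: gi.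
by rewrite (le_trans m1)// lerDl ltW.
Qed.

Lemma Taylor2 F dF g (A B : R) : loc_integrable g -> (forall t : R, 0 < t -> {for t, continuous g}) ->
  (forall t : R, 0 < t -> is_derive t (1 : R) F (dF t)) ->
  (forall t : R, 0 < t -> is_derive t (1 : R) dF (g t)) ->
  F t @[t --> 0^'+] --> A -> dF t @[t --> 0^'+] --> B ->
  forall t : R, 0 < t -> F t = A * kap 1 t + B * kap 2 t + RL_integral 2 g t.
Proof.
move=> gi cg D1 D2 FA FB t t0.
have dFE s : 0 < s -> dF s = B * kap 1 s + 0 * kap 2 s + RL_integral 1 g s.
  by move=> s0; rewrite (Taylor1 gi cg D2 FB s0) kap1 pos_partE s0 mul0r addr0 mulr1.
have cdF s : 0 < s -> {for s, continuous dF}.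
  by move=> s0; apply: differentiable_continuous; apply/derivable1_diffP; have [] := D2 s s0.
have dFi : loc_integrable dF.
  apply: bounded_loc_integrable => T T0.
  have [m1 [M hM]] := bounded_measurableD (bounded_measurableZ B (bounded_kap T (lexx 1))) (bounded_RL_integral T (lexx 1) gi).
  have e z : 0 < z < T -> dF z = B * kap 1 z + RL_integral 1 g z.
    by move=> /andP[z0 _]; rewrite dFE// mul0r addr0.
  split; last by exists M => z zT; rewrite e// hM.
  by apply: eq_measurable_fun m1 => z; rewrite inE/= in_itv/= => zT; rewrite e.
rewrite (Taylor1 dFi cdF D1 FA t0) (RL_integral_expand ltr01 (lexx 1) gi dFE t0).
by rewrite kap1 pos_partE t0 mul0r addr0 mulr1 addrA.
Qed.

End fractional_integrals_of_bounded_functions.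

Lemma is_derive_continuous {R : realType} (F : R -> R) d (t : R) : is_derive t (1 : R) F d -> {for t, continuous F}.
Proof. by move=> [h _]; apply: differentiable_continuous; apply/derivable1_diffP. Qed.

(** * Identification of a mode with a multiple of [mode_sol] *)

Section integrated_mode_equation.
Context {R : realType}.
Notation mu := (@lebesgue_measure R).
Variables (th q : R).
Hypothesis th_gt : pi / 2 < th.
Hypothesis thq : th < q.
Hypothesis q_lt : q < pi.
Variables (al be lam c : R) (y : R -> R).
Hypothesis al_gt0 : 0 < al.
Hypothesis alq : al * q < pi.
Hypothesis be_gt0 : 0 < be.
Hypothesis be_lt : be < al + 1.
Hypothesis lam_gt0 : 0 < lam.
Hypothesis cy : forall t : R, 0 < t -> {for t, continuous y}.
Hypothesis yi : loc_integrable y.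
Hypothesis equation : forall t : R, 0 < t ->
  RL_integral 1 y t + lam * RL_integral (al + 1) y t = c * kap (be + 1) t.

Let Y := RL_integral 1 y.
(** be will be 1, 2, al and al - 1 in the four cases; 0 < be < al + 1 says that a = al - be
    satisfies -1 < a < al, the range of [laplace_mode_sol]. *)
Let e := mode_sol th al (al - be) lam.

Let a_gt : -1 < al - be. Proof. by have := be_lt; lra. Qed.
Let a_lt : al - be < al. Proof. by have := be_gt0; lra. Qed.

Let ce (t : R) : 0 < t -> {for t, continuous e}.
Proof. by move=> t0; exact: (continuous_mode_sol th_gt thq q_lt (ltW al_gt0) lam_gt0 alq a_gt t0). Qed.

(** Read off from the Laplace integrability at s = 1, as e^(-t) >= e^(-T) on ]0, T[. *)
Let ei : loc_integrable e.
Proof.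
move=> T T0.
have [Li _] := laplace_mode_sol th_gt thq q_lt (ltW al_gt0) lam_gt0 alq a_gt a_lt ltr01.
have Li2 := L1_restrict (measurable_itv `]0, T[) Li.
have me : measurable_fun `]0, T[%classic e.
  apply: open_continuous_measurable_fun; first exact: interval_open.
  move=> x; rewrite inE/= in_itv/= => /andP[x0 _].
  exact: ce.
have : L1 (e \_ `]0, T[).
  apply: (L1_dominated _ (L1Z (expR T) (integrable_norm Li2))).
    by apply/(measurable_restrictT e (measurable_itv _)).
  move=> t /=; rewrite !patchE; case: ifPn => [|_]; last first.
    by rewrite -[X in `|X|]/(0 : R) -[X in _ * `|X|]/(0 : R) normr0 mulr0.
  rewrite inE/= in_itv/= => /andP[t0 tT]; rewrite pos_partE t0 [X in _ <= _ * X]normrM (ger0_norm (expR_ge0 _)).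
  by rewrite mulrA -expRD ler_peMl// -[leLHS]expR0 ler_expR; lra.
by rewrite -restrict_EFin => h; apply/(integrable_mkcond (mu := mu) (EFin \o e) (measurable_itv `]0, T[)).
Qed.

Let cY (t : R) : 0 < t -> {for t, continuous Y}.
Proof. by move=> t0; apply: (is_derive_continuous (is_derive_RL_integral1 yi t0 (cy t0))). Qed.

Let mpY : measurable_fun setT (pos_part Y).
Proof.
apply/(measurable_restrictT Y (measurable_itv _)).
apply: open_continuous_measurable_fun; first exact: interval_open.
by move=> x; rewrite inE/= in_itv/= andbT; exact: cY.
Qed.

Let laplace_J1 s : 0 < s ->
  L1 (fun t => expR (- s * t) * pos_part (RL_integral 1 e) t) /\
  I (fun t => expR (- s * t) * pos_part (RL_integral 1 e) t) =
    s `^ (al - be) / (s `^ al + lam) * s `^ (- 1).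
Proof.
move=> s0.
have [Li Le] := laplace_mode_sol th_gt thq q_lt (ltW al_gt0) lam_gt0 alq a_gt a_lt s0.
have [ci cE] := conv_L1 Li (L1_kap ltr01 s0).
have mpe : measurable_fun setT (pos_part e).
  apply/(measurable_restrictT e (measurable_itv _)).
  apply: open_continuous_measurable_fun; first exact: interval_open.
  by move=> x; rewrite inE/= in_itv/= andbT; exact: ce.
have E t : convolution (fun z => expR (- s * z) * pos_part e z) (fun z => expR (- s * z) * kap 1 z) t =
   expR (- s * t) * pos_part (RL_integral 1 e) t.
  rewrite -(conv_expR s t mpe (measurable_kap 1)).
  congr (_ * _); rewrite pos_partE; case: ltP => t0.
    rewrite (RL_integralE ltr01 t0 (lexx t)) ?conv_kap_restrict//.
    by have /integrableP[/measurable_EFinP] := ei t0.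
  rewrite /convolution (eq_I (g := cst 0)); first by rewrite /Rintegral integral0.
  move=> z; rewrite pos_partE; case: ltP => z0; last by rewrite mul0r.
  by rewrite kap_eq0 ?mulr0// subr_le0 (le_trans t0)// ltW.
by rewrite (funext E) in ci cE; rewrite cE Le laplace_kap.
Qed.

(** J y and c J e share the transform c s^(- be - 1) / (1 + lam s^(-al)) and hence coincide; both
    are differentiable, and differentiation returns y = c e. *)
Lemma integrated_equation_unique : forall t, 0 < t -> y t = c * mode_sol th al (al - be) lam t.
Proof.
have be1 : 0 < be + 1 by rewrite addr_gt0.
have Yb T : 0 < T -> exists M, forall t, 0 < t < T -> `|Y t| <= M.
  by move=> T0; have [_] := bounded_RL_integral T (lexx 1) yi.
have Yeq t : 0 < t -> Y t + lam * RL_integral al Y t = c * kap (be + 1) t.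
  have al1 : 1 <= 1 + al by rewrite lerDl ltW.
  by move=> t0; rewrite -(equation t0) (addrC al 1) -(RL_integral_RL ltr01 al_gt0 al1 t0 (yi t0)).
have [s0 s00 hs] := Volterra_laplace al_gt0 be1 lam_gt0 mpY Yb Yeq.
pose H t := Y t - c * RL_integral 1 e t.
have cH t : 0 < t -> {for t, continuous H}.
  move=> t0; apply: cvgB; first exact: cY.
  by apply: cvgMr; apply: (is_derive_continuous (is_derive_RL_integral1 ei t0 (ce t0))).
have HI s : s0 <= s -> L1 (fun t => expR (- s * t) * pos_part H t) /\
     I (fun t => expR (- s * t) * pos_part H t) = 0.
  move=> ss; have sp : 0 < s by exact: lt_le_trans ss.
  have [i1 e1] := hs s ss; have [i2 e2] := laplace_J1 sp.
  have E t : expR (- s * t) * pos_part H t = expR (- s * t) * pos_part Y t +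
     - c * (expR (- s * t) * pos_part (RL_integral 1 e) t).
    by rewrite !pos_partE /H; case: ifP => _; ring.
  have i3 := L1Z (- c) i2.
  rewrite (funext E); split; first exact: L1D.
  rewrite (ID i1 i3) (IZ _ i2) e1 e2.
  have e3 : s `^ (- (be + 1)) = s `^ (al - be) * s `^ (- 1) * s `^ (- al).
    by rewrite -!powRD ?(gt_eqF sp) ?implybT//; congr (_ `^ _); ring.
  have e4 : s `^ (- al) = (s `^ al)^-1 by exact: powRN.
  have h1 : s `^ al != 0 by rewrite gt_eqF// powR_gt0.
  have h2 : s `^ al + lam != 0 by rewrite gt_eqF// addr_gt0// powR_gt0.
  rewrite e3 e4; move: (s `^ al) (s `^ (al - be)) (s `^ (- 1)) h1 h2 => A1 A2 A3 h1 h2.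
  by field; rewrite h1 h2.
move=> t t0.
have H0 := Laplace_transform_inj cH HI.
have d1 := is_derive_RL_integral1 yi t0 (cy t0).
have d2 := is_derive_RL_integral1 ei t0 (ce t0).
have d3 : is_derive t (1 : R) H (y t - c * e t).
  by apply: is_deriveB => //; exact: is_deriveZ.
have := @derive_val _ _ _ _ _ _ _ d3.
rewrite (near_eq_derive (g := cst 0)) ?derive_cst//; first by move=> /esym/eqP; rewrite subr_eq0 => /eqP.
by near=> x; rewrite /= H0//; near: x; exact: lt_nbhsr.
Unshelve. all: by end_near. Qed.

End integrated_mode_equation.

(** * Reduction of the four initial value problems to one integrated equation *)

Section mode_solutions.
Context {R : realType}.
Notation mu := (@lebesgue_measure R).
Implicit Types (y g F : R -> R).

Lemma ceiln1 (a : R) : 0 < a <= 1 -> ceiln a = 1%N.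
Proof. by move=> a01; rewrite /ceiln (_ : Num.ceil a = 1)//; apply: ceil_def; rewrite subrr. Qed.

Lemma ceiln2 (a : R) : 1 < a <= 2 -> ceiln a = 2%N.
Proof. by move=> a12; rewrite /ceiln (_ : Num.ceil a = 2)//; apply: ceil_def. Qed.

Lemma is_derive_derive1 F (t : R) : derivable F t 1 -> is_derive t (1 : R) F (F^`()%classic t).
Proof. by move=> dF; split => //; rewrite derive1E. Qed.

Lemma Taylor1_kap F g (A : R) : loc_integrable g -> (forall t : R, 0 < t -> {for t, continuous g}) ->
  (forall t : R, 0 < t -> is_derive t (1 : R) F (g t)) -> F t @[t --> 0^'+] --> A ->
  forall t : R, 0 < t -> F t = A * kap 1 t + 0 * kap 2 t + RL_integral 1 g t.
Proof.
move=> gi cg dF FA t t0.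
by rewrite (Taylor1 gi cg dF FA t0) kap1 pos_partE t0 mul0r addr0 mulr1.
Qed.

Lemma loc_integrableZ k g : loc_integrable g -> loc_integrable (fun z => k * g z).
Proof.
move=> gi T T0; have h := gi T T0.
have mI : measurable (`]0, T[%classic : set (measurableTypeR R)) by exact: measurable_itv.
by have := integrableZl mI k h; apply: eq_integrable.
Qed.

(** g is only locally integrable, so the factor is pulled out of J g first, which is locally
    bounded, and then out of J^al. *)
Lemma RL_integral_scale k g al t : loc_integrable g -> 0 < al -> 0 < t ->
  RL_integral (al + 1) (fun z => k * g z) t = k * RL_integral (al + 1) g t.
Proof.
move=> gi al0 t0; have al1 : 1 <= 1 + al by rewrite lerDl ltW.
rewrite (addrC al 1) -(RL_integral_RL ltr01 al0 al1 t0 (loc_integrableZ k gi t0)).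
rewrite -(RL_integral_RL ltr01 al0 al1 t0 (gi t t0)).
rewrite -(RL_integralZ k al0 t0 (bounded_RL_integral t (lexx 1) gi)).
apply: RL_integral_eq; first exact: lt0r_neq0.
move=> z /andP[z0 zt]; rewrite !RL_integral1E; apply: RintegralZl => //; exact: gi.
Qed.

Section integrated_equations.
Variables (al lam m A B : R) (y g : R -> R).
Hypothesis al_gt0 : 0 < al.
Hypothesis al_lt : al < m.
Hypothesis m_ge1 : 1 <= m.

Let mal : 0 < m - al. Proof. by rewrite subr_gt0. Qed.

(** Here g is the m-th derivative of y. Applying J^(al + 1) to the equation gives J^(m + 1) g = -
    lam J^(al + 1) y, and J of the Taylor expansion contains the same J^(m + 1) g; eliminating it
    removes every derivative. *)
Lemma integrated_Caputo : loc_integrable g ->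
  (forall t, 0 < t -> y t = A * kap 1 t + B * kap 2 t + RL_integral m g t) ->
  (forall t, 0 < t -> RL_integral (m - al) g t = - lam * y t) ->
  loc_integrable y /\
  forall t, 0 < t -> RL_integral 1 y t + lam * RL_integral (al + 1) y t = A * kap 2 t + B * kap 3 t.
Proof.
move=> gi yE eq.
have by_ T : 0 < T -> bounded_measurable y T.
  move=> T0; have b2 : (1 : R) <= 2 by rewrite ler1n.
  have [m1 [M hM]] := bounded_measurableD (bounded_measurableD
     (bounded_measurableZ A (bounded_kap T (lexx 1))) (bounded_measurableZ B (bounded_kap T b2)))
     (bounded_RL_integral T m_ge1 gi).
  split.
    by apply: eq_measurable_fun m1 => z; rewrite inE/= in_itv/= => /andP[z0 _]; rewrite yE.
  by exists M => z zT; have /andP[z0 _] := zT; rewrite yE// hM.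
split => [|t t0]; first exact: bounded_loc_integrable.
have al1 : 0 < al + 1 by rewrite addr_gt0.
have m1 : 1 <= m - al + (al + 1) by rewrite addrA subrK (le_trans m_ge1)// lerDl.
have e1 : - lam * RL_integral (al + 1) y t = RL_integral (m + 1) g t.
  rewrite -(RL_integralZ (- lam) al1 t0 (by_ t t0)).
  rewrite (_ : m + 1 = m - al + (al + 1)); last by ring.
  rewrite -(RL_integral_RL mal al1 m1 t0 (gi t t0)).
  apply: RL_integral_eq; first exact: lt0r_neq0.
  by move=> z /andP[z0 _]; rewrite -eq.
rewrite (RL_integral_expand ltr01 m_ge1 gi yE t0) -e1.
rewrite (_ : 1 + 1 = 2 :> R)// (_ : 2 + 1 = 3 :> R); last by rewrite -(natrD _ 2 1).
by ring.
Qed.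

(** Taylor's formula is applied to J^(m - al) y, whose m-th derivative is - lam y by the equation;
    J^(al + 1 - m) then turns the left-hand side into J y. *)
Lemma integrated_RL : loc_integrable y -> m < al + 1 ->
  (forall t, 0 < t -> RL_integral (m - al) y t =
     A * kap 1 t + B * kap 2 t + RL_integral m (fun z => - lam * y z) t) ->
  forall t, 0 < t -> RL_integral 1 y t + lam * RL_integral (al + 1) y t =
    A * kap (al + 2 - m) t + B * kap (al + 3 - m) t.
Proof.
move=> yi m_lt FE t t0; have nu0 : 0 < al + 1 - m by rewrite subr_gt0.
have := RL_integral_expand nu0 m_ge1 (loc_integrableZ (- lam) yi) FE t0.
have e1 : m - al + (al + 1 - m) = 1 by ring.
have h1 : 1 <= m - al + (al + 1 - m) by rewrite e1.
rewrite (RL_integral_RL mal nu0 h1 t0 (yi t t0)) e1 => ->.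
rewrite (_ : m + (al + 1 - m) = al + 1); last by ring.
rewrite (RL_integral_scale (- lam) yi al_gt0 t0).
rewrite (_ : 1 + (al + 1 - m) = al + 2 - m); last by ring.
rewrite (_ : 2 + (al + 1 - m) = al + 3 - m); last by ring.
by ring.
Qed.

End integrated_equations.

Section solutions.
Variables (th q : R).
Hypothesis th_gt : pi / 2 < th.
Hypothesis thq : th < q.
Hypothesis q_lt : q < pi.
Variables (al lam c : R) (y : R -> R).
Hypothesis alq : al * q < pi.
Hypothesis lam_gt0 : 0 < lam.

Let unique (be : R) : 0 < al -> 0 < be -> be < al + 1 ->
  (forall t : R, 0 < t -> {for t, continuous y}) -> loc_integrable y ->
  (forall t : R, 0 < t -> RL_integral 1 y t + lam * RL_integral (al + 1) y t = c * kap (be + 1) t) ->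
  forall t, 0 < t -> y t = c * mode_sol th al (al - be) lam t.
Proof. by move=> a0 b0 b1 cy yi eq; exact: (integrated_equation_unique th_gt thq q_lt a0 alq b0 b1 lam_gt0 cy yi eq). Qed.

Lemma mode_solution_Caputo_lt1 : 0 < al < 1 -> mode_solution Caputo al 0 1 lam c y ->
  forall t, 0 < t -> y t = c * mode_sol th al (al - 1) lam t.
Proof.
move=> /andP[a0 a1]; have ce : ceiln al = 1%N by rewrite ceiln1// a0 ltW.
have a0F : (al <= 0) = false by rewrite leNgt a0.
rewrite /mode_solution /frac_derivable /frac_deriv ce a0F lexx oppr0 => -[[du [cg gi]] eq ic _].
have D (t : R) : 0 < t -> is_derive t (1 : R) y (y^`(1)%classic t).
  by move=> t0; rewrite derive1n1; apply: is_derive_derive1; apply: (du 0%N).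
have ic' : y t @[t --> 0^'+] --> c by move: ic; rewrite /RL_integral eqxx.
have [yi E] := integrated_Caputo a0 a1 (lexx 1) gi (Taylor1_kap gi cg D ic') eq.
apply: unique => //.
- by rewrite ltrDr.
- by move=> t t0; exact: is_derive_continuous (D t t0).
- by move=> t t0; rewrite E// mul0r addr0.
Qed.

(** Treats both Caputo problems with 1 < al < 2: A and B are the limits of y and y', one of them 0,
    and the identity between kernels selects be. *)
Let Caputo_gt1 (A B be : R) : 1 < al < 2 -> frac_derivable Caputo al y ->
  (forall t, 0 < t -> frac_deriv Caputo al y t = - lam * y t) ->
  y t @[t --> 0^'+] --> A -> y^`()%classic t @[t --> 0^'+] --> B ->
  0 < be -> be < al + 1 -> (forall t, A * kap 2 t + B * kap 3 t = c * kap (be + 1) t) ->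
  forall t, 0 < t -> y t = c * mode_sol th al (al - be) lam t.
Proof.
move=> /andP[a1 a2]; have ce : ceiln al = 2%N by rewrite ceiln2// a1 ltW.
have a0 : 0 < al by exact: lt_trans a1.
have a0F : (al <= 0) = false by rewrite leNgt a0.
rewrite /frac_derivable /frac_deriv ce a0F => -[du [cg gi]] eq iA iB be0 be1 cE.
have D1 (t : R) : 0 < t -> is_derive t (1 : R) y (y^`()%classic t).
  by move=> t0; apply: is_derive_derive1; apply: (du 0%N).
have D2 (t : R) : 0 < t -> is_derive t (1 : R) (y^`()%classic) (y^`(2)%classic t).
  by move=> t0; apply: is_derive_derive1; have := du 1%N t isT t0; rewrite derive1n1.
have [yi E] := integrated_Caputo a0 a2 (ler1n _ 2) gi (Taylor2 gi cg D1 D2 iA iB) eq.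
apply: unique => //.
- by move=> t t0; exact: is_derive_continuous (D1 t t0).
- by move=> t t0; rewrite E.
Qed.

Let frac_deriv0 K : frac_deriv K 0 y = y.
Proof. by apply/funext => t; rewrite /frac_deriv lexx /RL_integral oppr0 eqxx. Qed.

Let frac_deriv1 : frac_deriv Caputo 1 y = y^`()%classic.
Proof.
apply/funext => t; rewrite /frac_deriv ler10 ceiln1 ?ltr01 ?lexx// subrr.
by rewrite /RL_integral eqxx derive1n1.
Qed.

Lemma mode_solution_Caputo0 : 0 < al < 1 \/ 1 < al < 2 -> mode_solution Caputo al 0 1 lam c y ->
  forall t, 0 < t -> y t = c * mode_sol th al (al - 1) lam t.
Proof.
case => [|a12]; first exact: mode_solution_Caputo_lt1.
rewrite /mode_solution frac_deriv0 frac_deriv1 => -[h1 h2 h3 h4].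
have /andP[a1 a2] := a12.
apply: (Caputo_gt1 a12 h1 h2 h3 (h4 a1)) => //.
- by rewrite ltrDr (lt_trans _ a1).
- by move=> t; rewrite mul0r addr0.
Qed.

Lemma mode_solution_Caputo1 : 1 < al < 2 -> mode_solution Caputo al 1 0 lam c y ->
  forall t, 0 < t -> y t = c * mode_sol th al (al - 2) lam t.
Proof.
move=> a12; rewrite /mode_solution frac_deriv0 frac_deriv1 => -[h1 h2 h3 h4].
have /andP[a1 a2] := a12.
apply: (Caputo_gt1 a12 h1 h2 (h4 a1) h3) => //.
- by rewrite -ltrBlDr; lra.
- by move=> t; rewrite mul0r add0r -natr1.
Qed.

Lemma mode_solution_RL_lt1 gamma' : 0 < al < 1 ->
  mode_solution RiemannLiouville al (al - 1) gamma' lam c y ->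
  forall t, 0 < t -> y t = c * mode_sol th al 0 lam t.
Proof.
move=> /andP[a0 a1]; have ce : ceiln al = 1%N by rewrite ceiln1// a0 ltW.
have a0F : (al <= 0) = false by rewrite leNgt a0.
have a1F : (al - 1 <= 0) by rewrite subr_le0 ltW.
rewrite /mode_solution /frac_derivable /frac_deriv ce a0F a1F opprB => -[[[cy yi] du] eq ic _].
have D (t : R) : 0 < t -> is_derive t (1 : R) (RL_integral (1 - al) y) (- lam * y t).
  by move=> t0; rewrite -(eq t t0) derive1n1; apply: is_derive_derive1; apply: (du 0%N).
have gi := loc_integrableZ (- lam) yi.
have cg (t : R) : 0 < t -> {for t, continuous (fun z => - lam * y z)}.
  by move=> t0; apply: cvgMr; exact: cy.
have E := integrated_RL a0 a1 (lexx 1) yi _ (Taylor1_kap gi cg D ic).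
suff: forall t, 0 < t -> y t = c * mode_sol th al (al - al) lam t by rewrite subrr.
apply: unique => //.
- by rewrite ltrDl.
- move=> t t0; rewrite E ?ltrDr// mul0r addr0; congr (_ * kap _ t); ring.
Qed.

(** The Riemann-Liouville counterpart, with A the datum of order al - 2 and B that of order al -
    1. *)
Let RL_gt1 (A B be : R) : 1 < al < 2 -> frac_derivable RiemannLiouville al y ->
  (forall t, 0 < t -> frac_deriv RiemannLiouville al y t = - lam * y t) ->
  frac_deriv RiemannLiouville (al - 2) y t @[t --> 0^'+] --> A ->
  frac_deriv RiemannLiouville (al - 1) y t @[t --> 0^'+] --> B ->
  0 < be -> be < al + 1 -> (forall t, A * kap al t + B * kap (al + 1) t = c * kap (be + 1) t) ->
  forall t, 0 < t -> y t = c * mode_sol th al (al - be) lam t.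
Proof.
move=> /andP[a1 a2]; have ce : ceiln al = 2%N by rewrite ceiln2// a1 ltW.
have a0 : 0 < al by exact: lt_trans a1.
have a0F : (al <= 0) = false by rewrite leNgt a0.
have a1F : (al - 1 <= 0) = false by rewrite leNgt subr_gt0 a1.
have a2F : (al - 2 <= 0) by rewrite subr_le0 ltW.
have ce1 : ceiln (al - 1) = 1%N by rewrite ceiln1// subr_gt0 a1/=; lra.
rewrite /frac_derivable /frac_deriv ce a0F a1F a2F ce1 !opprB => -[[cy yi] du] eq iA iB be0 be1 cE.
(* The derivatives of orders al - 2, al - 1 and al are J^(2 - al) y and its first two derivatives,
   so Taylor's formula for this one function uses exactly the given data. *)
have e21 : 1 - (al - 1) = 2 - al by ring.
rewrite (_ : 1%:R + (1 - al) = 2 - al) in iB; last by ring.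
rewrite derive1n1 in iB.
have D1 (t : R) : 0 < t -> is_derive t (1 : R) (RL_integral (2 - al) y) ((RL_integral (2 - al) y)^`()%classic t).
  by move=> t0; apply: is_derive_derive1; apply: (du 0%N).
have D2 (t : R) : 0 < t -> is_derive t (1 : R) ((RL_integral (2 - al) y)^`()%classic) (- lam * y t).
  by move=> t0; rewrite -(eq t t0); apply: is_derive_derive1; have := du 1%N t isT t0; rewrite derive1n1.
have gi := loc_integrableZ (- lam) yi.
have cg (t : R) : 0 < t -> {for t, continuous (fun z => - lam * y z)}.
  by move=> t0; apply: cvgMr; exact: cy.
have E := integrated_RL a0 a2 (ler1n _ 2) yi _ (Taylor2 gi cg D1 D2 iA iB).
apply: unique => //.
- move=> t t0; rewrite E -?cE//; last by lra.
  by congr (_ * kap _ t + _ * kap _ t); ring.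
Qed.

Lemma mode_solution_RL1 : 0 < al < 1 \/ 1 < al < 2 ->
  mode_solution RiemannLiouville al (al - 1) (al - 2) lam c y ->
  forall t, 0 < t -> y t = c * mode_sol th al 0 lam t.
Proof.
case => [|a12]; first exact: mode_solution_RL_lt1.
move=> [h1 h2 h3 h4]; have /andP[a1 a2] := a12.
suff: forall t, 0 < t -> y t = c * mode_sol th al (al - al) lam t by rewrite subrr.
apply: (RL_gt1 a12 h1 h2 (h4 a1) h3) => //.
- exact: lt_trans a1.
- by rewrite ltrDl.
- by move=> t; rewrite mul0r add0r.
Qed.

Lemma mode_solution_RL2 : 1 < al < 2 ->
  mode_solution RiemannLiouville al (al - 2) (al - 1) lam c y ->
  forall t, 0 < t -> y t = c * mode_sol th al 1 lam t.
Proof.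
move=> a12 [h1 h2 h3 h4]; have /andP[a1 a2] := a12.
rewrite (_ : 1 = al - (al - 1) :> R); last by ring.
apply: (RL_gt1 a12 h1 h2 h3 (h4 a1)) => //.
- by rewrite subr_gt0.
- lra.
- by move=> t; rewrite mul0r addr0 subrK.
Qed.

End solutions.
End mode_solutions.

(** * Orthonormal expansions *)

Section square_integrable.
Context {d : measure_display} {T : measurableType d} {R : realType}.
Variable mu : {measure set T -> \bar R}.
Implicit Types f g h : T -> R.

(** Functions, not classes; elements of L_2(Omega) enter through their extension by 0. *)
Definition sqint f := measurable_fun setT f /\ mu.-integrable setT (EFin \o (fun x => f x ^+ 2)).

Definition ip f g : R := (\int[mu]_x (f x * g x))%R.

Lemma sqint_dominated f (g : T -> R) : measurable_fun setT f ->
  mu.-integrable setT (EFin \o g) -> (forall x, f x ^+ 2 <= g x) -> sqint f.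
Proof.
move=> mf gi fg; split => //; apply: le_integrable gi => //.
  by apply/measurable_EFinP; exact: measurable_funX.
move=> x _ /=; rewrite lee_fin ger0_norm ?sqr_ge0//.
exact: le_trans (fg x) (ler_norm _).
Qed.

Lemma sqintD f g : sqint f -> sqint g -> sqint (fun x => f x + g x).
Proof.
move=> [mf fi] [mg gi]; apply: (@sqint_dominated _ (fun x => 2 * f x ^+ 2 + 2 * g x ^+ 2)).
- exact: measurable_funD.
- have := integrableD measurableT (integrableZl measurableT 2 fi) (integrableZl measurableT 2 gi).
  by apply: eq_integrable.
- by move=> x; have := sqr_ge0 (f x - g x); nra.
Qed.

Lemma sqintZ k f : sqint f -> sqint (fun x => k * f x).
Proof.
move=> [mf fi]; apply: (@sqint_dominated _ (fun x => k ^+ 2 * f x ^+ 2)).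
- by apply: measurable_funM => //; exact: measurable_cst.
- by have := integrableZl measurableT (k ^+ 2) fi; apply: eq_integrable.
- by move=> x; rewrite exprMn.
Qed.

Lemma sqintB f g : sqint f -> sqint g -> sqint (fun x => f x - g x).
Proof.
move=> fi gi; have := sqintD fi (sqintZ (-1) gi).
by under eq_fun do rewrite mulN1r.
Qed.

Lemma sqint0 : sqint (fun _ => 0).
Proof.
split; first exact: measurable_cst.
by have := integrable0 mu setT; apply: eq_integrable => // x _ /=; rewrite expr0n.
Qed.

Lemma sqint_sum (h : nat -> T -> R) n : (forall j, sqint (h j)) ->
  sqint (fun x => \sum_(j < n) h j x).
Proof.
move=> hi; elim: n => [|n ih].
  by under eq_fun do rewrite big_ord0; exact: sqint0.
by under eq_fun do rewrite big_ord_recr; exact: sqintD.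
Qed.

Lemma sqintM f g : sqint f -> sqint g -> mu.-integrable setT (EFin \o (fun x => f x * g x)).
Proof.
move=> [mf fi] [mg gi].
have := integrableD measurableT fi gi; apply: le_integrable => //.
  by apply/measurable_EFinP; exact: measurable_funM.
move=> x _ /=; rewrite lee_fin; apply: le_trans (ler_norm _).
rewrite normrM -(real_normK (num_real (f x))) -(real_normK (num_real (g x))).
by have := sqr_ge0 (`|f x| - `|g x|); have := sqr_ge0 (`|f x| + `|g x|); nra.
Qed.

Lemma ipC f g : ip f g = ip g f.
Proof. by apply: eq_Rintegral => x _; rewrite mulrC. Qed.

Lemma ipDl f g h : sqint f -> sqint g -> sqint h ->
  ip (fun x => f x + g x) h = ip f h + ip g h.
Proof.
move=> fi gi hi; rewrite -RintegralD//; [|exact: sqintM|exact: sqintM].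
by apply: eq_Rintegral => x _; rewrite mulrDl.
Qed.

Lemma ipZl k f h : sqint f -> sqint h -> ip (fun x => k * f x) h = k * ip f h.
Proof.
move=> fi hi; rewrite -RintegralZl//; last exact: sqintM.
by apply: eq_Rintegral => x _; rewrite mulrA.
Qed.

Lemma ipBl f g h : sqint f -> sqint g -> sqint h ->
  ip (fun x => f x - g x) h = ip f h - ip g h.
Proof.
move=> fi gi hi; rewrite -[- ip g h]mulN1r -ipZl// -ipDl//; last exact: sqintZ.
by apply: eq_Rintegral => x _; rewrite mulN1r.
Qed.

Lemma ip0l h : ip (fun _ => 0) h = 0.
Proof.
rewrite /ip (_ : (fun x => 0 * h x) = cst 0); last by apply/funext => x; rewrite mul0r.
by rewrite /Rintegral integral0.
Qed.

Lemma ip_suml (f : nat -> T -> R) n h : (forall j, sqint (f j)) -> sqint h ->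
  ip (fun x => \sum_(j < n) f j x) h = \sum_(j < n) ip (f j) h.
Proof.
move=> fi hi; elim: n => [|n ih].
  by rewrite big_ord0; under eq_fun do rewrite big_ord0; exact: ip0l.
rewrite big_ord_recr/= -ih -ipDl//; last exact: sqint_sum.
by apply: eq_Rintegral => x _; rewrite big_ord_recr.
Qed.

Lemma ip_ge0 f : 0 <= ip f f.
Proof. by apply: Rintegral_ge0 => x _; rewrite -expr2 sqr_ge0. Qed.

Lemma ip_sqrB f g : sqint f -> sqint g ->
  ip (fun x => f x - g x) (fun x => f x - g x) = ip f f - 2 * ip f g + ip g g.
Proof.
move=> fi gi; have bi := sqintB fi gi.
rewrite ipBl// ipC ipBl// [X in _ - X]ipC ipBl// (ipC g f); ring.
Qed.

Lemma ip_sqrD_le f g : sqint f -> sqint g ->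
  ip (fun x => f x + g x) (fun x => f x + g x) <= 2 * ip f f + 2 * ip g g.
Proof.
move=> fi gi; have di := sqintD fi gi; have bi := ip_ge0 (fun x => f x - g x).
have e1 : ip f (fun x => f x + g x) = ip f f + ip f g by rewrite ipC ipDl// (ipC g f).
have e2 : ip g (fun x => f x + g x) = ip f g + ip g g by rewrite ipC ipDl.
by move: bi; rewrite ip_sqrB// (ipDl fi gi di) e1 e2; lra.
Qed.

Section orthonormal.
Variable phi : nat -> T -> R.
Hypothesis phi_sqint : forall j, sqint (phi j).
Hypothesis phi_orthonormal : forall i j, ip (phi i) (phi j) = (i == j)%:R.

Definition lin_comb (c : nat -> R) N x := \sum_(j < N) c j * phi j x.

Lemma sqint_lin_comb c N : sqint (lin_comb c N).
Proof. by apply: (@sqint_sum (fun j x => c j * phi j x)) => j; exact: sqintZ. Qed.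

Lemma ip_lin_comb c N h : sqint h ->
  ip (lin_comb c N) h = \sum_(j < N) c j * ip (phi j) h.
Proof.
move=> hi; rewrite (@ip_suml (fun j x => c j * phi j x))//.
  by apply: eq_bigr => j _; exact: ipZl.
by move=> j; exact: sqintZ.
Qed.

Lemma ip_lin_comb_phi c N k : (k < N)%N -> ip (lin_comb c N) (phi k) = c k.
Proof.
move=> kN; rewrite ip_lin_comb//.
under eq_bigr do rewrite phi_orthonormal.
rewrite (bigD1 (Ordinal kN))//= eqxx mulr1 big1 ?addr0// => i ik.
have /negbTE -> : (i : nat) != k by apply: contra ik => /eqP e; apply/eqP; exact: val_inj.
by rewrite mulr0.
Qed.

Lemma ip_lin_comb2 c N : ip (lin_comb c N) (lin_comb c N) = \sum_(j < N) c j ^+ 2.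
Proof.
rewrite ip_lin_comb; last exact: sqint_lin_comb.
by apply: eq_bigr => j _; rewrite ipC ip_lin_comb_phi// -expr2.
Qed.

Lemma ip_lin_combB c M N : (N <= M)%N ->
  ip (fun x => lin_comb c M x - lin_comb c N x) (fun x => lin_comb c M x - lin_comb c N x) =
  \sum_(j < M) c j ^+ 2 - \sum_(j < N) c j ^+ 2.
Proof.
move=> NM; rewrite ip_sqrB; [|exact: sqint_lin_comb|exact: sqint_lin_comb].
rewrite !ip_lin_comb2 [ip (lin_comb c M) _]ipC ip_lin_comb; last exact: sqint_lin_comb.
rewrite (eq_bigr (fun j : 'I_N => c j ^+ 2)); first by ring.
by move=> j _; rewrite ipC ip_lin_comb_phi ?expr2// (leq_trans (ltn_ord j)).
Qed.

Lemma ip_sub_lin_comb f N (c := fun j => ip f (phi j)) : sqint f ->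
  ip (fun x => f x - lin_comb c N x) (fun x => f x - lin_comb c N x) =
  ip f f - \sum_(j < N) c j ^+ 2.
Proof.
move=> fi; rewrite ip_sqrB//; last exact: sqint_lin_comb.
rewrite ip_lin_comb2 ipC ip_lin_comb//.
rewrite (eq_bigr (fun j : 'I_N => c j ^+ 2)); first by ring.
by move=> j _; rewrite ipC expr2.
Qed.

Lemma Bessel f N : sqint f -> \sum_(j < N) ip f (phi j) ^+ 2 <= ip f f.
Proof. by move=> fi; rewrite -subr_ge0 -ip_sub_lin_comb// ip_ge0. Qed.

Lemma sqr_ip_le f k : sqint f -> ip f (phi k) ^+ 2 <= ip f f.
Proof.
move=> fi; apply: le_trans (Bessel k.+1 fi); rewrite big_ord_recr/= lerDr.
by apply: sumr_ge0 => j _; exact: sqr_ge0.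
Qed.

(** Once N > k the k-th coefficient of the partial sum is c k, and a single coefficient is bounded
    by the norm, so it passes to the limit. *)
Lemma coefficient_of_limit f (c : nat -> R) k : sqint f ->
  ip (fun x => lin_comb c N x - f x) (fun x => lin_comb c N x - f x) @[N --> \oo] --> 0 ->
  ip f (phi k) = c k.
Proof.
move=> fi lim0; apply/eqP; rewrite -subr_eq0 -sqrf_eq0; apply/eqP.
apply/le_anti; rewrite sqr_ge0 andbT.
apply: (ler_cvg_to (cvg_cst _) lim0); near=> N.
have ci := sqint_lin_comb c N.
have kN : (k < N)%N by near: N; exact: nbhs_infty_gt.
have := sqr_ip_le k (sqintB ci fi); rewrite ipBl// ip_lin_comb_phi//.
by rewrite -[X in X ^+ 2 <= _]opprB sqrrN.
Unshelve. all: by end_near. Qed.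

Definition expandable f :=
  ip (fun x => lin_comb (fun j => ip f (phi j)) N x - f x)
     (fun x => lin_comb (fun j => ip f (phi j)) N x - f x) @[N --> \oo] --> 0.

Lemma Parseval f : sqint f -> expandable f ->
  \sum_(j < N) ip f (phi j) ^+ 2 @[N --> \oo] --> ip f f.
Proof.
move=> fi fe; have := fe; rewrite /expandable.
have e N : ip (fun x => lin_comb (fun j => ip f (phi j)) N x - f x)
     (fun x => lin_comb (fun j => ip f (phi j)) N x - f x) =
     ip f f - \sum_(j < N) ip f (phi j) ^+ 2.
  by rewrite -ip_sub_lin_comb//; apply: eq_Rintegral => x _; rewrite -!expr2 -sqrrN opprB.
rewrite (funext e) => h.
rewrite -[X in _ --> X]subr0 (_ : (fun N => _) = fun N => ip f f - (ip f f - \sum_(j < N) ip f (phi j) ^+ 2)).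
  by apply: cvgB => //; exact: cvg_cst.
by apply/funext => N; ring.
Qed.

(** Parseval for f and Bessel for v: this is where an estimate uniform over the modes becomes an
    estimate of norms. *)
Lemma Parseval_le f v K : sqint f -> expandable f -> sqint v -> 0 <= K ->
  (forall j, `|ip f (phi j)| <= K * `|ip v (phi j)|) -> ip f f <= K ^+ 2 * ip v v.
Proof.
move=> fi fe vi K0 fv; apply: (ler_cvg_to (Parseval fi fe) (cvg_cst _)); near=> N.
apply: (@le_trans _ _ (K ^+ 2 * \sum_(j < N) ip v (phi j) ^+ 2)).
  rewrite mulr_sumr; apply: ler_sum => j _.
  rewrite -(real_normK (num_real (ip f _))) -(real_normK (num_real (ip v _))) -exprMn.
  by rewrite ler_pXn2r ?nnegrE// mulr_ge0.
by rewrite ler_wpM2l ?sqr_ge0// Bessel.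
Unshelve. all: by end_near. Qed.

End orthonormal.
End square_integrable.

(** * The Riesz-Fischer theorem *)

Section Riesz_Fischer.
Context {d : measure_display} {T : measurableType d} {R : realType}.
Variable mu : {measure set T -> \bar R}.

Section fast_Cauchy.
Variable s : nat -> T -> R.
Hypothesis s_sqint : forall k, sqint mu (s k).
Let h k x := s k.+1 x - s k x.
Hypothesis h_small : forall k, ip mu (h k) (h k) <= 16^-1 ^+ k.

(** With squared norms at most 16^(-k), the weights 4^k leave a sum G of integral at most the sum of
    the 4^(-k); where G is finite, |h k| <= sqrt G 2^(-k), which gives pointwise convergence with G
    as majorant. *)
Let Gterm k x : \bar R := (4 ^+ k * h k x ^+ 2)%:E.
Let G x : \bar R := (\sum_(0 <= k <oo) Gterm k x)%E.

Let h_sqint k : sqint mu (h k). Proof. exact: sqintB. Qed.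

Let Gterm_ge0 k x : (0 <= Gterm k x)%E.
Proof. by rewrite lee_fin mulr_ge0 ?sqr_ge0// exprn_ge0. Qed.

Let mGterm k : measurable_fun setT (Gterm k).
Proof.
apply/measurable_EFinP; apply: measurable_funM; first exact: measurable_cst.
by apply: measurable_funX; have [] := h_sqint k.
Qed.

Let G_ge0 x : (0 <= G x)%E.
Proof. by apply: nneseries_ge0 => k _ _; exact: Gterm_ge0. Qed.

Let mG : measurable_fun setT G.
Proof. exact: ge0_emeasurable_sum. Qed.

Let int_Gterm k : (\int[mu]_x Gterm k x <= (4^-1 ^+ k)%:E)%E.
Proof.
have [mh hi] := h_sqint k.
rewrite /Gterm; under eq_integral do rewrite EFinM.
rewrite ge0_integralZl_EFin//; last 2 first.
- by move=> x _; rewrite lee_fin sqr_ge0.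
- by apply/measurable_EFinP; exact: measurable_funX.
have -> : (\int[mu]_x (h k x ^+ 2)%:E = (ip mu (h k) (h k))%:E)%E.
  rewrite /ip /Rintegral fineK; last exact: integrable_fin_num (sqintM (h_sqint k) (h_sqint k)).
  by apply: eq_integral => x _; rewrite expr2.
rewrite -EFinM lee_fin; apply: (le_trans (ler_wpM2l _ (h_small k))); first by rewrite exprn_ge0.
by rewrite -exprMn (_ : 4 / 16 = 4^-1)//; lra.
Qed.

Let int_G : (\int[mu]_x G x < +oo)%E.
Proof.
rewrite /G integral_nneseries//.
apply: (@le_lt_trans _ _ (\sum_(0 <= k <oo) (4^-1 ^+ k)%:E)%E).
  by apply: lee_nneseries => [k _ _|k _]; [exact: integral_ge0|exact: int_Gterm].
have q1 : `|4^-1| < 1 :> R by rewrite ger0_norm ?invr_ge0// invf_lt1// ltr1n.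
have cv := @is_cvg_geometric_series R 1 4^-1 q1.
rewrite (_ : (\sum_(0 <= k <oo) _)%E = (limn (series (geometric 1 4^-1 : R^nat)))%:E) ?ltry//.
rewrite -EFin_lim//; congr (limn _); apply/funext => n.
by rewrite /series /= -sumEFin; apply: eq_bigr => i _; rewrite /geometric mul1r.
Qed.

Let G_integrable : mu.-integrable setT G.
Proof.
apply/integrableP; split => //.
by rewrite (eq_integral G)// => x _; rewrite gee0_abs.
Qed.

Let C x := Num.sqrt (fine (G x)).

Let h_le k x : (G x < +oo)%E -> `|h k x| <= C x * 2^-1 ^+ k.
Proof.
move=> Gx; have Gf : G x \is a fin_num by rewrite ge0_fin_numE.
have e : (Gterm k x <= G x)%E.
  rewrite /G [leRHS](@nneseriesD1 _ _ k)//.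
  by rewrite leeDl// nneseries_ge0// => i _ _; exact: Gterm_ge0.
rewrite -(fineK Gf) lee_fin in e.
rewrite -(@ler_pXn2r _ 2)// ?nnegrE//; last by rewrite mulr_ge0 ?sqrtr_ge0// exprn_ge0// invr_ge0.
rewrite real_normK ?num_real// exprMn sqr_sqrtr; last exact: fine_ge0.
rewrite -exprM mulnC exprM -ler_pdivrMr ?exprn_gt0// ?exprn_gt0 ?invr_gt0//.
rewrite mulrC (_ : (2^-1 ^+ 2) = 4^-1 :> R); last by rewrite exprVn -natrX.
by rewrite exprVn invrK.
Qed.

(** Keeping the difference of powers instead of 2^(-k) alone is what closes the induction on n. *)
Let s_Cauchy k n x : (G x < +oo)%E ->
  `|s (k + n) x - s k x| <= 2 * C x * (2^-1 ^+ k - 2^-1 ^+ (k + n)).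
Proof.
move=> Gx; elim: n => [|n ih]; first by rewrite addn0 !subrr normr0 mulr0.
have -> : s (k + n.+1) x - s k x = h (k + n) x + (s (k + n) x - s k x).
  by rewrite /h addnS; ring.
apply: (le_trans (ler_normD _ _)).
have := h_le (k + n) Gx; rewrite addnS exprS.
move: ih; set a := _ ^+ (k + n); lra.
Qed.

Let good := [set x | (G x < +oo)%E].

Let mgood : measurable good.
Proof.
have -> : good = setT `&` G @^-1` [set~ +oo%E].
  by apply/seteqP; split => x /=; rewrite /good /= ltey => hx; [split => //; apply/eqP|case: hx => _ /eqP].
by apply: mG => //; exact: measurableC.
Qed.

(** Set to 0 where G is infinite, so that the limit exists at every point and is measurable. *)
Let sA k := s k \_ good.

Let sA_cvg x : cvgn (sA ^~ x).
Proof.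
have [Gx|Gx] := boolP (x \in good); last first.
  by apply/cvg_ex; exists 0; apply: cvg_near_cst; apply: nearW => k; rewrite /sA patchE (negbTE Gx).
have e k : sA k x = s k x by rewrite /sA patchE Gx.
rewrite (funext e); rewrite inE in Gx.
have : cvgn (series (h ^~ x)).
  apply: normed_cvg.
  apply: (@series_le_cvg _ _ (geometric (C x) 2^-1)) => //.
  - by move=> n /=.
  - by move=> n; rewrite /geometric /= mulr_ge0 ?sqrtr_ge0// exprn_ge0// invr_ge0.
  - by move=> n; exact: h_le.
  - by apply: is_cvg_geometric_series; rewrite ger0_norm ?invr_ge0// invf_lt1// ltr1n.
rewrite (_ : series _ = fun n => s n x - s 0 x); last first.
  by apply/funext => n; rewrite /series /= telescope_sumr.
move=> /cvg_ex[l hl]; apply/cvg_ex; exists (l + s 0 x).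
rewrite (_ : (fun k => s k x) = fun k => (s k x - s 0 x) + s 0 x); last by apply/funext => k; rewrite subrK.
by apply: cvgD => //; exact: cvg_cst.
Qed.

Let g x := limn (sA ^~ x).

Let mg : measurable_fun setT g.
Proof.
apply: (@measurable_fun_cvg _ _ _ _ sA).
  move=> k; apply/(measurable_restrictT (s k) mgood); apply: measurable_funTS.
  by have [] := s_sqint k.
by move=> x _; exact: sA_cvg.
Qed.

(** Stated in the extended reals, so that points with G = +oo satisfy it trivially. *)
Let g_le k x : (((g x - s k x) ^+ 2)%:E <= (4 * 4^-1 ^+ k)%:E * G x)%E.
Proof.
have [Gx|] := ltP (G x) +oo%E; last first.
  by rewrite leye_eq => /eqP ->; rewrite gt0_muley ?leey// lte_fin mulr_gt0// exprn_gt0// invr_gt0.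
have Gf : G x \is a fin_num by rewrite ge0_fin_numE.
have gl : `|g x - s k x| <= 2 * C x * 2^-1 ^+ k.
  have c1 : `|sA n x - s k x| @[n --> \oo] --> `|g x - s k x|.
    by apply: cvg_norm; apply: cvgB; [exact: sA_cvg|exact: cvg_cst].
  apply: (ler_cvg_to c1 (cvg_cst _)); near=> n.
  have kn : (k <= n)%N by near: n; exact: nbhs_infty_ge.
  rewrite /sA patchE mem_set// -(subnKC kn).
  apply: (le_trans (s_Cauchy k (n - k) Gx)).
  by rewrite ler_wpM2l ?mulr_ge0 ?sqrtr_ge0// gerBl exprn_ge0// invr_ge0.
rewrite -(fineK Gf) -EFinM lee_fin.
have := @lerXn2r _ 2 _ _ _ _ gl; rewrite !nnegrE normr_ge0 => /(_ isT).
rewrite !mulr_ge0 ?sqrtr_ge0 ?exprn_ge0 ?invr_ge0// => /(_ isT).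
rewrite real_normK ?num_real// !exprMn sqr_sqrtr; last exact: fine_ge0.
rewrite -exprM mulnC exprM (_ : (2^-1 ^+ 2) = 4^-1 :> R); last by rewrite exprVn -natrX.
by rewrite (_ : 2 ^+ 2 = 4 :> R); [lra|rewrite -natrX].
Unshelve. all: by end_near. Qed.

Lemma fast_Cauchy_limit : exists2 g, sqint mu g &
  forall e, 0 < e -> exists k0, forall k, (k0 <= k)%N ->
    ip mu (fun x => s k x - g x) (fun x => s k x - g x) <= e.
Proof.
have gk k : sqint mu (fun x => g x - s k x).
  have [ms _] := s_sqint k.
  have mgs : measurable_fun setT (fun x => g x - s k x) by exact: measurable_funB.
  split => //; have := integrableZl measurableT (4 * 4^-1 ^+ k) G_integrable.
  apply: le_integrable => //; first by apply/measurable_EFinP; exact: measurable_funX.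
  move=> x _; rewrite gee0_abs ?lee_fin ?sqr_ge0//; apply: (le_trans (g_le k x)).
  exact: lee_abs.
exists g.
  have := sqintD (gk 0%N) (s_sqint 0%N).
  by under eq_fun do rewrite subrK.
move=> e e0; pose I := fine (\int[mu]_x G x).
have If : (\int[mu]_x G x)%E \is a fin_num by exact: integrable_fin_num.
have c : 4 * 4^-1 ^+ k * I @[k --> \oo] --> 0.
  rewrite -(mul0r I) -(mulr0 4); apply: cvgMl; apply: cvgMr.
  by apply: cvg_expr; rewrite ger0_norm ?invr_ge0// invf_lt1// ltr1n.
have [k0 _ hk] : \forall k \near \oo, 4 * 4^-1 ^+ k * I <= e by exact: (cvgr_le _ c).
exists k0 => k k0k; apply: le_trans (hk k k0k).
have E : ip mu (fun x => s k x - g x) (fun x => s k x - g x) = fine (\int[mu]_x ((g x - s k x) ^+ 2)%:E).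
  by rewrite /ip /Rintegral; congr fine; apply: eq_integral => x _; congr EFin; ring.
rewrite E -lee_fin fineK; last exact: integrable_fin_num (gk k).2.
have c0 : 0 <= 4 * 4^-1 ^+ k :> R by rewrite mulr_ge0// exprn_ge0// invr_ge0.
have <- : (\int[mu]_x ((4 * 4^-1 ^+ k)%:E * G x) = (4 * 4^-1 ^+ k * I)%:E)%E.
  by rewrite ge0_integralZl_EFin// (EFinM _ I) /I fineK.
apply: ge0_le_integral => //.
- by move=> x _; rewrite lee_fin sqr_ge0.
- exact: measurable_int (gk k).2.
- by apply: measurable_funeM.
Qed.

End fast_Cauchy.

Section orthonormal_series.
Variable phi : nat -> T -> R.
Hypothesis phi_sqint : forall j, sqint mu (phi j).
Hypothesis phi_orthonormal : forall i j, ip mu (phi i) (phi j) = (i == j)%:R.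

(** Square summability makes the partial sums Cauchy; a fast subsequence has a limit, and comparison
    with one of its members extends the convergence to all partial sums. *)
Lemma Riesz_Fischer (c : nat -> R) : cvgn (series (fun j => c j ^+ 2)) ->
  exists2 g, sqint mu g &
   ip mu (fun x => lin_comb phi c N x - g x) (fun x => lin_comb phi c N x - g x) @[N --> \oo] --> 0.
Proof.
move=> cs.
have sym N M : ip mu (fun x => lin_comb phi c M x - lin_comb phi c N x)
         (fun x => lin_comb phi c M x - lin_comb phi c N x) =
  ip mu (fun x => lin_comb phi c N x - lin_comb phi c M x)
         (fun x => lin_comb phi c N x - lin_comb phi c M x).
  by apply: eq_Rintegral => x _; ring.
have tail e : 0 < e -> exists N0, forall M N, (N0 <= N)%N -> (N0 <= M)%N ->
   ip mu (fun x => lin_comb phi c M x - lin_comb phi c N x)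
         (fun x => lin_comb phi c M x - lin_comb phi c N x) <= e.
  move=> e0; have [l hl] := (cvg_ex _).1 cs.
  have e2 : 0 < e / 2 by rewrite divr_gt0.
  have [N0 _ h] : \forall n \near \oo, `|l - series (fun j => c j ^+ 2) n| <= e / 2.
    by move/cvgrPdist_le : hl => /(_ _ e2).
  exists N0 => M N; wlog NM : M N / (N <= M)%N => [hw|] N0N N0M.
    have [NM|/ltnW MN] := leqP N M; first exact: hw.
    by rewrite sym; exact: hw.
  rewrite (ip_lin_combB phi_sqint phi_orthonormal)//.
  rewrite -!(big_mkord xpredT (fun j => c j ^+ 2)).
  have := h M N0M; have := h N N0N; rewrite /series /= !ler_norml => /andP[a1 a2] /andP[b1 b2].
  lra.
have q k : 0 < 16^-1 ^+ k :> R by rewrite exprn_gt0// invr_gt0.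
have [N0 N0P] := choice (fun k => tail _ (q k)).
(* The maximum ensures that N k and N (k + 1) both lie beyond N0 k. *)
pose N k := (\max_(i < k.+1) N0 i)%N.
have N0N i k : (i <= k)%N -> (N0 i <= N k)%N.
  by move=> ik; exact: (@leq_bigmax _ (fun i : 'I_k.+1 => N0 i) (Ordinal (ik : (i < k.+1)%N))).
have li n : sqint mu (lin_comb phi c n) by exact: sqint_lin_comb.
have [|g gi gP] := @fast_Cauchy_limit (fun k => lin_comb phi c (N k)) (fun k => li (N k)).
  by move=> k; apply: N0P; exact: N0N.
exists g => //; apply/cvgrPdist_le => e e0.
have e4 : 0 < e / 4 by rewrite divr_gt0.
have [k0 k0P] := gP _ e4.
have [k1 _ k1P] : \forall k \near \oo, 16^-1 ^+ k <= e / 4.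
  have c0 : 16^-1 ^+ k @[k --> \oo] --> (0 : R).
    by apply: cvg_expr; rewrite ger0_norm ?invr_ge0// invf_lt1// ltr1n.
  exact: (cvgr_le _ c0).
pose k := maxn k0 k1.
have h1 := k0P k (leq_maxl _ _); have h2 := k1P k (leq_maxr _ _).
near=> n; rewrite sub0r normrN ger0_norm ?ip_ge0//.
have N0n : (N0 k <= n)%N by near: n; exact: nbhs_infty_ge.
have h3 := N0P k n (N k) (N0N _ _ (leqnn k)) N0n.
have h4 := ip_sqrD_le (sqintB (li n) (li (N k))) (sqintB (li (N k)) gi).
rewrite (_ : (fun x => lin_comb phi c n x - g x) = fun x =>
  lin_comb phi c n x - lin_comb phi c (N k) x + (lin_comb phi c (N k) x - g x)).
  apply: (le_trans h4); lra.
by apply/funext => x; ring.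
Unshelve. all: by end_near. Qed.

End orthonormal_series.
End Riesz_Fischer.

Lemma cvg_powRN0 {R : realType} (al : R) : 0 < al -> t `^ (- al) @[t --> +oo] --> 0.
Proof.
move=> al0; apply/cvgrPdist_le => e e0; near=> t.
have t0 : 0 < t by near: t; exact: nbhs_pinfty_gt.
rewrite sub0r normrN ger0_norm ?powR_ge0// powRN -[leRHS]invrK lef_pV2 ?posrE ?invr_gt0 ?powR_gt0//.
have -> : e^-1 = (e^-1 `^ al^-1) `^ al by rewrite -powRrM mulVf ?lt0r_neq0// powRr1// invr_ge0 ltW.
have le_t : e^-1 `^ al^-1 <= t by near: t; exact: nbhs_pinfty_ge.
by apply: ge0_ler_powR => //; rewrite ?nnegrE ?powR_ge0 ?(ltW al0) ?(ltW t0).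
Unshelve. all: by end_near. Qed.

(** * From estimates of modes to convergence in L_2(Omega) *)

Section spectral_limits.
Context {R : realType} {n : nat}.
Variable Omega : set 'rV[R]_n.
Local Notation mu := (@lebesgue_rV R n).
Implicit Types f g : 'rV[R]_n -> R.

Lemma restrictM f g x : (f \_ Omega) x * (g \_ Omega) x = ((fun x => f x * g x) \_ Omega) x.
Proof. by rewrite !patchE; case: ifP => // _; rewrite -[point]/(0 : R) mulr0. Qed.

Lemma restrictB f g x : ((fun x => f x - g x) \_ Omega) x = (f \_ Omega) x - (g \_ Omega) x.
Proof. by rewrite !patchE; case: ifP => // _; rewrite -[point]/(0 : R) subr0. Qed.

Lemma restrictZ k f x : ((fun x => k * f x) \_ Omega) x = k * (f \_ Omega) x.
Proof. by rewrite !patchE; case: ifP => // _; rewrite -[point]/(0 : R) mulr0. Qed.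

Lemma restrict_sum (f : nat -> 'rV[R]_n -> R) N x :
  ((fun x => \sum_(j < N) f j x) \_ Omega) x = \sum_(j < N) (f j \_ Omega) x.
Proof.
rewrite patchE; case: ifPn => xO.
  by apply: eq_bigr => j _; rewrite patchE xO.
by rewrite big1// => j _; rewrite patchE (negbTE xO).
Qed.

Lemma L2innerE f g : L2inner Omega f g = ip mu (f \_ Omega) (g \_ Omega).
Proof.
by rewrite /L2inner Rintegral_mkcond; apply: eq_Rintegral => x _; rewrite restrictM.
Qed.

Lemma L2_sqint f : L2 Omega f <-> sqint mu (f \_ Omega).
Proof.
split => [h|[mf fi]].
  split; last exact: Lfun2_integrable_sqr h.
  by move: h; rewrite /L2 inE => /andP[]; rewrite inE.
rewrite /L2 inE; apply/andP; split; first by rewrite inE.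
rewrite inE /= /finite_norm unlock /Lnorm poweR_lty//.
have /integrableP[_] := fi; apply: le_lt_trans.
apply: ge0_le_integral => //.
- by move=> x _; rewrite lee_fin powR_ge0.
- apply/measurable_EFinP; apply: (measurableT_comp (measurable_powR _)).
  exact: measurableT_comp.
- by apply: measurableT_comp => //; apply/measurable_EFinP; exact: measurable_funX.
- by move=> x _ /=; rewrite lee_fin normrX -powR_mulrn.
Qed.

Lemma L2normE f : L2 Omega f -> L2norm Omega f = (Num.sqrt (ip mu (f \_ Omega) (f \_ Omega)))%:E.
Proof.
move=> /L2_sqint fi; rewrite /L2norm unlock /Lnorm.
have -> : (\int[mu]_x ((`|(f \_ Omega) x|) `^ 2)%:E = (ip mu (f \_ Omega) (f \_ Omega))%:E)%E.
  rewrite /ip /Rintegral fineK; last exact: integrable_fin_num (sqintM fi fi).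
  by apply: eq_integral => x _; rewrite powR_mulrn// real_normK ?num_real// expr2.
by rewrite poweR_EFin powR12_sqrt// ip_ge0.
Qed.

Hypothesis mOmega : measurable Omega.

Lemma sqint_restrict f : sqint mu f -> sqint mu (f \_ Omega).
Proof.
move=> [mf fi]; apply: (sqint_dominated _ fi).
  by apply/(measurable_restrictT f mOmega); exact: measurable_funTS.
by move=> x; rewrite patchE; case: ifP => // _; rewrite -[X in X ^+ 2 <= _]/(0 : R) expr0n sqr_ge0.
Qed.

Lemma ip_restrict_le f : sqint mu f -> ip mu (f \_ Omega) (f \_ Omega) <= ip mu f f.
Proof.
move=> fi; have ri := sqint_restrict fi.
apply: le_Rintegral => //; [exact: sqintM|exact: sqintM|move=> x _].
by rewrite !patchE; case: ifP => // _; rewrite -[X in X * _ <= _]/(0 : R) mul0r -expr2 sqr_ge0.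
Qed.

Lemma L2B f g : L2 Omega f -> L2 Omega g -> L2 Omega (fun x => f x - g x).
Proof.
move=> /L2_sqint fi /L2_sqint gi; apply/L2_sqint.
by rewrite (funext (restrictB f g)); exact: sqintB.
Qed.

Lemma L2Z k f : L2 Omega f -> L2 Omega (fun x => k * f x).
Proof. by move=> /L2_sqint fi; apply/L2_sqint; rewrite (funext (restrictZ k f)); exact: sqintZ. Qed.

Lemma L2_sum (f : nat -> 'rV[R]_n -> R) N : (forall j, L2 Omega (f j)) ->
  L2 Omega (fun x => \sum_(j < N) f j x).
Proof.
move=> fi; apply/L2_sqint; rewrite (funext (restrict_sum f N)).
by apply: (@sqint_sum _ _ _ mu (fun j => f j \_ Omega)) => j; exact/L2_sqint.
Qed.

(** [L2cvg] speaks of an extended real norm; the squared distance is real and can be handled by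
    Parseval's identity. *)
Lemma L2cvgP (I : Type) (F : set_system I) {FF : Filter F} (u : I -> 'rV[R]_n -> R) g :
  (\forall i \near F, L2 Omega (u i)) -> L2 Omega g ->
  L2cvg Omega F u g <->
  ip mu ((fun x => u i x - g x) \_ Omega) ((fun x => u i x - g x) \_ Omega) @[i --> F] --> 0.
Proof.
move=> uL gL; set a := fun i => ip mu _ _.
have e : \forall i \near F, L2norm Omega (fun x => u i x - g x) = (Num.sqrt (a i))%:E.
  by apply: filterS uL => i ui; rewrite L2normE//; exact: L2B.
have a0 i : 0 <= a i by exact: ip_ge0.
rewrite /L2cvg; split => h.
  have h1 : (Num.sqrt (a i))%:E @[i --> F] --> 0%E.
    by apply: cvg_trans h; apply: near_eq_cvg; apply: filterS e => i ->.
  have h2 : Num.sqrt (a i) @[i --> F] --> 0 by exact: (fine_cvg h1).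
  rewrite (_ : a = fun i => Num.sqrt (a i) * Num.sqrt (a i)).
    by rewrite -(mulr0 0); exact: cvgM.
  by apply/funext => i; rewrite -expr2 sqr_sqrtr.
have h1 : (Num.sqrt (a i))%:E @[i --> F] --> 0%E.
  apply/fine_cvgP; split; first exact: nearW.
  rewrite -sqrtr0; apply: (cvg_comp _ Num.sqrt h); exact: sqrt_continuous.
by apply: cvg_trans h1; apply: near_eq_cvg; apply: filterS e => i ->.
Qed.

Section eigenbasis.
Variable B : ('rV[R]_n -> R) -> 'rV[R]_n -> R.
Variables (lam : nat -> R) (phi : nat -> 'rV[R]_n -> R).
Hypothesis eigen : laplace_eigenbasis Omega B lam phi.

Let phiO j := phi j \_ Omega.

Let phiO_sqint j : sqint mu (phiO j).
Proof. exact/L2_sqint/(phi_L2 eigen). Qed.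

Let phiO_orthonormal i j : ip mu (phiO i) (phiO j) = (i == j)%:R.
Proof. by rewrite -L2innerE (phi_orthonormal eigen). Qed.

Let lin_comb_phiO (c : nat -> R) N x :
  ((fun x => \sum_(j < N) c j * phi j x) \_ Omega) x = lin_comb phiO c N x.
Proof.
rewrite (restrict_sum (fun j x => c j * phi j x)); apply: eq_bigr => j _.
by rewrite restrictZ.
Qed.

Let L2_lin_comb (c : nat -> R) N : L2 Omega (fun x => \sum_(j < N) c j * phi j x).
Proof. by apply: (@L2_sum (fun j x => c j * phi j x)) => j; apply: L2Z; exact: (phi_L2 eigen). Qed.

Let near_L2_lin_comb (c : nat -> R) :
  \forall N \near \oo, L2 Omega (fun x => \sum_(j < N) c j * phi j x).
Proof. by apply: nearW => N; exact: L2_lin_comb. Qed.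

Let phiO_expandable f : L2 Omega f -> expandable mu phiO (f \_ Omega).
Proof.
move=> fL; rewrite /expandable.
have h := (L2cvgP (near_L2_lin_comb (fun j => L2inner Omega f (phi j))) fL).1 (phi_complete eigen fL).
move: (h eventually_filter); apply: cvg_trans; apply: near_eq_cvg; apply: nearW => N.
rewrite (_ : (fun x => _ - f x) \_ Omega = fun x =>
  lin_comb phiO (fun j => ip mu (f \_ Omega) (phiO j)) N x - (f \_ Omega) x)//.
apply/funext => x; rewrite restrictB (lin_comb_phiO (fun j => L2inner Omega f (phi j))); congr (_ - _).
by apply: eq_bigr => j _; rewrite L2innerE.
Qed.

Let lam_ge j : lam 0 <= lam j. Proof. exact: (lam_nondecreasing eigen). Qed.
Let lam0_gt0 : 0 < lam 0. Proof. exact: (lam_gt0 eigen). Qed.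
Let lam_pos j : 0 < lam j. Proof. exact: lt_le_trans (lam_ge j). Qed.

(** [get] returns the sum only if there is one. Existence is Riesz-Fischer: since lam j >= lam 0 >
    0, the coefficients are dominated by lam 0 ^- m times those of f and are square summable. *)
Lemma neg_laplacian_inv_coefficient m f : L2 Omega f ->
  L2 Omega (neg_laplacian_inv Omega lam phi m f) /\
  forall j, L2inner Omega (neg_laplacian_inv Omega lam phi m f) (phi j) =
    lam j ^- m * L2inner Omega f (phi j).
Proof.
move=> fL; have fi := (L2_sqint f).1 fL.
pose c j := lam j ^- m * L2inner Omega f (phi j).
rewrite /neg_laplacian_inv; set P := (X in get X).
suff /getPex[gL gcv] : exists g, P g.
  split=> // j; rewrite L2innerE; apply: (@coefficient_of_limit _ _ _ mu phiO phiO_sqint phiO_orthonormal _ c j).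
    exact: (L2_sqint _).1.
  have h := (L2cvgP (near_L2_lin_comb c) gL).1 gcv.
  move: (h eventually_filter); apply: cvg_trans; apply: near_eq_cvg; apply: nearW => N.
  congr (ip mu _ _); apply/funext => x; by rewrite restrictB lin_comb_phiO.
have cs : cvgn (series (fun j => c j ^+ 2)).
  apply: (@series_le_cvg _ _ (fun j => (lam 0 ^- m) ^+ 2 * ip mu (f \_ Omega) (phiO j) ^+ 2)).
  - by move=> j; exact: sqr_ge0.
  - by move=> j; rewrite mulr_ge0 ?sqr_ge0.
  - move=> j; rewrite /c L2innerE exprMn ler_wpM2r ?sqr_ge0//.
    have V0 i : 0 <= lam i ^- m by rewrite invr_ge0 exprn_ge0 ?(ltW (lam_pos i)).
    rewrite lerXn2r ?nnegrE ?V0// lef_pV2 ?posrE ?exprn_gt0//.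
    by rewrite lerXn2r ?nnegrE ?(ltW (lam_pos _)).
  - apply: is_cvg_seriesZ; apply/cvg_ex; exists (ip mu (f \_ Omega) (f \_ Omega)).
    have := Parseval phiO_sqint phiO_orthonormal fi (phiO_expandable fL).
    by under eq_fun do rewrite -(big_mkord xpredT (fun j => ip mu (f \_ Omega) (phiO j) ^+ 2)).
have [g gi gcv] := Riesz_Fischer phiO_sqint phiO_orthonormal cs.
have gL : L2 Omega g by apply/L2_sqint; exact: sqint_restrict.
exists g; split => //.
(* The partial sums vanish outside Omega, so cutting g off there cannot increase the distance to
   them. *)
apply: (L2cvgP (near_L2_lin_comb c) gL).2.
apply: (squeeze_cvgr _ (cvg_cst 0) gcv); apply: nearW => N; rewrite ip_ge0/=.
have lg : sqint mu (fun x => lin_comb phiO c N x - g x).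
  by apply: sqintB => //; exact: sqint_lin_comb.
apply: le_trans (ip_restrict_le lg); rewrite le_eqVlt; apply/orP; left; apply/eqP.
congr (ip mu _ _); apply/funext => x; rewrite !patchE; case: ifPn => // xO; congr (_ - _);
  by apply: eq_bigr => j _; rewrite /phiO patchE xO.
Qed.

Lemma L2_asymptotics m p C al K (u : R -> 'rV[R]_n -> R) v : 0 < al -> 0 <= K ->
  L2 Omega v -> (forall t, 0 < t -> L2 Omega (u t)) ->
  (forall j t, 0 < t -> `|t `^ p * mode Omega phi u j t -
     C * (lam j ^- m * L2inner Omega v (phi j))| <= K * t `^ (- al) * `|L2inner Omega v (phi j)|) ->
  L2cvg Omega +oo (fun t x => t `^ p * u t x) (fun x => C * neg_laplacian_inv Omega lam phi m v x).
Proof.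
move=> al0 K0 vL uL est.
have [gL gc] := neg_laplacian_inv_coefficient m vL.
have ut : \forall t \near +oo, L2 Omega (fun x => t `^ p * u t x).
  near=> t; apply: L2Z; apply: uL; near: t; exact: nbhs_pinfty_gt.
apply/(L2cvgP ut (L2Z C gL)).
set V := ip mu (v \_ Omega) (v \_ Omega).
have c0 : (K * t `^ (- al)) ^+ 2 * V @[t --> +oo] --> 0.
  rewrite -(mul0r V); apply: cvgMl.
  rewrite (_ : 0 = (K * 0) * (K * 0)); last by rewrite !mulr0.
  by apply: cvgM; apply: cvgMr; exact: cvg_powRN0.
apply: (squeeze_cvgr _ (cvg_cst 0) c0); near=> t.
have t0 : 0 < t by near: t; exact: nbhs_pinfty_gt.
have hL := L2B (L2Z (t `^ p) (uL t t0)) (L2Z C gL).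
rewrite ip_ge0/=; apply: (Parseval_le phiO_sqint phiO_orthonormal).
- exact: (L2_sqint _).1.
- exact: phiO_expandable.
- exact: (L2_sqint _).1.
- by rewrite mulr_ge0 ?powR_ge0.
move=> j; have := est j t t0; rewrite /mode -gc !L2innerE.
rewrite (_ : (fun x => _ - _) \_ Omega = fun x => t `^ p * (u t \_ Omega) x -
  C * (neg_laplacian_inv Omega lam phi m v \_ Omega) x); last first.
  by apply/funext => x; rewrite restrictB !restrictZ.
have h1 := (L2_sqint _).1 (uL t t0); have h2 := (L2_sqint _).1 gL.
by rewrite (ipBl (sqintZ _ h1) (sqintZ _ h2) (phiO_sqint j)) (ipZl _ h1 (phiO_sqint j)) (ipZl _ h2 (phiO_sqint j)).
Unshelve. all: by end_near. Qed.

End eigenbasis.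

End spectral_limits.

(** * Asymptotics *)

Section mode_asymptotics.
Context {R : realType}.
Variables th q al : R.
Hypothesis th_gt : pi / 2 < th.
Hypothesis thq : th < q.
Hypothesis q_lt : q < pi.
Hypothesis al_gt0 : 0 < al.
Hypothesis alq : al * q < pi.

Lemma mode_sol_le b : -1 < b -> exists2 M : R, 0 <= M &
  forall lam, 0 < lam -> `|mode_sol th al b lam 1| <= M / lam.
Proof.
move=> b1; have b0 : 0 < b + 1 by rewrite -ltrBlDr sub0r.
pose M := pi^-1 * (I (fun x => expR ((b + 1) * x - - cos th * expR x)) / sector_cst (al * q)).
have le lam : 0 < lam -> `|mode_sol th al b lam 1| <= M / lam.
  move=> lam0; have h := mode_sol_decay th_gt thq q_lt (ltW al_gt0) lam0 alq b0.
  rewrite /mode_sol /M normrM ger0_norm ?invr_ge0 ?pi_ge0// -[leRHS]mulrA.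
  by apply: ler_wpM2l h; rewrite invr_ge0 pi_ge0.
(* M is nonnegative because it bounds an absolute value at lam = 1. *)
by exists M => //; have := le 1 ltr01; rewrite divr1; apply: le_trans.
Qed.

Lemma powR_mode_sol a lam p t : -1 < a -> 0 < lam -> 0 < t ->
  t `^ p * mode_sol th al a lam t = t `^ (p + al - a - 1) * mode_sol th al a (lam * t `^ al) 1.
Proof.
move=> a1 lam0 t0; rewrite (mode_sol_scale th_gt thq q_lt (ltW al_gt0) lam0 alq a1 t0).
rewrite mulrA -powRD; first by congr (_ `^ _ * _); ring.
by rewrite (gt_eqF t0) implybT.
Qed.

(** After scaling the product is t^al S_z(1) with z = lam t^al. One expansion leaves the error - S2
    / lam, and |S2| <= M / z supplies both t^(-al) and the additional 1 / lam. *)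
Lemma mode_sol_asymptotics1 a : -1 < a -> exists2 M : R, 0 <= M &
  forall lam t, 0 < lam -> 0 < t ->
    `|t `^ (a + 1) * mode_sol th al a lam t - hankel_pow th (a + 1) * lam ^- 1| <=
    M * lam ^- 2 * t `^ (- al).
Proof.
move=> a1; have a2 : -1 < a + al by rewrite ltr_wpDr// ltW.
have [M M0 hM] := mode_sol_le a2; exists M => // lam t lam0 t0.
have z0 : 0 < lam * t `^ al by rewrite mulr_gt0 ?powR_gt0.
rewrite powR_mode_sol// (_ : a + 1 + al - a - 1 = al); last by ring.
have e := mode_sol_expansion th_gt thq q_lt (ltW al_gt0) z0 alq a1.
move: (hM _ z0) e; rewrite powRN.
move: (t `^ al) (powR_gt0 al t0) => s s0 in z0 *.
move: (mode_sol _ _ _ _ _) (mode_sol _ _ _ _ _) (hankel_pow _ _) => S S2 h hS e.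
have -> : s * S - h * lam ^- 1 = lam^-1 * - S2.
  have -> : S2 = h - lam * s * S by rewrite e; ring.
  by field; rewrite gt_eqF.
rewrite normrM normrN ger0_norm ?invr_ge0 ?(ltW lam0)//.
have -> : M * lam ^- 2 * s^-1 = lam^-1 * (M / (lam * s)) by field; rewrite !gt_eqF.
by rewrite ler_wpM2l// invr_ge0 ltW.
Qed.

(** As the first coefficient is 0, two expansions give t^(2 al) S_z(1) = (S3 - h) / lam^2 with h the
    second Hankel coefficient and |S3| <= M / z. *)
Lemma mode_sol_asymptotics2 a : -1 < a -> hankel_pow th (a + 1) = 0 -> exists2 M : R, 0 <= M &
  forall lam t, 0 < lam -> 0 < t ->
    `|t `^ (al + a + 1) * mode_sol th al a lam t - (- hankel_pow th (a + al + 1)) * lam ^- 2| <=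
    M * lam ^- 3 * t `^ (- al).
Proof.
move=> a1 h0; have a2 : -1 < a + al by rewrite ltr_wpDr// ltW.
have a3 : -1 < a + al + al by rewrite ltr_wpDr// ltW.
have [M M0 hM] := mode_sol_le a3; exists M => // lam t lam0 t0.
have z0 : 0 < lam * t `^ al by rewrite mulr_gt0 ?powR_gt0.
rewrite powR_mode_sol// (_ : al + a + 1 + al - a - 1 = al + al); last by ring.
rewrite powRD; last by rewrite (gt_eqF t0) implybT.
have e := mode_sol_expansion th_gt thq q_lt (ltW al_gt0) z0 alq a1.
have e2 := mode_sol_expansion th_gt thq q_lt (ltW al_gt0) z0 alq a2.
move: (hM _ z0) e e2; rewrite h0 powRN.
move: (t `^ al) (powR_gt0 al t0) => s s0 in z0 *.
move: (mode_sol _ _ _ _ _) (mode_sol _ _ _ _ _) (mode_sol _ _ _ _ _) (hankel_pow _ _).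
move=> S2 S S3 h hS e e2.
have -> : s * s * S - - h * lam ^- 2 = lam ^- 2 * S3.
  have -> : S3 = h - lam * s * S2 by rewrite e2; ring.
  have -> : S2 = - (lam * s * S) by rewrite e; ring.
  by field; rewrite gt_eqF.
rewrite normrM ger0_norm ?invr_ge0 ?exprn_ge0 ?(ltW lam0)//.
have -> : M * lam ^- 3 * s^-1 = lam ^- 2 * (M / (lam * s)) by field; rewrite !gt_eqF.
by rewrite ler_wpM2l// invr_ge0 exprn_ge0// ltW.
Qed.

Variables (n : nat) (Omega : set 'rV[R]_n) (B : ('rV[R]_n -> R) -> 'rV[R]_n -> R).
Variables (lam : nat -> R) (phi : nat -> 'rV[R]_n -> R).
Hypothesis mOmega : measurable Omega.
Hypothesis eigen : laplace_eigenbasis Omega B lam phi.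

(** The error carries one more power of 1 / l than the limit, and all these powers are at most lam 0
    ^- m.+1; positivity of the lowest eigenvalue is what makes the estimate uniform in j. *)
Lemma L2_mode_asymptotics m p a C (u : R -> 'rV[R]_n -> R) v :
  L2 Omega v -> (forall t, 0 < t -> L2 Omega (u t)) ->
  (forall j t, 0 < t ->
    mode Omega phi u j t = L2inner Omega v (phi j) * mode_sol th al a (lam j) t) ->
  (exists2 M : R, 0 <= M & forall l t, 0 < l -> 0 < t ->
    `|t `^ p * mode_sol th al a l t - C * l ^- m| <= M * l ^- m.+1 * t `^ (- al)) ->
  L2cvg Omega +oo (fun t x => t `^ p * u t x) (fun x => C * neg_laplacian_inv Omega lam phi m v x).
Proof.
move=> vL uL um [M M0 hM]; have l0 := lam_gt0 eigen.
have V0 : 0 <= lam 0 ^- m.+1 by rewrite invr_ge0 exprn_ge0// ltW.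
apply: (L2_asymptotics mOmega eigen al_gt0 (mulr_ge0 M0 V0) vL uL) => j t t0.
have lj := lam_nondecreasing eigen (leq0n j); have lj0 := lt_le_trans l0 lj.
rewrite um//; set c := L2inner _ _ _.
rewrite (_ : _ - _ = (t `^ p * mode_sol th al a (lam j) t - C * lam j ^- m) * c); last by ring.
rewrite normrM ler_wpM2r// (le_trans (hM _ _ lj0 t0))// ler_wpM2r ?powR_ge0// ler_wpM2l//.
by rewrite lef_pV2 ?posrE ?exprn_gt0// lerXn2r ?nnegrE ?(ltW lj0) ?(ltW l0).
Qed.

End mode_asymptotics.

Lemma open_measurable_rV {R : realType} n (U : set 'rV[R]_n) : open U -> measurable U.
Proof. by move=> oU; exact: sub_sigma_algebra. Qed.

Lemma sector_angles {R : realType} (al : R) : 0 < al < 2 ->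
  exists th q : R, [/\ pi / 2 < th, th < q, q < pi & al * q < pi].
Proof.
move=> /andP[a0 a2]; have p0 := @pi_gt0 R.
have m1 : al / 2 < 1 by rewrite ltr_pdivrMr// mul1r.
(* With this d, al q = pi (1 - (2 - al)^2 / 4), which is below pi, and q < pi because al > 0. *)
pose d : R := (2 - al) / 8; exists (pi * (1 / 2 + d)), (pi * (1 / 2 + 2 * d)); rewrite /d.
split.
- by rewrite ltr_pM2l//; lra.
- by rewrite ltr_pM2l//; lra.
- by rewrite -[ltRHS]mulr1 ltr_pM2l//; lra.
- rewrite mulrCA -[ltRHS]mulr1 ltr_pM2l//; nra.
Qed.

Theorem theorem9 (R : realType) (n : nat) (Omega : set 'rV[R]_n)
    (B : ('rV[R]_n -> R) -> 'rV[R]_n -> R)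
    (lam : nat -> R) (phi : nat -> 'rV[R]_n -> R) (alpha : R)
    (n_gt0 : (0 < n)%N)
    (Omega_dom : bounded_domain Omega)
    (eigen : laplace_eigenbasis Omega B lam phi)
    (alpha_range : 0 < alpha < 1 \/ 1 < alpha < 2) :
  [/\ forall (v0 : 'rV[R]_n -> R) (u0 : R -> 'rV[R]_n -> R),
        L2 Omega v0 ->
        diffusion_solution Omega lam phi Caputo alpha 0 1 v0 u0 ->
        L2cvg Omega +oo (fun t x => t `^ alpha * u0 t x)
          (fun x => (Gamma (1 - alpha))^-1
                    * neg_laplacian_inv Omega lam phi 1 v0 x),
      1 < alpha ->
      forall (v1 : 'rV[R]_n -> R) (u1 : R -> 'rV[R]_n -> R),
        L2 Omega v1 ->
        diffusion_solution Omega lam phi Caputo alpha 1 0 v1 u1 ->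
        L2cvg Omega +oo (fun t x => t `^ (alpha - 1) * u1 t x)
          (fun x => (Gamma (2 - alpha))^-1
                    * neg_laplacian_inv Omega lam phi 1 v1 x),
      forall (va1 : 'rV[R]_n -> R) (ua1 : R -> 'rV[R]_n -> R),
        L2 Omega va1 ->
        diffusion_solution Omega lam phi RiemannLiouville alpha
          (alpha - 1) (alpha - 2) va1 ua1 ->
        L2cvg Omega +oo (fun t x => t `^ (alpha + 1) * ua1 t x)
          (fun x => - (Gamma (- alpha))^-1
                    * neg_laplacian_inv Omega lam phi 2 va1 x) &
      1 < alpha ->
      forall (va2 : 'rV[R]_n -> R) (ua2 : R -> 'rV[R]_n -> R),
        L2 Omega va2 ->
        diffusion_solution Omega lam phi RiemannLiouville alpha
          (alpha - 2) (alpha - 1) va2 ua2 ->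
        L2cvg Omega +oo (fun t x => t `^ (alpha + 2) * ua2 t x)
          (fun x => - (Gamma (- 1 - alpha))^-1
                    * neg_laplacian_inv Omega lam phi 2 va2 x)].
Proof.
have a02 : 0 < alpha < 2 by case: alpha_range => /andP[h1 h2]; apply/andP; split; lra.
have a0 : 0 < alpha by case/andP: a02.
have [th [q [th_gt thq q_lt alq]]] := sector_angles a02.
have mOmega : measurable Omega by case: Omega_dom => oO _ _ _; exact: open_measurable_rV.
have lam_pos j : 0 < lam j by rewrite (lt_le_trans (lam_gt0 eigen))// (lam_nondecreasing eigen).
have a12 : 1 < alpha -> 1 < alpha < 2 by case/andP: a02 => _ -> ->.
have L := L2_mode_asymptotics (th := th) a0 mOmega eigen.
have hankel : forall m, 0 < m -> hankel_pow th m = (Gamma (1 - m))^-1 := hankel_powE th_gt thq q_lt.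
split.
- move=> v u vL [uL um _].
  have a1 : - 1 < alpha - 1 by rewrite ltrBrDr addNr.
  apply: (L _ _ (alpha - 1) _ _ _ vL uL) => [j|].
    exact: (mode_solution_Caputo0 th_gt thq q_lt alq (lam_pos j) alpha_range (um j)).
  by have := mode_sol_asymptotics1 th_gt thq q_lt a0 alq a1; rewrite !subrK hankel.
- move=> /a12 al12 v u vL [uL um _]; have /andP[al1 al2] := al12.
  have a1 : - 1 < alpha - 2 by lra.
  apply: (L _ _ (alpha - 2) _ _ _ vL uL) => [j|].
    exact: (mode_solution_Caputo1 th_gt thq q_lt alq (lam_pos j) al12 (um j)).
  have := mode_sol_asymptotics1 th_gt thq q_lt a0 alq a1.
  rewrite (_ : alpha - 2 + 1 = alpha - 1); last by ring.
  by rewrite hankel ?subr_gt0// (_ : 1 - (alpha - 1) = 2 - alpha)//; ring.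
- move=> v u vL [uL um _].
  apply: (L _ _ 0 _ _ _ vL uL) => [j|].
    exact: (mode_solution_RL1 th_gt thq q_lt alq (lam_pos j) alpha_range (um j)).
  (* The pole of Gamma at 0 removes the term of order 1 / t, so the second term decides. *)
  have h0 : hankel_pow th (0 + 1) = 0 by rewrite add0r hankel// subrr Gamma0 invr0.
  have := mode_sol_asymptotics2 th_gt thq q_lt a0 alq (ltrN10 _) h0.
  rewrite addr0 add0r (hankel (alpha + 1)) ?addr_gt0//.
  by rewrite (_ : 1 - (alpha + 1) = - alpha)//; ring.
- move=> /a12 al12 v u vL [uL um _]; have /andP[al1 al2] := al12.
  apply: (L _ _ 1 _ _ _ vL uL) => [j|].
    exact: (mode_solution_RL2 th_gt thq q_lt alq (lam_pos j) al12 (um j)).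
  (* Likewise at the pole - 1 of Gamma, reached from 0 by the recurrence. *)
  have h0 : hankel_pow th (1 + 1) = 0.
    rewrite hankel ?addr_gt0// opprD addrA subrr add0r Gamma_rec ?oppr_lt0//.
    by rewrite addNr Gamma0 mul0r invr0.
  have := mode_sol_asymptotics2 th_gt thq q_lt a0 alq (lt_trans (ltrN10 _) ltr01) h0.
  rewrite (_ : alpha + 1 + 1 = alpha + 2); last by ring.
  rewrite (_ : 1 + alpha + 1 = alpha + 2); last by ring.
  rewrite (hankel (alpha + 2)) ?addr_gt0//.
  by rewrite (_ : 1 - (alpha + 2) = - 1 - alpha)//; ring.
Qed.
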